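(* Let $(\mathrm{r},\boldsymbol{z}^h,\widehat{\boldsymbol z}_t^h)\in L^2(\mathcal{T}_h)^{d\times d}\times \boldsymbol{V}_h^{\mathrm{div}}\times \boldsymbol{M}_h^t$ satisfy $$(\mathrm{r},\mathrm{g}^h)_{\mathcal{T}_h}-(\nabla\boldsymbol{z}^h,\mathrm{g}^h)_{\mathcal{T}_h}+\langle \mathrm{tr}_t(\boldsymbol z^h)-\widehat{\boldsymbol z}_t^h,\ \mathrm{tr}_t(\mathrm{g}^h\boldsymbol n)\rangle_{\partial\mathcal{T}_h}=0\qquad\text{for all }\mathrm{g}^h\in\mathcal{G}_h .$$ Then $$\Big(\sum_{K\in\mathcal{T}_h}\|\nabla\boldsymbol z^h\|_K^2+\sum_{F\in\mathcal{E}_h}h_F^{-1}\|\mathrm{tr}_t(\boldsymbol z^h)-\widehat{\boldsymbol z}_t^h\|_F^2\Big)^{1/2}\le C\,\|\mathrm{r}\|_{\mathcal{T}_h},$$ with a constant $C$ that depends only on the polynomial degree $k$ and the shape-regularity of the elements $K\in\mathcal{T}_h$.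
   Context: Mesh. $d\in\{2,3\}$; $\Omega\subset\mathbb{R}^d$ is a polygon ($d=2$) or polyhedron ($d=3$). $\mathcal{T}_h$ is a shape-regular conforming triangulation of $\Omega$ into affine-mapped simplices, or into affine-mapped hypercubes; $\mathcal{E}_h$ is the set of facets (edges if $d=2$, faces if $d=3$) of the elements, $\mathcal{F}(K)$ the set of facets of $K$, $h_F=\mathrm{diam}(F)$. $\underline{K}$ is the reference simplex/hypercube, $\underline{F}$ the reference facet, $\Phi_K:\underline K\to K$ and $\Phi_F:\underline F\to F$ the affine mappings, $\Phi_K'$ the Jacobian matrix of $\Phi_K$. $\boldsymbol n$ is the unit outward normal on $\partial K$. Traces. On a facet $F$ with unit normal $\boldsymbol n_F$: $\mathrm{tr}_n(\boldsymbol v)=(\boldsymbol v\cdot\boldsymbol n_F)\boldsymbol n_F$ and $\mathrm{tr}_t(\boldsymbol v)=\boldsymbol v-(\boldsymbol v\cdot\boldsymbol n_F)\boldsymbol n_F$ (restricted to $F$), for vector functions on $K$ or on $F$. Reference spaces ($k\ge0$ fixed). $\mathcal P_k(D)$: polynomials of degree $\le k$ on $D$; $\widetilde{\mathcal P}_k$: homogeneous polynomials of degree $k$. - Simplex: $\mathcal G^{\mathrm{row}}(\underline K)=\mathcal P_k(\underline K)^d$, $\boldsymbol V(\underline K)=\mathcal P_k(\underline K)^d\oplus\boldsymbol x\,\widetilde{\mathcal P}_k(\underline K)$. - Hypercube: $\mathcal G^{\mathrm{row}}(\underline K)=\mathcal P_k(\underline K)^d\oplus \mathrm{span}\,\nabla\times\{xy^{k+1},yx^{k+1}\}$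 if $d=2$, and $\mathcal P_k(\underline K)^d\oplus\nabla\times\{x\widetilde{\mathcal P}_k(y,z)(y\nabla z-z\nabla y),\ y\widetilde{\mathcal P}_k(z,x)(z\nabla x-x\nabla z),\ z\widetilde{\mathcal P}_k(x,y)(x\nabla y-y\nabla x)\}$ (span of these) if $d=3$; $\boldsymbol V(\underline K)=\mathcal P_k(\underline K)^d\oplus(x_1\widetilde{\mathcal P}_k(\underline K),\dots,x_d\widetilde{\mathcal P}_k(\underline K))^T$ (independent polynomials in each component). - In both cases $\boldsymbol M(\underline F)=\mathcal P_k(\underline F)^d$. Mapped spaces. $\mathcal G^{\mathrm{row}}(K)$ and $\boldsymbol V(K)$ are the images of the reference spaces under the Piola map $\underline{\boldsymbol v}\mapsto \frac{1}{\det\Phi_K'}\Phi_K'\,\underline{\boldsymbol v}\circ\Phi_K^{-1}$; $\boldsymbol M(F)=\{\underline{\widehat{\boldsymbol v}}\circ\Phi_F^{-1}:\underline{\widehat{\boldsymbol v}}\in\boldsymbol M(\underline F)\}$; $\mathcal G(K)$ is the space of $d\times d$ tensor functions each of whose rows lies in $\mathcal G^{\mathrm{row}}(K)$. Global spaces. $\mathcal G_h=\{\mathrm g\in L^2(\mathcal{T}_h)^{d\times d}:\mathrm g|_K\in\mathcal G(K)\ \forall K\in\mathcal{T}_h\}$; $\boldsymbol V_h^{\mathrm{div}}=\{\boldsymbol v\in H(\mathrm{div};\Omega):\boldsymbol v|_K\in\boldsymbol V(K)\ \forall K\}$; $\boldsymbol M_h^t=\{\widehat{\boldsymbol v}\in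 L^2(\mathcal E_h)^d:\widehat{\boldsymbol v}|_F\in\boldsymbol M(F),\ \mathrm{tr}_n(\widehat{\boldsymbol v})|_F=0\ \forall F\in\mathcal E_h\}$. Notation. $(\cdot,\cdot)_{\mathcal{T}_h}=\sum_K(\cdot,\cdot)_K$ and $\langle\cdot,\cdot\rangle_{\partial\mathcal{T}_h}=\sum_K\langle\cdot,\cdot\rangle_{\partial K}$ are sums of elementwise $L^2$ inner products on $K$ and on $\partial K$; $\|\cdot\|_{\mathcal{T}_h}$ is the corresponding $L^2$-norm. $\nabla$ of a vector function is taken elementwise and row by row. In the sum over $F\in\mathcal E_h$, an interior facet contributes the terms from both adjacent elements (each element's trace of $\boldsymbol z^h$). *)

(* Defs.v *)
From HB Require Import structures.
From mathcomp Require Import all_boot all_order all_algebra.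
(* The notations of [mpoly] clash with those of MathComp-Analysis, and its
   [isMeasure] must not shadow the one of measure theory. *)
From mathcomp Require Import -(notations) mpoly.
From mathcomp Require Import all_classical all_reals all_analysis.

Set Implicit Arguments.
Unset Strict Implicit.
Unset Printing Implicit Defensive.
Import Order.TTheory GRing.Theory Num.Theory.
Import numFieldNormedType.Exports.

Local Open Scope classical_set_scope.
Local Open Scope ring_scope.

(** * Lebesgue measure on R^n *)

Section lebesgue.
Context {R : realType}.
Local Open Scope ereal_scope.

Definition tcons n (p : R * n.-tuple R) : n.+1.-tuple R :=
  [the n.+1.-tuple R of p.1 :: p.2].

Fixpoint lebesgue_tuple n : set (n.-tuple R) -> \bar R :=
  match n with
  | 0 => \d_([tuple] : 0.-tuple R)
  | m.+1 => pushforward (lebesgue_measure \x @lebesgue_tuple m) (@tcons m)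
  end.

Lemma measurable_tcons n : measurable_fun setT (@tcons n).
Proof. by apply: measurable_cons; [exact: measurable_fst|exact: measurable_snd]. Qed.

Lemma lebesgue_tuple_measure n :
  exists m : {sigma_finite_measure set (n.-tuple R) -> \bar R},
    lebesgue_tuple (n := n) = m :> (set (n.-tuple R) -> \bar R).
Proof.
elim: n => [|n [m IH]]; first by exists (\d_([tuple] : 0.-tuple R)).
pose nu := pushforward (lebesgue_measure \x m) (@tcons n).
have sf : sigma_finite setT nu.
  have /sigma_finiteP[F [FT Fnd FE]] :=
    sigma_finiteT (@lebesgue_measure R : {sigma_finite_measure set _ -> \bar R}).
  have /sigma_finiteP[G [GT Gnd GE]] := sigma_finiteT m.
  exists (fun i => [set t | F i (thead t) /\ G i [tuple of behead t]]).
    apply/seteqP; split=> // t _.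
    have : setT (thead t) by [].
    have : setT [tuple of behead t] by [].
    rewrite FT GT => -[i _ Gi] [j _ Fj].
    exists (maxn i j) => //; split.
      by move: Fj; apply/subsetPset/Fnd; rewrite leq_maxr.
    by move: Gi; apply/subsetPset/Gnd; rewrite leq_maxl.
  move=> i; split.
    apply: measurableI.
      rewrite -[X in measurable X]setTI; apply: (measurable_tnth ord0) => //.
      exact: (FE i).1.
    rewrite -[X in measurable X]setTI; apply: measurable_behead => //.
    exact: (GE i).1.
  rewrite /nu /pushforward [X in (_ \x _) X](_ : _ = F i `*` G i).
    rewrite product_measure1E//; [|exact: (FE i).1|exact: (GE i).1].
    by rewrite lte_mul_pinfty// ?(FE i).2 ?(GE i).2// ge0_fin_numE// (FE i).2.
  apply/seteqP; split=> -[x t]/=; rewrite theadE.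
    have -> : [tuple of behead (tcons (x, t))] = t by apply/val_inj.
    by [].
  have -> : [tuple of behead (tcons (x, t))] = t by apply/val_inj.
  by [].
have mf := @measurable_tcons n.
pose nu_sf := HB.pack_for {sigma_finite_measure set (n.+1.-tuple R) -> \bar R}
  nu (Measure_isSigmaFinite.Build _ _ _ nu sf).
by exists (nu_sf mf mf mf); rewrite /= IH.
Qed.

Let lebesgue_tuple0 n : lebesgue_tuple (n := n) set0 = 0.
Proof. by have [m ->] := lebesgue_tuple_measure n. Qed.

Let lebesgue_tuple_ge0 n A : 0 <= lebesgue_tuple (n := n) A.
Proof. by have [m ->] := lebesgue_tuple_measure n. Qed.

Let lebesgue_tuple_additive n :
  semi_sigma_additive (@lebesgue_tuple n).
Proof.
have [m ->] := lebesgue_tuple_measure n; exact: measure_semi_sigma_additive.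
Qed.

HB.instance Definition _ n := isMeasure.Build _ _ _ (@lebesgue_tuple n)
  (@lebesgue_tuple0 n) (@lebesgue_tuple_ge0 n) (@lebesgue_tuple_additive n).

Let lebesgue_tuple_sigma_finite n : sigma_finite setT (@lebesgue_tuple n).
Proof. have [m ->] := lebesgue_tuple_measure n; exact: sigma_finiteT. Qed.

HB.instance Definition _ n := Measure_isSigmaFinite.Build _ _ _
  (@lebesgue_tuple n) (@lebesgue_tuple_sigma_finite n).

End lebesgue.

Section lebesgue_integral.
Context {R : realType}.

Definition vec n (t : n.-tuple R) : 'cV[R]_n := \col_i tnth t i.

Definition integral_on n (D : set 'cV[R]_n) (f : 'cV[R]_n -> R) : R :=
  \int[@lebesgue_tuple R n]_(t in @vec n @^-1` D) f (vec t).

Definition L2 n (D : set 'cV[R]_n) (f : 'cV[R]_n -> R) : Prop :=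
  measurable_fun (@vec n @^-1` D) (f \o @vec n) /\
  (\int[@lebesgue_tuple R n]_(t in @vec n @^-1` D) (f (vec t) ^+ 2)%:E < +oo)%E.

End lebesgue_integral.

(** * Euclidean geometry and affine maps *)

Section geometry.
Context {R : realType}.

(* Frobenius product; the Euclidean dot product on column vectors. *)
Definition dot m n (A B : 'M[R]_(m, n)) : R := \sum_i \sum_j A i j * B i j.

(* The library norm [`|A|] is the sup norm. *)
Definition enorm m n (A : 'M[R]_(m, n)) : R := Num.sqrt (dot A A).

Definition diam n (A : set 'cV[R]_n) : R :=
  sup [set enorm (x - y) | x in A & y in A].

Definition inscribed_diam n (A : set 'cV[R]_n) : R :=
  sup [set 2 * r | r in
    [set r | 0 <= r /\ exists c : 'cV[R]_n, [set x | enorm (x - c) <= r] `<=` A]].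

Record affine m n := Affine { linpart : 'M[R]_(n, m); origin : 'cV[R]_n }.

Definition affine_fun m n (f : affine m n) (x : 'cV[R]_m) : 'cV[R]_n :=
  linpart f *m x + origin f.

Coercion affine_fun : affine >-> Funclass.

Definition frontier n (A : set 'cV[R]_n) := closure A `\` interior A.

(* Equality with the interior of the closure excludes slits. *)
Definition polytope n (Omega : set 'cV[R]_n) : Prop :=
  [/\ open Omega, Omega !=set0, bounded_set Omega,
      interior (closure Omega) = Omega &
      exists hs : seq ('cV[R]_n * R),
        (forall h, h \in hs -> h.1 != 0) /\
        forall x, frontier Omega x -> exists2 h, h \in hs & dot h.1 x = h.2].

End geometry.

(** * Reference elements and triangulations *)

Inductive cell_shape := simplex | hypercube.

Definition ref_cell {R : realType} (s : cell_shape) n : set 'cV[R]_n :=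
  match s with
  | simplex => [set x : 'cV[R]_n | (forall i, 0 <= x i 0) /\ \sum_i x i 0 <= 1]
  | hypercube => [set x : 'cV[R]_n | forall i, 0 <= x i 0 <= 1]
  end.
Arguments ref_cell {R} s n.

Definition ref_facets {R : realType} (s : cell_shape) n : set (set 'cV[R]_n) :=
  match s with
  | simplex =>
      [set A | (exists i, A = ref_cell s n `&` [set x : 'cV[R]_n | x i 0 = 0]) \/
               A = ref_cell s n `&` [set x : 'cV[R]_n | \sum_i x i 0 = 1]]
  | hypercube =>
      [set A | exists i (b : bool),
                 A = ref_cell s n `&` [set x : 'cV[R]_n | x i 0 = b%:R]]
  end.
Arguments ref_facets {R} s n.

Section mesh.
Context {R : realType}.

Definition facets_of (s : cell_shape) n (Phi : affine (R := R) n n) :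
    set (set 'cV[R]_n) :=
  [set Phi @` A | A in ref_facets s n].

(* The proper faces of a polytope (vertices, edges, facets) are the
   intersections of its facets. *)
Definition is_face (s : cell_shape) n (Phi : affine (R := R) n n)
    (E : set 'cV[R]_n) : Prop :=
  exists Fs : set (set 'cV[R]_n),
    [/\ Fs !=set0, Fs `<=` facets_of s Phi & E = \bigcap_(A in Fs) A].

Record triangulation (s : cell_shape) d (Omega : set 'cV[R]_d) := Triangulation {
  elt : finType;
  facet : finType;
  PhiK : elt -> affine (R := R) d d;
  PhiF : facet -> affine (R := R) d.-1 d;
  PhiK_unit : forall K, linpart (PhiK K) \in unitmx;
  PhiF_rank : forall F, \rank (linpart (PhiF F)) = d.-1;
  cells_cover : closure Omega = \bigcup_(K in setT) (PhiK K @` ref_cell s d);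
  conforming : forall K K', K != K' ->
    let E := (PhiK K @` ref_cell s d) `&` (PhiK K' @` ref_cell s d) in
    E = set0 \/ is_face s (PhiK K) E /\ is_face s (PhiK K') E;
  facet_sets : [set PhiF F @` ref_cell s d.-1 | F in setT] =
               \bigcup_(K in setT) facets_of s (PhiK K);
  facet_inj : injective (fun F => PhiF F @` ref_cell s d.-1) }.

Section mesh_notions.
Variables (s : cell_shape) (d : nat) (Omega : set 'cV[R]_d).
Variable T : triangulation s Omega.
Implicit Types (K : elt T) (F : facet T).

Definition cell K : set 'cV[R]_d := PhiK K @` ref_cell s d.

Definition fset_of F : set 'cV[R]_d := PhiF F @` ref_cell s d.-1.

Definition facet_of K F : bool := `[< facets_of s (PhiK K) (fset_of F) >].

Definition hF F : R := diam (fset_of F).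

Definition shape_regular (sigma : R) : Prop :=
  forall K, diam (cell K) <= sigma * inscribed_diam (cell K).

(* A unit normal of F; its sign is irrelevant in the traces. *)
Definition nF F : 'cV[R]_d :=
  xget 0 [set n : 'cV[R]_d | enorm n = 1 /\
    forall x y, fset_of F x -> fset_of F y -> dot n (x - y) = 0].

(* The unit outward normal of K on its facet F, as the unit vector of a
   supporting half-space of the convex set K along F. *)
Definition outward_normal K F : 'cV[R]_d :=
  xget 0 [set n : 'cV[R]_d | enorm n = 1 /\
    forall x y, fset_of F x -> cell K y -> dot n (y - x) <= 0].

Definition tr_n F (v : 'cV[R]_d) : 'cV[R]_d := dot v (nF F) *: nF F.

Definition tr_t F (v : 'cV[R]_d) : 'cV[R]_d := v - tr_n F v.

(* Surface integral through the affine parametrization of F, with its Gram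
   determinant. *)
Definition integral_facet F (f : 'cV[R]_d -> R) : R :=
  let B := linpart (PhiF F) in
  Num.sqrt (\det (B^T *m B)) *
  integral_on (ref_cell s d.-1) (fun y => f (PhiF F y)).

End mesh_notions.
End mesh.

(** * Polynomial spaces *)

Section polynomials.
Context {R : realType}.

Local Notation "''X_' i" := (mpolyX R (mnm1 i)).
Local Notation "p ^`d ( i )" := (mderiv i p) (at level 2, format "p ^`d ( i )").

Definition poly_le k n (p : mpoly n R) : Prop := (mmeasure mdeg p <= k.+1)%N.

Definition poly_homog k n (p : mpoly n R) : Prop := p \is ishomog1 k mdeg.

Definition eval_vec m n (v : 'I_m -> mpoly n R) (x : 'cV[R]_n) : 'cV[R]_m :=
  \col_i meval (fun j => x j 0) (v i).

Definition curl2 (phi : mpoly 2 R) : 'I_2 -> mpoly 2 R :=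
  tnth [tuple phi^`d(1); - phi^`d(0)].

Definition curl3 (w : 'I_3 -> mpoly 3 R) : 'I_3 -> mpoly 3 R :=
  tnth [tuple (w 2)^`d(1) - (w 1)^`d(2);
              (w 0)^`d(2) - (w 2)^`d(0);
              (w 1)^`d(0) - (w 0)^`d(1)].

(* The space spanned by the curls that enrich P_k^d on the hypercube. In
   dimension 3, [y * grad z - z * grad y] is the vector [(0, -z, y)], and
   cyclically; the q's range over homogeneous polynomials in two of the
   coordinates. *)
Definition curl_space k d : ('I_d -> mpoly d R) -> Prop :=
  match d return ('I_d -> mpoly d R) -> Prop with
  | 2 => fun v =>
      let x := 'X_(0 : 'I_2) in let y := 'X_(1 : 'I_2) in
      exists a b : R, forall i,
        v i = a *: curl2 (x * y ^+ k.+1) i + b *: curl2 (y * x ^+ k.+1) i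
  | 3 => fun v =>
      let x := 'X_(0 : 'I_3) in let y := 'X_(1 : 'I_3) in
      let z := 'X_(2 : 'I_3) in
      exists q1 q2 q3 : mpoly 2 R,
        [/\ poly_homog k q1, poly_homog k q2, poly_homog k q3 &
        forall i, v i =
          curl3 (fun j => x * comp_mpoly [tuple y; z] q1 *
                          tnth [tuple 0; - z; y] j) i +
          curl3 (fun j => y * comp_mpoly [tuple z; x] q2 *
                          tnth [tuple z; 0; - x] j) i +
          curl3 (fun j => z * comp_mpoly [tuple x; y] q3 *
                          tnth [tuple - y; x; 0] j) i]
  | _ => fun v => forall i, v i = 0
  end.

Definition ref_Grow (s : cell_shape) k d (v : 'I_d -> mpoly d R) : Prop :=
  match s with
  | simplex => forall i, poly_le k (v i)
  | hypercube =>
      exists p c, [/\ forall i, poly_le k (p i), curl_space k c &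
                       forall i, v i = p i + c i]
  end.

Definition ref_V (s : cell_shape) k d (v : 'I_d -> mpoly d R) : Prop :=
  match s with
  | simplex =>
      exists p q, [/\ forall i, poly_le k (p i), poly_homog k q &
                       forall i, v i = p i + 'X_i * q]
  | hypercube =>
      exists p q, [/\ forall i, poly_le k (p i), forall i, poly_homog k (q i) &
                       forall i, v i = p i + 'X_i * q i]
  end.

Definition piola d (Phi : affine (R := R) d d) (v : 'cV[R]_d -> 'cV[R]_d)
    (x : 'cV[R]_d) : 'cV[R]_d :=
  let J := linpart Phi in
  (\det J)^-1 *: (J *m v (invmx J *m (x - origin Phi))).

End polynomials.

(** * Function spaces on a triangulation *)

Section spaces.
Context {R : realType}.

Definition partial d (f : 'cV[R]_d -> R) (j : 'I_d) (x : 'cV[R]_d) : R :=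
  'D_(delta_mx j 0) f x.

(* [grad v x] has the gradients of the components of [v] as rows. *)
Definition grad m d (v : 'cV[R]_d -> 'cV[R]_m) (x : 'cV[R]_d) : 'M[R]_(m, d) :=
  \matrix_(i, j) partial (fun y => v y i 0) j x.

Definition smooth d (f : 'cV[R]_d -> R) : Prop :=
  forall js : seq 'I_d, let g := foldl (@partial d) f js in
    continuous g /\ forall j x, derivable g x (delta_mx j 0).

Definition test_function d (Omega : set 'cV[R]_d) (phi : 'cV[R]_d -> R) : Prop :=
  smooth phi /\
  exists A, [/\ compact A, A `<=` Omega & forall x, ~ A x -> phi x = 0].

Definition Hdiv d (Omega : set 'cV[R]_d) (v : 'cV[R]_d -> 'cV[R]_d) : Prop :=
  (forall i, L2 Omega (fun x => v x i 0)) /\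
  exists2 w, L2 Omega w &
    forall phi, test_function Omega phi ->
      integral_on Omega (fun x => \sum_j v x j 0 * partial phi j x) =
      - integral_on Omega (fun x => w x * phi x).

Section on_mesh.
Variables (s : cell_shape) (d : nat) (Omega : set 'cV[R]_d).
Variable T : triangulation s Omega.
Variable k : nat.

(* A function on the triangulation is a family of functions, one per element
   (resp. facet), since it is two-valued on interelement facets. The value of
   a member outside its element is irrelevant, except that piecewise polynomial
   functions are identified with their polynomial extension to R^d, so that
   traces and gradients on the closed element make sense. *)
Definition broken (V : Type) := elt T -> 'cV[R]_d -> V.

Definition glue_mesh (v : broken 'cV[R]_d) (x : 'cV[R]_d) : 'cV[R]_d :=
  if [pick K | `[< cell K x >]] is Some K then v K x else 0.

Definition L2_mesh m n (g : broken 'M[R]_(m, n)) : Prop :=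
  forall K i j, L2 (cell K) (fun x => g K x i j).

Definition Grow_elt (K : elt T) (w : 'cV[R]_d -> 'cV[R]_d) : Prop :=
  exists2 v, ref_Grow s k v & w =1 piola (PhiK K) (eval_vec v).

Definition G_elt (K : elt T) (g : 'cV[R]_d -> 'M[R]_d) : Prop :=
  forall i, Grow_elt K (fun x => (row i (g x))^T).

Definition V_elt (K : elt T) (w : 'cV[R]_d -> 'cV[R]_d) : Prop :=
  exists2 v, ref_V s k v & w =1 piola (PhiK K) (eval_vec v).

Definition M_facet (F : facet T) (w : 'cV[R]_d -> 'cV[R]_d) : Prop :=
  exists2 v : 'I_d -> mpoly d.-1 R, (forall i, poly_le k (v i)) &
    forall y, ref_cell s d.-1 y -> w (PhiF F y) = eval_vec v y.

Definition Gh (g : broken 'M[R]_d) : Prop := forall K, G_elt K (g K).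

Definition Vh_div (v : broken 'cV[R]_d) : Prop :=
  (forall K, V_elt K (v K)) /\ Hdiv Omega (glue_mesh v).

Definition Mh_t (w : facet T -> 'cV[R]_d -> 'cV[R]_d) : Prop :=
  forall F, M_facet F (w F) /\ forall x, fset_of F x -> tr_n F (w F x) = 0.

Definition inner_mesh m n (u v : broken 'M[R]_(m, n)) : R :=
  \sum_K integral_on (cell K) (fun x => dot (u K x) (v K x)).

Definition inner_boundary
    (u v : forall (K : elt T) (F : facet T), 'cV[R]_d -> 'cV[R]_d) : R :=
  \sum_K \sum_(F | facet_of K F)
    integral_facet F (fun x => dot (u K F x) (v K F x)).

Definition norm_mesh m n (u : broken 'M[R]_(m, n)) : R :=
  Num.sqrt (inner_mesh u u).

Definition elt_sqnorm m n (K : elt T) (u : 'cV[R]_d -> 'M[R]_(m, n)) : R :=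
  integral_on (cell K) (fun x => enorm (u x) ^+ 2).

Definition facet_sqnorm (F : facet T) (u : 'cV[R]_d -> 'cV[R]_d) : R :=
  integral_facet F (fun x => enorm (u x) ^+ 2).

End on_mesh.
End spaces.

(* Main.v *)
Require Import Defs.
From mathcomp Require Import all_boot all_order all_algebra.
From mathcomp Require Import -(notations) mpoly.
From mathcomp Require Import all_classical all_reals all_analysis.
From mathcomp Require Import measurable_realfun.
From mathcomp Require Import ring lra zify.
Import Order.TTheory GRing.Theory Num.Theory.
Import numFieldNormedType.Exports.
Local Open Scope classical_set_scope.
Local Open Scope ring_scope.
Set Implicit Arguments.
Unset Strict Implicit.
Unset Printing Implicit Defensive.

(** Test functions supported on a single element localize the problem, and the
    affine Piola map turns it into one on the reference element: with zeta the
    pulled-back z^h and delta_l its tangential jump on the facet l, the rows a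
    of the weak form read
      \int grad zeta_a . v = \sum_l c_l \int_l delta_(l, a) (nu_l . v) + (data),
    with positive weights c_l. As (zeta, delta) ranges over a finite-dimensional
    space, it suffices that zero data imply grad zeta = 0 and delta = 0; the
    powers of |J| |J^-1| that the scaling costs are bounded by shape regularity.

    On the simplex, tangentiality makes the identity test give div zeta = 0,
    which removes the Raviart-Thomas part of zeta. Then delta_(i, i) = 0 kills
    all boundary terms for v = (1 - x_1 - ... - x_d) (d_i zeta_i) e_i in row i
    and for v = x_j (d_j zeta_i) (e_j - e_i) in row i, whence grad zeta = 0; the
    weak form then says that the moments of delta_(l, a) on the facets are
    proportional to those on x_a = 0, which vanish.

    On the hypercube, testing with polynomials of degree k is not enough, and
    the fields x_j X^m e_j with |m| = k are not test functions individually. The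
    curls supply one linear relation between their values for each m, and
    integration by parts relates any two of them; together these force all of
    the values to vanish. *)

(** The weights c_l do not see K. With z(Phi y) = J zeta(y) and the test tensor J^-T e_a (J v)^T,
    whose rows are Piola images, the contraction with grad z = J (grad zeta) J^-1 is row a of grad
    zeta times v. On a facet the surface element is |det J| |J^-T nu_l| times a number of the
    reference facet, and |J^-T nu_l| cancels against the normalization of the normal. Only the
    common factor |det J| survives, so one kernel computation per cell shape and dimension serves
    all elements; J returns only in the norms. The obstacle is that zeta has degree k + 1 whereas
    arbitrary test polynomials have degree k. The jump delta has degree k only after zeta is known
    to have it, so tangentiality, nu_l . delta_l = 0, has to be exploited first, through tests whose
    boundary terms vanish whatever the degree of delta. It survives the pull-back because J^-T nu_l
    is normal to the facet of K. The step from a trivial kernel to a bound is an elimination over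
    finitely many test values, which yields the constant without a basis of the space. *)

(** * Affine change of variables for the Lebesgue measure *)

Section affine_substitution_1d.
Context {R : realType}.
Local Open Scope ereal_scope.
Let T := measurableTypeR R.

Lemma measurable_affine1 (a b : R) :
  measurable_fun [set: T] (fun x : T => (a * x + b)%R : T).
Proof. by apply: measurable_funD => //; exact: measurable_funM. Qed.

(** By uniqueness of the Lebesgue measure only half-open intervals matter. For a < 0 the preimage is
    half-open on the other side, which does not change its length. *)
Lemma lebesgue_measure_affine (a b : R) (A : set T) :
  (a != 0)%R -> measurable A ->
  pushforward (mscale (`|a|%:nng)%R (@lebesgue_measure R))
    (fun x : T => (a * x + b)%R : T) A = lebesgue_measure A.
Proof.
move=> a0 mA; apply/esym/lebesgue_measure_unique => //=.
  exact: measurable_affine1.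
move=> ? _ [[u v]] _ <-; rewrite /pushforward /mscale/=.
have na0 : (0 < `|a|)%R by rewrite normr_gt0.
move: (a0); rewrite neq_lt => /orP[a_lt0|a_gt0].
- rewrite [X in _ * lebesgue_measure X](_ : _ = `[(v - b) / a, (u - b) / a[%classic)%R.
    rewrite !lebesgue_measure_itv/= !lte_fin ltr_nM2r ?invr_lt0// ltrD2r.
    case: ifPn => uv; rewrite ?mule0// -!EFinD -EFinM ltr0_norm//; congr EFin.
    by field.
  apply/seteqP; split=> x /=; rewrite !in_itv/= ler_ndivrMr// ltr_ndivlMr// => /andP[h1 h2];
    apply/andP; split; lra.
- rewrite [X in _ * lebesgue_measure X](_ : _ = `]((u - b) / a), ((v - b) / a)]%classic)%R.
    rewrite !lebesgue_measure_itv/= !lte_fin ltr_pM2r ?invr_gt0// ltrD2r.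
    case: ifPn => uv; rewrite ?mule0// -!EFinD -EFinM gtr0_norm//; congr EFin.
    by field.
  apply/seteqP; split=> x /=; rewrite !in_itv/= ltr_pdivrMr// ler_pdivlMr// => /andP[h1 h2];
    apply/andP; split; lra.
Qed.

Lemma integral_lebesgue_affine (a b : R) (f : T -> \bar R) : (a != 0)%R ->
  measurable_fun setT f -> (forall x, 0 <= f x) ->
  \int[@lebesgue_measure R]_x f (a * x + b)%R =
  (`|a|^-1)%:E * \int[@lebesgue_measure R]_x f x.
Proof.
move=> a0 mf f0.
have na0 : (0 < `|a|)%R by rewrite normr_gt0.
have mphi := measurable_affine1 a b.
have -> : \int[lebesgue_measure]_x f x =
    \int[pushforward (mscale (`|a|%:nng)%R (@lebesgue_measure R))
    (fun x : T => (a * x + b)%R : T)]_x f x.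
  by apply: eq_measure_integral => //= A mA _; rewrite lebesgue_measure_affine.
rewrite ge0_integral_pushforward//= preimage_setT ge0_integral_mscale//=.
  by rewrite muleA -EFinM mulVf ?gt_eqF// mul1e.
exact: measurableT_comp.
Qed.

End affine_substitution_1d.

Section affine_substitution.
Context {R : realType}.
Local Open Scope ereal_scope.
Let T := measurableTypeR R.

Definition unvec n (x : 'cV[R]_n) : n.-tuple R := [tuple x i 0%R | i < n].

Lemma vecK n : cancel (@vec R n) (@unvec n).
Proof. by move=> t; apply: eq_from_tnth => i; rewrite tnth_mktuple mxE. Qed.

Lemma unvecK n : cancel (@unvec n) (@vec R n).
Proof. by move=> x; apply/colP => i; rewrite mxE tnth_mktuple. Qed.

Definition aff m n (A : 'M[R]_(n, m)) (b : 'cV[R]_n) (t : m.-tuple R) : n.-tuple R :=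
  unvec (A *m vec t + b)%R.

Lemma vec_aff m n (A : 'M[R]_(n, m)) b t : vec (aff A b t) = (A *m vec t + b)%R.
Proof. exact: unvecK. Qed.

Lemma measurable_aff m n (A : 'M[R]_(n, m)) b : measurable_fun setT (aff A b).
Proof.
apply/measurable_fun_tnthP => i.
rewrite [X in measurable_fun _ X](_ : _ =
    (fun t => \sum_j A i j * tnth t j + b i 0%R)%R); last first.
  apply/funext => t /=; rewrite tnth_mktuple !mxE; congr (_ + _)%R.
  by apply: eq_bigr => j _; rewrite mxE.
apply: measurable_funD; last exact: measurable_cst.
apply: measurable_sum => j; apply: measurable_funM; first exact: measurable_cst.
exact: measurable_tnth.
Qed.

Lemma integral_lebesgue_tupleS n (f : n.+1.-tuple R -> \bar R) :
  measurable_fun setT f -> (forall t, 0 <= f t) ->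
  \int[@lebesgue_tuple R n.+1]_t f t =
  \int[@lebesgue_measure R]_x \int[@lebesgue_tuple R n]_t f (tcons (x, t)).
Proof.
move=> mf f0.
transitivity (\int[pushforward (@lebesgue_measure R \x @lebesgue_tuple R n) (@tcons R n)]_t f t).
  by apply: eq_measure_integral => [|A mA _ //]; exact: measurable_tcons.
rewrite ge0_integral_pushforward//=; last exact: measurable_tcons.
rewrite preimage_setT fubini_tonelli1//.
by apply: measurableT_comp => //; exact: measurable_tcons.
Qed.

Lemma integral_lebesgue_tupleS_swap n (f : n.+1.-tuple R -> \bar R) :
  measurable_fun setT f -> (forall t, 0 <= f t) ->
  \int[@lebesgue_tuple R n.+1]_t f t =
  \int[@lebesgue_tuple R n]_t \int[@lebesgue_measure R]_x f (tcons (x, t)).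
Proof.
move=> mf f0; rewrite integral_lebesgue_tupleS//.
have := @fubini_tonelli _ _ _ _ R (@lebesgue_measure R) (@lebesgue_tuple R n) (f \o @tcons R n); apply => //.
  by apply: measurableT_comp => //; exact: measurable_tcons.
by move=> x; exact: f0.
Qed.

Lemma vec_tcons n (x : R) (t : n.-tuple R) :
  vec (tcons (x, t)) = col_mx (x%:M : 'cV_1) (vec t).
Proof.
apply/colP => i; rewrite [LHS]mxE -[i](@fintype.splitK 1%N n); case: (@fintype.split 1%N n i) => j.
  by rewrite (@col_mxEu _ 1%N n) [j]ord1 mxE eqxx mulr1n; apply: (tnth_nth x).
rewrite (@col_mxEd _ 1%N n) mxE.
rewrite (tnth_nth x) [RHS](tnth_nth x).
by [].
Qed.

Lemma unvec_col_mx n (y : 'cV[R]_1) (z : 'cV[R]_n) :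
  unvec (col_mx y z) = tcons (y 0%R 0%R, unvec z).
Proof.
rewrite -[RHS]vecK vec_tcons unvecK; congr (unvec (col_mx _ _)).
by apply/colP => i; rewrite [i]ord1 !mxE eqxx.
Qed.

Lemma aff_block n a u v (B : 'M[R]_n) (b : 'cV[R]_(1 + n)) x t :
  aff (block_mx a%:M u v B) b (tcons (x, t)) =
  tcons ((a * x + (u *m vec t + usubmx b) 0 0)%R,
         aff B (x *: v + dsubmx b)%R t).
Proof.
rewrite /aff vec_tcons mul_block_col -[b in LHS]vsubmxK add_col_mx unvec_col_mx.
congr (tcons (_, unvec _)).
  by rewrite -!addrA mul_scalar_mx !mxE eqxx mulr1n.
by rewrite mul_mx_scalar addrA [(B *m _ + _)%R]addrC.
Qed.

(** A property of the matrix, for all offsets b at once: it passes to products, and in the block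
    lemmas the offset depends on the variable that Fubini's theorem freezes. *)
Definition affine_substitution n (A : 'M[R]_n) := forall b (f : n.-tuple R -> \bar R),
  measurable_fun setT f -> (forall t, 0 <= f t) ->
  \int[@lebesgue_tuple R n]_t f (aff A b t) =
  (`|\det A|^-1)%:E * \int[@lebesgue_tuple R n]_t f t.

Lemma measurable_tcons1 n (t : n.-tuple R) :
  measurable_fun setT (fun x : T => tcons (x, t)).
Proof. by apply: (@measurable_cons _ _ T T id _ (cst t)); [exact: measurable_id|exact: measurable_cst]. Qed.

Lemma measurable_tcons2 n (x : R) :
  measurable_fun setT (fun t : n.-tuple R => tcons (x, t)).
Proof. by apply: (@measurable_cons _ _ _ T (cst x) _ id); [exact: measurable_cst|exact: measurable_id]. Qed.

Lemma measurable_comp_aff n (A : 'M[R]_n) b (f : n.-tuple R -> \bar R) :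
  measurable_fun setT f -> measurable_fun setT (fun t => f (aff A b t)).
Proof. by move=> mf; apply: measurableT_comp => //; exact: measurable_aff. Qed.

Lemma affine_substitutionM n (A B : 'M[R]_n) :
  affine_substitution A -> affine_substitution B ->
  affine_substitution (A *m B).
Proof.
move=> hA hB b f mf f0.
transitivity (\int[@lebesgue_tuple R n]_t (f \o aff A b) (aff B 0 t)).
  by apply: eq_integral => t _; rewrite /aff /= unvecK addr0 mulmxA.
rewrite hB//=; last exact: measurable_comp_aff.
by rewrite hA// det_mulmx normrM invfM muleA -EFinM mulrC.
Qed.

(** The tail is integrated first: for a fixed head x it undergoes B with the offset x v, a
    translation invisible to the inner integral. *)
Lemma affine_substitution_lblock n (a : R) v (B : 'M[R]_n) : (a != 0)%R ->
  affine_substitution B -> affine_substitution (block_mx (a%:M : 'M[R]_1) 0 v B)%R.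
Proof.
move=> a0 hB b f mf f0.
rewrite [LHS]integral_lebesgue_tupleS//; last exact: measurable_comp_aff.
under eq_integral => x _.
  under eq_integral => t _ do rewrite aff_block mul0mx add0r.
  rewrite (hB _ (fun t => f (tcons (_, t))))//; last first.
    by apply: measurableT_comp => //; exact: measurable_tcons2.
  over.
have mG : measurable_fun setT
    (fun x : T => \int[@lebesgue_tuple R n]_t f (tcons (x, t))).
  apply: (measurable_fun_fubini_tonelli_F (f \o @tcons R n)) => //.
    by apply: measurableT_comp => //; exact: measurable_tcons.
  by move=> x; exact: f0.
have G0 (x : T) : 0 <= \int[@lebesgue_tuple R n]_t f (tcons (x, t)).
  exact: integral_ge0.
rewrite ge0_integralZl_EFin//; last first.
  by apply: measurableT_comp mG _; exact: measurable_affine1.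
rewrite (@integral_lebesgue_affine _ _ _ (fun x : T => \int[@lebesgue_tuple R n]_t f (tcons (x, t))))//.
rewrite integral_lebesgue_tupleS// muleA -EFinM; congr (_%:E * _).
by rewrite (@det_lblock _ 1%N n) det_scalar1 normrM invfM mulrC.
Qed.

(** Here the head is integrated first, since it is its offset u t that depends on the tail t. *)
Lemma affine_substitution_ublock n (a : R) u (B : 'M[R]_n) : (a != 0)%R ->
  affine_substitution B -> affine_substitution (block_mx (a%:M : 'M[R]_1) u 0 B)%R.
Proof.
move=> a0 hB b f mf f0.
rewrite [LHS]integral_lebesgue_tupleS_swap//; last exact: measurable_comp_aff.
under eq_integral => t _.
  under eq_integral => x _ do rewrite aff_block scaler0 add0r.
  rewrite (@integral_lebesgue_affine _ _ _ (fun x : T => f (tcons (x, _))))//; last first.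
    by apply: measurableT_comp => //; exact: measurable_tcons1.
  over.
have mG : measurable_fun setT
    (fun t : n.-tuple R => \int[@lebesgue_measure R]_x f (tcons (x, t))).
  apply: (@measurable_fun_fubini_tonelli_G _ _ _ _ R (@lebesgue_measure R) (f \o @tcons R n)) => //.
    by apply: measurableT_comp => //; exact: measurable_tcons.
  by move=> x; exact: f0.
have G0 (t : n.-tuple R) : 0 <= \int[@lebesgue_measure R]_x f (tcons (x, t)).
  exact: integral_ge0.
rewrite ge0_integralZl_EFin//; last exact: (measurable_comp_aff _ _ mG).
rewrite (hB _ (fun t => \int[@lebesgue_measure R]_x f (tcons (x, t))))//.
rewrite integral_lebesgue_tupleS_swap// muleA -EFinM; congr (_%:E * _).
by rewrite (@det_ublock _ 1%N n) det_scalar1 normrM invfM.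
Qed.

(** Block LU factorization, with the induction hypothesis for the Schur complement; a zero corner
    entry is first made nonzero by a shear. *)
Lemma affine_substitution_unitmx n (A : 'M[R]_n) :
  A \in unitmx -> affine_substitution A.
Proof.
elim: n A => [|n IH] A uA.
  move=> b f mf f0; rewrite det_mx00 normr1 invr1 mul1e.
  by apply: eq_integral => t _; rewrite [aff _ _ _]tuple0 [t]tuple0.
have h1 : affine_substitution (1%:M : 'M[R]_n) by apply: IH; exact: unitmx1.
have shear (u : 'rV[R]_n) : affine_substitution (block_mx (1%:M : 'M[R]_1) u 0 1%:M)%R.
  by apply: affine_substitution_ublock => //; exact: oner_neq0.
have main (a : R) u v (B : 'M[R]_n) : (a != 0)%R ->
    block_mx (a%:M : 'M[R]_1) u v B \in unitmx -> affine_substitution (block_mx (a%:M : 'M[R]_1) u v B).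
  move=> a0.
  have -> : (block_mx a%:M u v B = block_mx a%:M 0 v (B - a^-1 *: (v *m u))
      *m block_mx 1%:M (a^-1 *: u) 0 1%:M)%R.
    rewrite mulmx_block !mulmx0 !mul0mx !mulmx1 !addr0 mul_scalar_mx.
    by rewrite scalerA divff// scale1r -scalemxAr addrC subrK.
  rewrite unitmx_mul => /andP[uL _].
  apply: affine_substitutionM; last exact: shear.
  apply: affine_substitution_lblock => //; apply: IH.
  by move: uL; rewrite !unitmxE (@det_lblock _ 1%N n) unitrM => /andP[].
move: A uA; change (forall A : 'M[R]_(1 + n), A \in unitmx -> affine_substitution A).
move=> A; rewrite -(submxK A) (mx11_scalar (ulsubmx A)).
set a := ulsubmx A _ _; set u := ursubmx A; set v := dlsubmx A; set B := drsubmx A.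
move=> uA; have [a0|a0] := eqVneq a 0%R; last exact: main.
have [i vi] : exists i, v i 0%R != 0%R.
  apply/existsP; move: uA; apply: contraLR; rewrite negb_exists => /forallP v0.
  have -> : v = 0%R.
    by apply/colP => i; rewrite [RHS]mxE; apply/eqP; have := v0 i; rewrite negbK.
  by rewrite a0 unitmxE (@det_ublock _ 1%N n) det_scalar1 mul0r unitr0.
pose w : 'rV[R]_n := delta_mx 0%R i.
have wv : (w *m v) 0%R 0%R = v i 0%R by rewrite -rowE !mxE.
have E c : (block_mx 1%:M (c *: w) 0 1%:M *m block_mx a%:M u v B =
    block_mx (c * v i 0)%:M (u + c *: (w *m B)) v B)%R.
  rewrite mulmx_block !mul1mx !mul0mx !add0r a0 -!scalemxAl; congr block_mx.
  by rewrite (mx11_scalar (w *m v)) wv scale_scalar_mx raddf0 add0r.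
(* Adding row i of the lower block to the first row turns the corner into v_i, which is nonzero; the
   shear by -w undoes this. *)
have -> : (block_mx a%:M u v B = block_mx 1%:M ((- 1) *: w) 0 1%:M *m
    (block_mx 1%:M (1 *: w) 0 1%:M *m block_mx a%:M u v B))%R.
  rewrite mulmxA [X in _ = (X *m _)%R](_ : _ = 1%:M)%R ?mul1mx//.
  rewrite mulmx_block !mulmx0 !mul0mx !mulmx1 !mul1mx !addr0 !add0r -scalerDl.
  by rewrite subrr scale0r -(@scalar_mx_block _ 1%N n).
apply: affine_substitutionM; first exact: shear.
rewrite E mul1r; apply: main => //; rewrite -[v i 0%R]mul1r -E unitmx_mul uA andbT.
by rewrite unitmxE (@det_ublock _ 1%N n) !det1 mulr1 unitr1.
Qed.

End affine_substitution.

(** * Cauchy-Schwarz and integrals over sets of column vectors *)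

(** Common source of the Cauchy-Schwarz inequalities for integrals and for matrices. At (c, -a) the
    form equals c (b c - a^2), which decides the case c > 0. *)
Lemma discriminant_le0 {R : realFieldType} (a b c : R) :
  (forall s t, 0 <= s ^+ 2 * b + (2 * s * t * a + t ^+ 2 * c)) -> a ^+ 2 <= b * c.
Proof.
move=> key.
have b0 : 0 <= b by have := key 1 0; rewrite expr1n mul1r mulr0 mul0r expr0n/= mul0r !addr0.
have c0 : 0 <= c by have := key 0 1; rewrite expr0n/= mul0r mulr0 !mul0r add0r expr1n mul1r add0r.
have := key c (- a).
have [c_eq0|cn0] := eqVneq c 0.
  have [->|a0] := eqVneq a 0; first by rewrite expr0n/= mulr_ge0.
  (* For c = 0 and a nonzero the form takes the value b - 2 (b + 1) < 0 at this point. *)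
  have := key 1 (- ((b + 1) / a)); rewrite c_eq0.
  have -> : 2 * 1 * - ((b + 1) / a) * a = - (2 * (b + 1)) by field.
  by rewrite expr1n; nra.
have cp : 0 < c by rewrite lt_def cn0.
have -> : c ^+ 2 * b + (2 * c * - a * a + (- a) ^+ 2 * c) = c * (b * c - a ^+ 2) by ring.
by rewrite pmulr_rge0// subr_ge0.
Qed.

Section integral_on_theory.
Context {R : realType}.
Variable n : nat.
Implicit Types (D : set 'cV[R]_n) (f g : 'cV[R]_n -> R).

Definition mset D := measurable (@vec R n @^-1` D).

Definition integrable_on D f :=
  (@lebesgue_tuple R n).-integrable (@vec R n @^-1` D) (EFin \o (f \o @vec R n)).

Lemma eq_integral_on D f g : (forall x, D x -> f x = g x) ->
  integral_on D f = integral_on D g.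
Proof. by move=> fg; apply: eq_Rintegral => t /set_mem Dt; rewrite fg. Qed.

Lemma eq_integrable_on D f g : (forall x, D x -> f x = g x) ->
  mset D -> integrable_on D f -> integrable_on D g.
Proof.
by move=> fg mD; apply: eq_integrable => // t /set_mem Dt /=; rewrite fg.
Qed.

Lemma integral_on_ge0 D f : (forall x, D x -> 0 <= f x) -> 0 <= integral_on D f.
Proof. by move=> f0; apply: Rintegral_ge0 => t /f0. Qed.

Section measurable_domain.
Variable D : set 'cV[R]_n.
Hypothesis mD : mset D.

Lemma integrable_onD f g : integrable_on D f -> integrable_on D g ->
  integrable_on D (fun x => f x + g x).
Proof. by move=> fi gi; have := integrableD mD fi gi. Qed.

Lemma integrable_onZ c f : integrable_on D f -> integrable_on D (fun x => c * f x).
Proof. by move=> fi; have := integrableZl mD c fi. Qed.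

Lemma integrable_on_sum (I : Type) (s : seq I) (h : I -> 'cV[R]_n -> R) :
  (forall i, integrable_on D (h i)) -> integrable_on D (fun x => \sum_(i <- s) h i x).
Proof.
move=> hi.
have := @integrable_sum _ _ _ (@lebesgue_tuple R n) _ mD _ s xpredT
  (fun i t => (h i (vec t))%:E) (fun i _ => hi i).
by apply: eq_integrable => // t _; rewrite /= sumEFin.
Qed.

Lemma integral_onD f g : integrable_on D f -> integrable_on D g ->
  integral_on D (fun x => f x + g x) = integral_on D f + integral_on D g.
Proof. by move=> fi gi; exact: RintegralD. Qed.

Lemma integral_onZ c f : integrable_on D f ->
  integral_on D (fun x => c * f x) = c * integral_on D f.
Proof. by move=> fi; exact: RintegralZl. Qed.

Lemma le_integral_on f g : integrable_on D f -> integrable_on D g ->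
  (forall x, D x -> f x <= g x) -> integral_on D f <= integral_on D g.
Proof. by move=> fi gi fg; apply: le_Rintegral => // t /fg. Qed.

Lemma le_integrable_on f g : measurable_fun (@vec R n @^-1` D) (f \o @vec R n) ->
  (forall x, D x -> `|f x| <= g x) -> integrable_on D g -> integrable_on D f.
Proof.
move=> mf fg; apply: le_integrable => //; first exact/measurable_EFinP.
move=> t Dt /=; rewrite lee_fin.
exact: le_trans (fg _ Dt) (ler_norm _).
Qed.

Lemma L2_integrable_sqr f : L2 D f -> integrable_on D (fun x => f x ^+ 2).
Proof.
move=> [mf fo].
have mf2 : measurable_fun (@vec R n @^-1` D) (EFin \o ((fun x => f x ^+ 2) \o @vec R n)).
  by apply/measurable_EFinP; exact: (measurable_funX 2 mf).
apply/integrableP; split=> //.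
rewrite (le_lt_trans _ fo)//; apply: ge0_le_integral => //=.
- by apply: (measurableT_comp (@abse_measurable R setT) mf2).
- by move=> t _; rewrite lee_fin ger0_norm ?sqr_ge0.
Qed.

Lemma L2_integrableM f g : L2 D f -> L2 D g -> integrable_on D (fun x => f x * g x).
Proof.
move=> fL gL.
apply: (@le_integrable_on _ (fun x => f x ^+ 2 + g x ^+ 2)).
- exact: (measurable_funM fL.1 gL.1).
- move=> x _; rewrite normrM -(real_normK (num_real (f x))) -(real_normK (num_real (g x))).
  have := sqr_ge0 (`|f x| - `|g x|).
  have := normr_ge0 (f x); have := normr_ge0 (g x); nra.
- by apply: integrable_onD; exact: L2_integrable_sqr.
Qed.

Lemma integral_on_dot_cauchy_schwarz m p (u v : 'cV[R]_n -> 'M[R]_(m, p)) :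
  (forall i j, L2 D (fun x => u x i j)) -> (forall i j, L2 D (fun x => v x i j)) ->
  integral_on D (fun x => dot (u x) (v x)) ^+ 2 <=
  integral_on D (fun x => dot (u x) (u x)) * integral_on D (fun x => dot (v x) (v x)).
Proof.
move=> uL vL.
have idot (w w' : 'cV[R]_n -> 'M[R]_(m, p)) : (forall i j, L2 D (fun x => w x i j)) ->
    (forall i j, L2 D (fun x => w' x i j)) -> integrable_on D (fun x => dot (w x) (w' x)).
  move=> wL wL'; apply: integrable_on_sum => i; apply: integrable_on_sum => j.
  exact: L2_integrableM.
set a := integral_on D _; set b := integral_on D (fun x => dot (u x) (u x)).
set c := integral_on D (fun x => dot (v x) (v x)).
have key s t : 0 <= s ^+ 2 * b + (2 * s * t * a + t ^+ 2 * c).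
  rewrite /a /b /c.
  rewrite -!integral_onZ; try exact: idot.
  rewrite -!integral_onD; try (do ?apply: integrable_onD; apply: integrable_onZ; exact: idot).
  apply: integral_on_ge0 => x _.
  rewrite (_ : _ + _ = dot (s *: u x + t *: v x) (s *: u x + t *: v x)).
    by apply: sumr_ge0 => i _; apply: sumr_ge0 => j _; rewrite -expr2 sqr_ge0.
  rewrite /dot !mulr_sumr -!big_split; apply: eq_bigr => i _ /=.
  rewrite !mulr_sumr -!big_split; apply: eq_bigr => j _ /=; rewrite !mxE; ring.
exact: discriminant_le0.
Qed.

End measurable_domain.
End integral_on_theory.

Section affine_images.
Context {R : realType}.
Variable n : nat.
Variables (Phi : affine (R := R) n n) (D : set 'cV[R]_n).
Hypothesis uPhi : linpart Phi \in unitmx.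
Hypothesis mD : mset D.

Definition affine_inv (x : 'cV[R]_n) := invmx (linpart Phi) *m (x - origin Phi).

Lemma affine_funK : cancel Phi affine_inv.
Proof. by move=> x; rewrite /affine_inv /affine_fun addrK mulKmx. Qed.

Lemma affine_invK : cancel affine_inv Phi.
Proof. by move=> x; rewrite /affine_inv /affine_fun mulKVmx// subrK. Qed.

Lemma affine_imageE x : (Phi @` D) x <-> D (affine_inv x).
Proof.
split=> [[y Dy <-]|Dx]; first by rewrite affine_funK.
by exists (affine_inv x) => //; rewrite affine_invK.
Qed.

Lemma mset_affine_image : mset (Phi @` D).
Proof.
rewrite /mset.
rewrite [X in measurable X](_ : _ = setT `&` aff (invmx (linpart Phi))
    (- (invmx (linpart Phi) *m origin Phi)) @^-1` (@vec R n @^-1` D)).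
  exact: measurable_aff.
rewrite setTI; apply/seteqP; split=> t.
  by move=> /affine_imageE; rewrite /preimage/= unvecK /affine_inv mulmxBr.
by rewrite /preimage/= unvecK -mulmxBr => h; apply/affine_imageE.
Qed.

Lemma preimage_affine_image :
  aff (linpart Phi) (origin Phi) @^-1` (@vec R n @^-1` (Phi @` D)) = @vec R n @^-1` D.
Proof.
apply/seteqP; split=> t; rewrite /preimage/= vec_aff.
  by move=> /affine_imageE; rewrite affine_funK.
by move=> h; exists (vec t).
Qed.

(** The domain is moved into the integrand as an extension by zero, which reduces the claim to
    integrals over the whole space. *)
Lemma ge0_integral_affine_image (g : n.-tuple R -> \bar R) :
  measurable_fun setT g -> (forall t, 0 <= g t)%E ->
  (\int[@lebesgue_tuple R n]_(t in @vec R n @^-1` (Phi @` D)) g t =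
  (`|\det (linpart Phi)|)%:E *
  \int[@lebesgue_tuple R n]_(t in @vec R n @^-1` D) g (aff (linpart Phi) (origin Phi) t))%E.
Proof.
move=> mg g0.
have d0 : \det (linpart Phi) != 0 by move: uPhi; rewrite unitmxE unitfE.
have mgD : measurable_fun setT (g \_ (@vec R n @^-1` (Phi @` D))).
  by apply/(measurable_restrictT _ mset_affine_image); apply: measurable_funTS.
rewrite integral_mkcond [in RHS]integral_mkcond.
transitivity (`|\det (linpart Phi)|%:E * \int[@lebesgue_tuple R n]_t
    (g \_ (@vec R n @^-1` (Phi @` D))) (aff (linpart Phi) (origin Phi) t))%E.
  rewrite affine_substitution_unitmx//.
    by rewrite muleA -EFinM divff ?mul1e// normr_eq0.
  by move=> t; rewrite /patch; case: ifP.
congr (_ * _)%E; apply: eq_integral => t _; rewrite /patch.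
congr (if _ then _ else _).
by rewrite -[X in _ = (_ \in X)]preimage_affine_image; apply/idP/idP => /set_mem h; exact/mem_set.
Qed.

Lemma integral_on_affine_image (f : 'cV[R]_n -> R) :
  measurable_fun setT (f \o @vec R n) -> integrable_on D (f \o Phi) ->
  integrable_on (Phi @` D) f /\
  integral_on (Phi @` D) f = `|\det (linpart Phi)| * integral_on D (f \o Phi).
Proof.
move=> mf fi.
have fE t : f (vec (aff (linpart Phi) (origin Phi) t)) = f (Phi (vec t)).
  by rewrite vec_aff.
have mE : measurable_fun setT (fun t => (f (vec t))%:E) by exact/measurable_EFinP.
split.
  apply/integrableP; split; first exact: measurable_funTS.
  rewrite (@ge0_integral_affine_image (fun t => `|(f (vec t))%:E|%E))//; last first.
    exact: measurableT_comp.
  under eq_integral do rewrite fE.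
  by apply: lte_mul_pinfty => //; have /integrableP[] := fi.
rewrite /integral_on /Rintegral integralE [in RHS]integralE.
have ip := integrable_pos_fin_num mD fi; have im := integrable_neg_fin_num mD fi.
have hp t : ((EFin \o (f \o @vec R n))^\+ (aff (linpart Phi) (origin Phi) t) =
    (EFin \o ((f \o Phi) \o @vec R n))^\+ t)%E.
  by rewrite !funeposE; congr (maxe _ _); congr EFin; exact: fE.
have hm t : ((EFin \o (f \o @vec R n))^\- (aff (linpart Phi) (origin Phi) t) =
    (EFin \o ((f \o Phi) \o @vec R n))^\- t)%E.
  by rewrite !funenegE; congr (maxe (- _) _)%E; congr EFin; exact: fE.
rewrite (@ge0_integral_affine_image (EFin \o (f \o @vec R n))^\+%E)//; last 1 first.
  exact: measurable_funepos.
rewrite (@ge0_integral_affine_image (EFin \o (f \o @vec R n))^\-%E)//; last 1 first.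
  exact: measurable_funeneg.
rewrite (eq_integral _ _ (fun t _ => hp t)) (eq_integral _ _ (fun t _ => hm t)).
rewrite -muleBr//; last by apply: fin_num_adde_defr; exact: ip.
by rewrite fineM// fin_numB ip im.
Qed.

End affine_images.

(** * Polynomials as functions *)

Section polynomial_evaluation.
Context {R : realType}.
Local Notation "''X_' i" := (mpolyX R (mnm1 i)).
Variable n : nat.
Implicit Types (p q : mpoly n R) (x : 'cV[R]_n).

Definition peval p x : R := meval (fun j => x j 0) p.

Lemma pevalD p q x : peval (p + q) x = peval p x + peval q x.
Proof. exact: mevalD. Qed.
Lemma pevalB p q x : peval (p - q) x = peval p x - peval q x.
Proof. exact: mevalB. Qed.
Lemma pevalM p q x : peval (p * q) x = peval p x * peval q x.
Proof. exact: mevalM. Qed.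
Lemma pevalC c x : peval (mpolyC n c) x = c.
Proof. exact: mevalC. Qed.
Lemma pevalXU i x : peval 'X_i x = x i 0.
Proof. exact: mevalXU. Qed.
Lemma pevalZ c p x : peval (c *: p) x = c * peval p x.
Proof. exact: mevalZ. Qed.
Lemma peval0 x : peval 0 x = 0.
Proof. exact: meval0. Qed.
Lemma peval1 x : peval 1 x = 1.
Proof. exact: meval1. Qed.
Lemma peval_sum (I : Type) (r : seq I) (P : pred I) (F : I -> mpoly n R) x :
  peval (\sum_(i <- r | P i) F i) x = \sum_(i <- r | P i) peval (F i) x.
Proof. by rewrite (big_morph (peval^~ x) (fun p q => pevalD p q x) (peval0 x)). Qed.
Lemma pevalX m x : peval (mpolyX R m) x = \prod_i x i 0 ^+ m i.
Proof. exact: mevalX. Qed.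

(** Reduces analytic properties stable under sums and products, such as continuity, measurability or
    boundedness, to constants and coordinates. *)
Lemma mpoly_ring_ind (P : mpoly n R -> Prop) :
  (forall c, P (mpolyC n c)) -> (forall i, P 'X_i) ->
  (forall p q, P p -> P q -> P (p + q)) -> (forall p q, P p -> P q -> P (p * q)) ->
  forall p, P p.
Proof.
move=> PC PX PD PM p; rewrite (mpolyE p).
have P1 : P 1 by exact: PC.
apply: (big_ind P) => //; first exact: (PC 0).
move=> m _; rewrite -mul_mpolyC; apply: (PM) => //.
rewrite mpolyXE_id; apply: (big_ind P); [exact: P1|exact: PM|] => i _.
by elim: (m i) => [|e IH]; rewrite ?expr0// exprS; apply: (PM).
Qed.

Lemma is_derive_coord (x v : 'cV[R]_n) i :
  is_derive x v (fun y : 'cV[R]_n => y i 0 : R) (v i 0).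
Proof.
have h : (fun h : R => h^-1 *: ((h *: v + x) i 0 - x i 0)) @ 0^' --> (v i 0 : R).
  apply: cvg_near_cst; near=> e.
  rewrite !mxE addrK /GRing.scale/= mulKf//.
  by near: e; rewrite near_withinE; near=> e.
by split; [apply/cvg_ex; exists (v i 0)|apply: cvg_lim].
Unshelve. all: by end_near. Qed.

Lemma mderiv_XU (i j : 'I_n) : mderiv i 'X_j = (i == j)%:R.
Proof.
rewrite mderivX mnm1E eq_sym; case: eqVneq => [->|_]; last by rewrite scale0r.
rewrite scale1r -(mpolyX0 n R); congr mpolyX.
by apply/mnmP => k; rewrite mnmBE subnn mnmE.
Qed.

Lemma is_derive_peval (x v : 'cV[R]_n) p :
  is_derive x v (peval p) (\sum_i peval (mderiv i p) x * v i 0).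
Proof.
elim/mpoly_ring_ind: p => [c|i|p q hp hq|p q hp hq].
- rewrite (_ : peval _ = cst c); last by apply/funext => y; rewrite pevalC.
  rewrite big1; first exact: is_derive_cst.
  by move=> i _; rewrite mderivC peval0 mul0r.
- rewrite (_ : peval _ = fun y => y i 0); last by apply/funext => y; rewrite pevalXU.
  rewrite (bigD1 i)//= big1 ?addr0.
    rewrite mderiv_XU eqxx peval1 mul1r; exact: is_derive_coord.
  by move=> j ji; rewrite mderiv_XU (negbTE ji) peval0 mul0r.
- rewrite (_ : peval _ = peval p + peval q); last by apply/funext => y; rewrite pevalD.
  under eq_bigr do rewrite mderivD pevalD mulrDl.
  by rewrite big_split; exact: is_deriveD.
- rewrite (_ : peval _ = peval p * peval q); last by apply/funext => y; rewrite pevalM.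
  under eq_bigr do rewrite mderivM pevalD !pevalM mulrDl.
  rewrite big_split /= addrC.
  apply: is_derive_eq; rewrite /GRing.scale/= !mulr_sumr; congr (_ + _);
    apply: eq_bigr => i _; ring.
Qed.

Lemma continuous_peval p : continuous (peval p).
Proof.
elim/mpoly_ring_ind: p => [c|i|p q hp hq|p q hp hq] x.
- rewrite (_ : peval _ = cst c); first exact: cst_continuous.
  by apply/funext => y; rewrite pevalC.
- rewrite (_ : peval _ = fun y => y i 0); first exact: (@coord_continuous _ _ _ i 0).
  by apply/funext => y; rewrite pevalXU.
- rewrite (_ : peval _ = peval p + peval q); last by apply/funext => y; rewrite pevalD.
  exact: cvgD (hp x) (hq x).
- rewrite (_ : peval _ = peval p * peval q); last by apply/funext => y; rewrite pevalM.
  exact: cvgM (hp x) (hq x).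
Qed.

Lemma measurable_peval p : measurable_fun setT (peval p \o @vec R n).
Proof.
elim/mpoly_ring_ind: p => [c|i|p q hp hq|p q hp hq].
- rewrite (_ : _ \o _ = cst c); first exact: measurable_cst.
  by apply/funext => y; rewrite /= pevalC.
- rewrite (_ : _ \o _ = fun t => tnth t i); first exact: measurable_tnth.
  by apply/funext => y; rewrite /= pevalXU mxE.
- rewrite (_ : _ \o _ = (peval p \o @vec R n) \+ (peval q \o @vec R n)).
    exact: measurable_funD.
  by apply/funext => y; rewrite /= pevalD.
- rewrite (_ : _ \o _ = (peval p \o @vec R n) \* (peval q \o @vec R n)).
    exact: measurable_funM.
  by apply/funext => y; rewrite /= pevalM.
Qed.

Lemma peval_bounded p : exists2 M, 0 <= M &
  forall x, (forall i, 0 <= x i 0 <= 1) -> `|peval p x| <= M.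
Proof.
elim/mpoly_ring_ind: p => [c|i|p q [M M0 hp] [N N0 hq]|p q [M M0 hp] [N N0 hq]].
- by exists `|c| => // x _; rewrite pevalC.
- exists 1 => // x /(_ i) /andP[x0 x1].
  by rewrite pevalXU ger0_norm.
- exists (M + N) => [|x hx]; first exact: addr_ge0.
  by rewrite pevalD (le_trans (ler_normD _ _))// lerD ?hp ?hq.
- exists (M * N) => [|x hx]; first exact: mulr_ge0.
  by rewrite pevalM normrM ler_pM// ?hp ?hq.
Qed.

Lemma mmeasure_mderiv i p : p != 0 ->
  (mmeasure mdeg (mderiv i p) < mmeasure mdeg p)%N.
Proof.
move=> p0; rewrite (mpolySpred _ p0) ltnS mmeasureE.
apply/bigmax_leqP_seq => m; rewrite mcoeff_msupp mcoeff_mderiv => h _.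
have : mnm_add m (mnm1 i) \in msupp p.
  by rewrite mcoeff_msupp; apply: contra_neq h => ->; rewrite mul0rn.
move/(mmeasure_mnm_lt mdeg); rewrite /= mdegD mdeg1 addn1 => h'.
by rewrite -ltnS -(mpolySpred _ p0).
Qed.

(** Characteristic zero: if m_i > 0, then m_i times the coefficient of X^m in p is a coefficient of
    the i-th derivative. *)
Lemma mderiv_eq0_const p : (forall i, mderiv i p = 0) -> p = mpolyC n (mcoeff (@mnm0 n) p).
Proof.
move=> dp; apply/mpolyP => m; rewrite mcoeffC.
have [->|m0] := eqVneq; first by rewrite mulr1.
rewrite mulr0.
have /existsP[i mi] : [exists i, m i != 0].
  apply: contraNT m0; rewrite negb_exists => /forallP h.
  by apply/eqP/mnmP => i; rewrite mnmE; apply/eqP; have := h i; rewrite negbK.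
have := mcoeff_mderiv i p (mnm_sub m (mnm1 i)).
rewrite dp mcoeff0 (_ : mnm_add _ _ = m); last first.
  by apply/mnmP => j; rewrite mnmDE mnmBE mnm1E; case: eqVneq => [<-|]; lia.
by move=> /esym/eqP; rewrite mulrn_eq0 /= => /eqP.
Qed.

(** Induction on the degree: as U is open, the derivatives of p vanish on U too, hence as
    polynomials; so p is constant, and one point of U gives its value. *)
Lemma mpoly_eq0_open (U : set 'cV[R]_n) p : open U -> U !=set0 ->
  (forall x, U x -> peval p x = 0) -> p = 0.
Proof.
move=> oU [x0 Ux0].
have [N] := ubnP (mmeasure mdeg p); elim: N => // N IH in p * => ltN p0.
apply/eqP/contraT => pn0.
have dp i : mderiv i p = 0.
  apply: IH => [|x Ux]; first exact: leq_trans (mmeasure_mderiv i pn0) _.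
  have [_ <-] : is_derive x (delta_mx i 0 : 'cV[R]_n) (peval p) (peval (mderiv i p) x).
    apply: is_derive_eq; first exact: is_derive_peval.
    rewrite (bigD1 i)//= big1 ?addr0 ?mxE ?eqxx ?mulr1// => j ji.
    by rewrite mxE (negbTE ji) mulr0.
  rewrite (@near_eq_derive _ _ _ _ (cst 0)) ?derive_cst//.
  by apply: (filterS p0); apply: open_nbhs_nbhs; split.
have E := mderiv_eq0_const dp; have := p0 _ Ux0; rewrite {1}E pevalC => c0.
by move: pn0; rewrite E c0 mpolyC0 eqxx.
Qed.

End polynomial_evaluation.

(** * Integrals of polynomials over the reference cells *)

Section monomials_on_cube.
Context {R : realType}.
Local Notation T := (measurableTypeR R).

(** The cut-off turns a monomial on the cube into a product of functions of one variable on the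
    whole space, to which Fubini's theorem applies. *)
Definition unit_monomial (e : nat) (x : R) : R := if 0 <= x <= 1 then x ^+ e else 0.

Lemma unit_monomial_ge0 e x : 0 <= unit_monomial e x.
Proof. by rewrite /unit_monomial; case: ifP => // /andP[x0 _]; exact: exprn_ge0. Qed.

Lemma measurable_unit_monomial e : measurable_fun setT (unit_monomial e : T -> R).
Proof.
rewrite (_ : unit_monomial e = (fun x : T => x ^+ e * \1_(`[0, 1] : set T) x)).
  by apply: measurable_funM; [exact: exprn_measurable|exact: measurable_indic].
apply/funext => x; rewrite indicE mem_setE in_itv/= /unit_monomial.
by case: ifP; rewrite ?mulr1// mulr0.
Qed.

Lemma integral_unit_monomial e :
  (\int[@lebesgue_measure R]_x (unit_monomial e x)%:E = (e.+1%:R^-1)%:E)%E.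
Proof.
transitivity (\int[@lebesgue_measure R]_(x in `[0%R, 1%R]) (x ^+ e)%:E)%E.
  rewrite [RHS]integral_mkcond; apply: eq_integral => x _.
  by rewrite /patch /= /unit_monomial mem_setE in_itv/=; case: ifP.
have dF (x : R) : is_derive x 1 (fun x : R => e.+1%:R^-1 * x ^+ e.+1) (x ^+ e).
  have h := exp_derive e.+1 x (1 : R).
  have h' : is_derive x 1 (fun x : R => x ^+ e.+1) (e.+1%:R * x ^+ e).
    split; [exact: exprn_derivable|by rewrite h /GRing.scale/= mulr1].
  have [d1 d2] := is_deriveZ e.+1%:R^-1 h'; split; first exact: d1.
  by apply: (etrans d2); rewrite /GRing.scale/= mulKf// pnatr_eq0.
rewrite (@continuous_FTC2 _ _ (fun x : R => e.+1%:R^-1 * x ^+ e.+1))//.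
- by rewrite expr1n mulr1 expr0n/= mulr0 -EFinB subr0.
- by apply: continuous_in_subspaceT => x _; exact: exprn_continuous.
- split=> [x _||].
  + by have [] := dF x.
  + apply: cvg_at_right_filter; apply: cvgMr; exact: exprn_continuous.
  + apply: cvg_at_left_filter; apply: cvgMr; exact: exprn_continuous.
- by move=> x _; rewrite derive1E; have [_] := dF x.
Qed.

Lemma measurable_prod_unit_monomial n (e : 'I_n -> nat) :
  measurable_fun setT (fun t : n.-tuple R => (\prod_i unit_monomial (e i) (tnth t i))%:E).
Proof.
apply/measurable_EFinP; apply: measurable_prod => i _.
apply: (measurableT_comp (measurable_unit_monomial (e i))).
exact: measurable_tnth.
Qed.

Lemma prod_unit_monomial_ge0 n (e : 'I_n -> nat) (t : n.-tuple R) :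
  (0 <= (\prod_i unit_monomial (e i) (tnth t i))%:E)%E.
Proof. by rewrite lee_fin prodr_ge0// => i _; exact: unit_monomial_ge0. Qed.

Lemma integral_prod_unit_monomial n (e : 'I_n -> nat) :
  (\int[@lebesgue_tuple R n]_t (\prod_i unit_monomial (e i) (tnth t i))%:E =
  (\prod_i (e i).+1%:R^-1)%:E)%E.
Proof.
elim: n => [|n IH] in e *.
  under eq_integral do rewrite big_ord0.
  by rewrite big_ord0 integral_dirac//= diracT mul1e.
rewrite integral_lebesgue_tupleS; [|exact: measurable_prod_unit_monomial|exact: prod_unit_monomial_ge0].
pose e' i := e (lift ord0 i).
transitivity (\int[@lebesgue_measure R]_x \int[@lebesgue_tuple R n]_t
    ((unit_monomial (e ord0) x)%:E * (\prod_i unit_monomial (e' i) (tnth t i))%:E))%E.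
  apply: eq_integral => x _; apply: eq_integral => t _.
  rewrite big_ord_recl EFinM; congr (_%:E * _%:E)%E.
  by apply: eq_bigr => i _; rewrite tnthS.
under eq_integral => x _.
  rewrite ge0_integralZl_EFin; [|by []|by move=> t _; exact: prod_unit_monomial_ge0|
    exact: measurable_prod_unit_monomial|exact: unit_monomial_ge0].
  rewrite IH; over.
rewrite ge0_integralZr.
- by rewrite integral_unit_monomial -EFinM big_ord_recl.
- by [].
- apply/measurable_EFinP; exact: measurable_unit_monomial.
- by move=> x _; rewrite lee_fin unit_monomial_ge0.
- by rewrite lee_fin prodr_ge0.
Qed.

End monomials_on_cube.

Section reference_cells.
Context {R : realType}.
Variables (s : cell_shape) (n : nat).

Lemma ref_cell_coord s' (x : 'cV[R]_n) : ref_cell s' n x -> forall i, 0 <= x i 0 <= 1.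
Proof.
case: s' => //= -[x0 x1] i; rewrite x0/=; apply: le_trans x1.
by rewrite (bigD1 i)//= lerDl sumr_ge0.
Qed.

Lemma mset_ref_cell : mset (ref_cell s n : set 'cV[R]_n).
Proof.
have mge i : measurable [set t : n.-tuple R | 0 <= tnth t i].
  rewrite [X in measurable X](_ : _ = setT `&` (@tnth n R)^~ i @^-1` `[0, +oo[).
    by apply: measurable_tnth.
  by apply/seteqP; split=> t /=; rewrite in_itv/= andbT // => -[].
have mle i : measurable [set t : n.-tuple R | tnth t i <= 1].
  rewrite [X in measurable X](_ : _ = setT `&` (@tnth n R)^~ i @^-1` `]-oo, 1]).
    by apply: measurable_tnth.
  by apply/seteqP; split=> t /=; rewrite in_itv/= // => -[].
have msum : measurable [set t : n.-tuple R | \sum_i tnth t i <= 1].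
  rewrite [X in measurable X](_ : _ = setT `&` (fun t : n.-tuple R => \sum_i tnth t i) @^-1` `]-oo, 1]).
    by apply: measurable_sum => // i; exact: measurable_tnth.
  by apply/seteqP; split=> t /=; rewrite in_itv/= // => -[].
have mall : measurable (\big[setI/setT]_(i < n) [set t : n.-tuple R | 0 <= tnth t i]).
  by apply: bigsetI_measurable => i _; exact: mge.
have mall1 : measurable (\big[setI/setT]_(i < n) [set t : n.-tuple R | tnth t i <= 1]).
  by apply: bigsetI_measurable => i _; exact: mle.
rewrite /mset; case: s.
- rewrite [X in measurable X](_ : _ = (\big[setI/setT]_(i < n) [set t : n.-tuple R | 0 <= tnth t i])
     `&` [set t : n.-tuple R | \sum_i tnth t i <= 1]); first exact: measurableI.
  rewrite -bigcap_seq; apply/seteqP; split=> t /=.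
    move=> [h0 h1]; split=> [i _ /=|]; first by have := h0 i; rewrite mxE.
    by move: h1; under eq_bigr do rewrite mxE.
  move=> [h0 h1]; split=> [i|]; first by rewrite mxE; apply: h0; rewrite /= mem_index_enum.
  by under eq_bigr do rewrite mxE.
- rewrite [X in measurable X](_ : _ = (\big[setI/setT]_(i < n) [set t : n.-tuple R | 0 <= tnth t i])
     `&` (\big[setI/setT]_(i < n) [set t : n.-tuple R | tnth t i <= 1])); first exact: measurableI.
  rewrite -!bigcap_seq; apply/seteqP; split=> t /=.
    by move=> h; split=> i _ /=; have /andP[] := h i; rewrite mxE.
  move=> [h0 h1] i; rewrite mxE; apply/andP; split.
    by apply: h0; rewrite /= mem_index_enum.
  by apply: h1; rewrite /= mem_index_enum.
Qed.

End reference_cells.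

Section polynomial_integrals.
Context {R : realType}.
Implicit Types (s : cell_shape).

Lemma lebesgue_tuple_cube n :
  (@lebesgue_tuple R n (@vec R n @^-1` ref_cell hypercube n) = 1)%E.
Proof.
have := @integral_prod_unit_monomial R n (fun _ => 0%N).
rewrite [X in _ = (X%:E)%E]big1; last by move=> i _; rewrite invr1.
move=> <-.
rewrite -[LHS]mul1e -integral_cst; last exact: mset_ref_cell.
rewrite integral_mkcond; apply: eq_integral => t _; rewrite /patch /=.
case: ifPn => [/set_mem h|h].
  rewrite big1// => i _; have := h i; rewrite mxE /unit_monomial => ->.
  by rewrite expr0.
have [i hi] : exists i, ~~ (0 <= tnth t i <= 1).
  apply/existsP; move: h; apply: contraNT; rewrite negb_exists => /forallP h.
  by apply/mem_set => i; rewrite mxE; have := h i; rewrite negbK.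
by rewrite (bigD1 i)//= /unit_monomial (negbTE hi) mul0r.
Qed.

Lemma lebesgue_tuple_ref_cell s n :
  (@lebesgue_tuple R n (@vec R n @^-1` ref_cell s n) < +oo)%E.
Proof.
apply: (@le_lt_trans _ _ 1%E); last exact: ltry.
rewrite -(lebesgue_tuple_cube n); apply: le_measure; rewrite ?inE.
- exact: mset_ref_cell.
- exact: mset_ref_cell.
- by move=> t /ref_cell_coord.
Qed.

Lemma integrable_on_cst s n (c : R) : integrable_on (ref_cell s n) (fun=> c).
Proof.
apply/integrableP; split; first exact/measurable_EFinP/measurable_cst.
rewrite -/(cst `|c%:E|%E) integral_cst; last exact: mset_ref_cell.
by rewrite lte_mul_pinfty//; exact: lebesgue_tuple_ref_cell.
Qed.

Lemma integrable_on_peval s n (p : mpoly n R) : integrable_on (ref_cell s n) (peval p).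
Proof.
have [M M0 hM] := peval_bounded p.
apply: (@le_integrable_on _ _ _ _ _ (fun=> M)).
- exact: mset_ref_cell.
- by apply: measurable_funTS; exact: measurable_peval.
- by move=> x /ref_cell_coord/hM.
- exact: integrable_on_cst.
Qed.

Fact ipoly_key : unit. Proof. exact: tt. Qed.

(** Locked, so that rewriting with linearity never unfolds the Lebesgue integral. *)
Definition ipoly s n : mpoly n R -> R :=
  locked_with ipoly_key (fun p => integral_on (ref_cell s n) (peval p)).

Lemma ipolyE s n (p : mpoly n R) : ipoly s p = integral_on (ref_cell s n) (peval p).
Proof. by rewrite /ipoly unlock. Qed.

Section linearity.
Variables (s : cell_shape) (n : nat).
Implicit Types p q : mpoly n R.

Lemma ipolyD p q : ipoly s (p + q) = ipoly s p + ipoly s q.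
Proof.
rewrite !ipolyE -integral_onD; [|exact: mset_ref_cell|exact: integrable_on_peval..].
by apply: eq_integral_on => x _; rewrite pevalD.
Qed.

Lemma ipolyZ c p : ipoly s (c *: p) = c * ipoly s p.
Proof.
rewrite !ipolyE -integral_onZ; [|exact: mset_ref_cell|exact: integrable_on_peval..].
by apply: eq_integral_on => x _; rewrite pevalZ.
Qed.

Lemma ipoly0 : ipoly s (0 : mpoly n R) = 0.
Proof. by rewrite -(scale0r 0) ipolyZ mul0r. Qed.

Lemma ipolyN p : ipoly s (- p) = - ipoly s p.
Proof. by rewrite -scaleN1r ipolyZ mulN1r. Qed.

Lemma ipolyB p q : ipoly s (p - q) = ipoly s p - ipoly s q.
Proof. by rewrite ipolyD ipolyN. Qed.

Lemma ipoly_sum (I : Type) (r : seq I) (P : pred I) (F : I -> mpoly n R) :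
  ipoly s (\sum_(i <- r | P i) F i) = \sum_(i <- r | P i) ipoly s (F i).
Proof. by rewrite (@big_morph _ _ (@ipoly s n) _ _ _ _ ipolyD ipoly0). Qed.

Lemma ipoly_ge0 p : (forall x, ref_cell s n x -> 0 <= peval p x) -> 0 <= ipoly s p.
Proof. by move=> p0; rewrite ipolyE; exact: integral_on_ge0. Qed.

Lemma ipoly_sqr_ge0 p : 0 <= ipoly s (p * p).
Proof. by apply: ipoly_ge0 => x _; rewrite pevalM -expr2 sqr_ge0. Qed.

(* [p] vanishes on a cube well inside of the cell, hence everywhere. *)
Lemma ipoly_eq0 p : (forall x, ref_cell s n x -> 0 <= peval p x) ->
  ipoly s p = 0 -> p = 0.
Proof.
move=> p0 ip0.
(* The sup-norm ball of radius a around (a, ..., a) lies in ]0, 2a[^n. There the coordinates sum to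
   at most 1 because 2 a (n + 1) = 1, so it fits into both cell shapes. *)
pose a : R := (2 * n.+1%:R)^-1.
have n0 : 0 < (n.+1%:R : R) by rewrite ltr0n.
have a0 : 0 < a by rewrite invr_gt0 mulr_gt0.
pose U := ball (const_mx a : 'cV[R]_n) a.
have UE (x : 'cV[R]_n) i : U x -> 0 < x i 0 < a * 2.
  move=> -[_ /(_ i 0)]; rewrite /ball/= mxE ltr_norml => /andP[h1 h2].
  by apply/andP; split; lra.
have Uc : U `<=` ref_cell s n.
  move=> x Ux; have h i := UE x i Ux.
  have a21 : a * 2 * n.+1%:R = 1 by rewrite /a -mulrA mulVf// gt_eqF// mulr_gt0.
  case: s => /= [|i].
    split=> [i|]; first by have /andP[/ltW] := h i.
    apply: (@le_trans _ _ (\sum_(i < n) a * 2)).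
      by apply: ler_sum => i _; have /andP[_ /ltW] := h i.
    rewrite sumr_const card_ord -[leLHS]mulr_natr; apply: (@le_trans _ _ (a * 2 * n.+1%:R)); last by rewrite a21.
    by rewrite ler_wpM2l ?mulr_ge0 ?ltW// ltr_nat.
  have /andP[h1 h2] := h i; rewrite ltW//=; apply/ltW/(lt_le_trans h2).
  rewrite -[leRHS]a21; apply: ler_peMr; first by rewrite mulr_ge0 ?ltW.
  by rewrite ler1n.
have oU : open U by exact: ball_open.
apply: (mpoly_eq0_open oU); first by exists (const_mx a); exact: ballxx.
move=> x0 Ux0; apply/eqP/contraT => px0.
have pp : 0 < peval p x0 by rewrite lt_def px0 p0//; exact: Uc.
pose c := peval p x0 / 2.
have c0 : 0 < c by rewrite divr_gt0.
have : nbhs x0 (U `&` [set y | c < peval p y]).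
  apply: filterI; first by apply: open_nbhs_nbhs; split.
  have := @continuous_peval R n p x0.
  move=> /(_ [set r | c < r]); apply; apply: open_nbhs_nbhs; split; last first.
    by rewrite /= /c; lra.
  exact: open_gt.
move=> /nbhs_ballP[e /= e0 he].
(* The cube of side e / 2 with corner x0 lies in the sup-norm ball of radius e, where p exceeds c;
   the integral of p is then at least c (e / 2)^n > 0. *)
pose h := e / 2.
have h0 : 0 < h by rewrite divr_gt0.
pose Phi := Affine (h%:M : 'M[R]_n) x0.
have uh : linpart Phi \in unitmx.
  by rewrite unitmxE det_scalar unitfE expf_neq0 ?gt_eqF.
pose Q := Phi @` ref_cell hypercube n.
have mQ : mset Q by apply: mset_affine_image => //; exact: mset_ref_cell.
have QU y : Q y -> U y /\ c < peval p y.
  move=> [z hz <-]; apply: he; split=> // i j; rewrite [j]ord1 /affine_fun /= mul_scalar_mx !mxE.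
  rewrite /ball/= opprD addrCA subrr addr0 normrN normrM gtr0_norm//.
  have /andP[z0 z1] := hz i; rewrite ger0_norm// (@le_lt_trans _ _ h)//.
    by rewrite ler_piMr// ltW.
  by rewrite /h; lra.
have mp : measurable_fun setT (peval p \o @vec R n) by exact: measurable_peval.
have QC : @vec R n @^-1` Q `<=` @vec R n @^-1` ref_cell s n.
  by move=> t /QU[/Uc].
have iQ : integrable_on Q (peval p).
  apply: integrableS QC _ => //; first exact: mset_ref_cell.
  exact: integrable_on_peval.
have [iQc EQ] : integrable_on Q (fun=> c) /\
    integral_on Q (fun=> c) = `|\det (linpart Phi)| * integral_on (ref_cell hypercube n) (fun=> c).
  apply: (@integral_on_affine_image _ _ Phi (ref_cell hypercube n) uh _ (fun=> c)).
  - exact: mset_ref_cell.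
  - exact: measurable_cst.
  - exact: integrable_on_cst.
have h1 : integral_on Q (fun=> c) <= integral_on Q (peval p).
  by apply: le_integral_on => // y /QU[_ /ltW].
have h2 : integral_on Q (peval p) <= ipoly s p.
  rewrite ipolyE; apply: fine_le.
  - by apply: integrable_fin_num => //; exact: iQ.
  - apply: integrable_fin_num => //; first exact: mset_ref_cell.
    exact: integrable_on_peval.
  - apply: ge0_subset_integral => //; first exact: mset_ref_cell.
      exact/measurable_EFinP/measurable_funTS.
    by move=> t /p0; rewrite lee_fin.
have : 0 < integral_on Q (fun=> c).
  rewrite EQ mulr_gt0//.
    by rewrite normr_gt0 det_scalar expf_neq0 ?gt_eqF.
  rewrite /integral_on Rintegral_cst; last exact: mset_ref_cell.
  by rewrite [X in _ * fine X](lebesgue_tuple_cube n) mulr1.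
by rewrite ltNge (le_trans h1)// -ip0.
Qed.

Lemma ipoly_sqr_eq0 p : ipoly s (p * p) = 0 -> p = 0.
Proof.
move=> h; have /eqP : p * p = 0.
  by apply: ipoly_eq0 h => x _; rewrite pevalM -expr2 sqr_ge0.
by rewrite mulf_eq0 orbb => /eqP.
Qed.

End linearity.

Lemma ipoly_cube_monomial n (m : multinom n) :
  ipoly hypercube (mpolyX R m) = \prod_i (m i).+1%:R^-1.
Proof.
rewrite ipolyE /integral_on /Rintegral integral_mkcond.
rewrite -[RHS]/(fine (\prod_i (m i).+1%:R^-1)%:E) -integral_prod_unit_monomial.
congr fine; apply: eq_integral => t _; rewrite /patch /=.
case: ifPn => [/set_mem h|h].
  rewrite pevalX; congr EFin; apply: eq_bigr => i _; have := h i.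
  by rewrite mxE /unit_monomial => ->.
have [i hi] : exists i, ~~ (0 <= tnth t i <= 1).
  apply/existsP; move: h; apply: contraNT; rewrite negb_exists => /forallP h.
  by apply/mem_set => i; rewrite mxE; have := h i; rewrite negbK.
by rewrite (bigD1 i)//= /unit_monomial (negbTE hi) mul0r.
Qed.

End polynomial_integrals.

(** * Degree, homogeneity and affine composition *)

Section polynomial_degree.
Context {R : realType}.
Variable n : nat.
Implicit Types (p q : mpoly n R).

(* [mmeasure mdeg p] is one more than the degree, so that [poly_le k] is
   [deg_lt k.+1] and [deg_lt 0] holds for the zero polynomial only. *)
Definition deg_lt k p := (mmeasure mdeg p <= k)%N.

Lemma deg_ltP k p : reflect (forall m, mcoeff m p != 0 -> (mdeg m < k)%N) (deg_lt k p).
Proof.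
rewrite /deg_lt mmeasureE; apply: (iffP (bigmax_leqP_seq _ _ _ _)) => h m.
  by rewrite -mcoeff_msupp => mp; exact: (h m mp isT).
by move=> mp _; apply: h; rewrite -mcoeff_msupp.
Qed.

Lemma deg_ltW k k' p : (k <= k')%N -> deg_lt k p -> deg_lt k' p.
Proof. by move=> kk' h; exact: leq_trans kk'. Qed.

Lemma deg_lt0 k : deg_lt k 0.
Proof. by rewrite /deg_lt mmeasure0. Qed.

Lemma deg_ltD k p q : deg_lt k p -> deg_lt k q -> deg_lt k (p + q).
Proof. by rewrite /deg_lt => hp hq; apply: leq_trans (mmeasureD_le _ _ _) _; rewrite geq_max hp. Qed.

Lemma deg_ltN k p : deg_lt k p -> deg_lt k (- p).
Proof. by rewrite /deg_lt mmeasureN. Qed.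

Lemma deg_ltB k p q : deg_lt k p -> deg_lt k q -> deg_lt k (p - q).
Proof. by move=> hp hq; apply: deg_ltD => //; exact: deg_ltN. Qed.

Lemma deg_ltZ k c p : deg_lt k p -> deg_lt k (c *: p).
Proof. by move=> hp; exact: leq_trans (mmeasureZ_le _ _ _) hp. Qed.

Lemma deg_lt_sum k (I : Type) (r : seq I) (P : pred I) (F : I -> mpoly n R) :
  (forall i, P i -> deg_lt k (F i)) -> deg_lt k (\sum_(i <- r | P i) F i).
Proof. by move=> h; apply: (big_ind (deg_lt k)) => //; [exact: deg_lt0|exact: deg_ltD]. Qed.

Lemma deg_ltX k m : (mdeg m < k)%N -> deg_lt k (mpolyX R m).
Proof. by move=> mk; rewrite /deg_lt mmeasureX. Qed.

Lemma deg_ltC c : deg_lt 1 (mpolyC n c).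
Proof. by rewrite /deg_lt mmeasureC leq_b1. Qed.

Lemma deg_lt_ind k (P : mpoly n R -> Prop) : P 0 ->
  (forall p q, P p -> P q -> P (p + q)) -> (forall c p, P p -> P (c *: p)) ->
  (forall m, (mdeg m < k)%N -> P (mpolyX R m)) -> forall p, deg_lt k p -> P p.
Proof.
move=> P0 PD PZ PX p /deg_ltP pk; rewrite (mpolyE p) big_seq.
by apply: (big_ind P) => // m; rewrite mcoeff_msupp => /pk mk; apply: (PZ); exact: PX.
Qed.

Lemma deg_ltM j k p q : deg_lt j.+1 p -> deg_lt k q -> deg_lt (j + k) (p * q).
Proof.
move=> hp hq; move: p hp; apply: (@deg_lt_ind j.+1 (fun p => deg_lt (j + k) (p * q))).
- by rewrite mul0r; exact: deg_lt0.
- by move=> p p' h h'; rewrite mulrDl; exact: deg_ltD.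
- by move=> c p h; rewrite -scalerAl; exact: deg_ltZ.
move=> m mj; move: q hq; apply: (@deg_lt_ind k (fun q => deg_lt (j + k) (mpolyX R m * q))).
- by rewrite mulr0; exact: deg_lt0.
- by move=> p p' h h'; rewrite mulrDr; exact: deg_ltD.
- by move=> c p h; rewrite -scalerAr; exact: deg_ltZ.
move=> m' mk; rewrite -mpolyXD; apply: deg_ltX.
by rewrite mdegD -addnS leq_add.
Qed.

Lemma deg_lt_exp p e : deg_lt 2 p -> deg_lt e.+1 (p ^+ e).
Proof.
move=> hp; elim: e => [|e IH]; first by rewrite expr0 /deg_lt mmeasure1.
by rewrite exprS -add1n; exact: deg_ltM.
Qed.

Lemma deg_lt_mderiv i k p : deg_lt k.+1 p -> deg_lt k (mderiv i p).
Proof.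
have [->|p0] := eqVneq p 0; first by rewrite mderiv0 => _; exact: deg_lt0.
by move=> pk; rewrite /deg_lt -ltnS; exact: leq_trans (mmeasure_mderiv i p0) pk.
Qed.

Lemma homogP k p : poly_homog k p <-> forall m, mcoeff m p != 0 -> mdeg m = k.
Proof.
split=> [hp m|hp].
  by rewrite -mcoeff_msupp; move/dhomogP: hp; exact.
by apply/dhomogP => m; rewrite mcoeff_msupp => /hp.
Qed.

Lemma homog_deg_lt k p : poly_homog k p -> deg_lt k.+1 p.
Proof. by move=> /homogP h; apply/deg_ltP => m /h ->. Qed.

Lemma homog_eq0 k p : poly_homog k p -> deg_lt k p -> p = 0.
Proof.
move=> /homogP h /deg_ltP h'; apply/mpolyP => m; rewrite mcoeff0.
by apply/eqP/contraT => pm; have := h' m pm; rewrite (h m pm) ltnn.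
Qed.

Lemma homog_ind k (P : mpoly n R -> Prop) : P 0 ->
  (forall p q, P p -> P q -> P (p + q)) -> (forall c p, P p -> P (c *: p)) ->
  (forall m, mdeg m = k -> P (mpolyX R m)) -> forall p, poly_homog k p -> P p.
Proof.
move=> P0 PD PZ PX p /homogP pk; rewrite (mpolyE p) big_seq.
by apply: (big_ind P) => // m; rewrite mcoeff_msupp => /pk mk; apply: (PZ); exact: PX.
Qed.

Lemma mulX_mderivX (i : 'I_n) m :
  mpolyX R (mnm1 i) * mderiv i (mpolyX R m) = (m i)%:R *: mpolyX R m.
Proof.
rewrite mderivX -scalerAr; have [->|mi] := eqVneq (m i) 0%N; first by rewrite !scale0r.
rewrite -mpolyXD; congr (_ *: mpolyX _ _); apply/mnmP => j.
by rewrite mnmDE mnmBE mnm1E; case: eqVneq => [<-|]; lia.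
Qed.

(** Euler's identity; it evaluates the divergence of the Raviart-Thomas part x q. *)
Lemma euler_homog k p : poly_homog k p ->
  \sum_i mpolyX R (mnm1 i) * mderiv i p = k%:R *: p.
Proof.
move: p; apply: homog_ind.
- by rewrite scaler0 big1// => i _; rewrite mderiv0 mulr0.
- move=> p q hp hq; rewrite scalerDr -hp -hq -big_split; apply: eq_bigr => i _.
  by rewrite mderivD mulrDr.
- move=> c p hp; rewrite scalerA mulrC -scalerA -hp scaler_sumr.
  by apply: eq_bigr => i _; rewrite mderivZ -scalerAr.
- move=> m mk; under eq_bigr do rewrite mulX_mderivX.
  by rewrite -scaler_suml -mk mdegE natr_sum.
Qed.

Lemma peval_inj p q : peval p =1 peval q -> p = q.
Proof.
move=> pq; apply/eqP; rewrite -subr_eq0; apply/eqP.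
apply: (@mpoly_eq0_open _ _ setT); [exact: openT|by exists 0|] => x _.
by rewrite pevalB pq subrr.
Qed.

Lemma mpolyX1_neq0 i : mpolyX R (mnm1 i : multinom n) != 0.
Proof.
apply/eqP => h; have := congr1 (fun p => peval p (const_mx 1)) h.
by rewrite pevalXU peval0 mxE => /eqP; rewrite oner_eq0.
Qed.

End polynomial_degree.

Section affine_composition.
Context {R : realType}.
Variables (m n : nat) (Phi : affine (R := R) m n).

Definition affine_poly (a : 'I_n) : mpoly m R :=
  \sum_b linpart Phi a b *: mpolyX R (mnm1 b) + mpolyC m (origin Phi a 0).

Definition acomp (p : mpoly n R) : mpoly m R :=
  comp_mpoly [tuple affine_poly a | a < n] p.

Lemma peval_acomp p y : peval (acomp p) y = peval p (Phi y).
Proof.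
rewrite /peval comp_mpoly_meval; apply: meval_eq => a.
rewrite tnth_mktuple -/(peval _ _) pevalD pevalC peval_sum !mxE; congr (_ + _).
by apply: eq_bigr => b _; rewrite pevalZ pevalXU.
Qed.

Lemma acompD p q : acomp (p + q) = acomp p + acomp q.
Proof. by apply: peval_inj => y; rewrite pevalD !peval_acomp pevalD. Qed.

Lemma acompB p q : acomp (p - q) = acomp p - acomp q.
Proof. by apply: peval_inj => y; rewrite pevalB !peval_acomp pevalB. Qed.

Lemma acompZ c p : acomp (c *: p) = c *: acomp p.
Proof. by apply: peval_inj => y; rewrite pevalZ !peval_acomp pevalZ. Qed.

Lemma acomp0 : acomp 0 = 0.
Proof. by apply: peval_inj => y; rewrite peval_acomp !peval0. Qed.

Lemma deg_lt_acomp k p : deg_lt k p -> deg_lt k (acomp p).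
Proof.
have hp a : deg_lt 2 (affine_poly a).
  apply: deg_ltD; last exact: (deg_ltW _ (deg_ltC _ _)).
  by apply: deg_lt_sum => b _; apply: deg_ltZ; apply: deg_ltX; rewrite mdeg1.
move: p; apply: deg_lt_ind.
- by rewrite acomp0; exact: deg_lt0.
- by move=> p q h h'; rewrite acompD; exact: deg_ltD.
- by move=> c p h; rewrite acompZ; exact: deg_ltZ.
move=> e ek; apply: (deg_ltW ek); rewrite /acomp comp_mpolyX mdegE.
apply: (big_ind2 (fun (p : mpoly m R) d => deg_lt d.+1 p)).
- by rewrite /deg_lt mmeasure1.
- by move=> p d q d' h h'; rewrite -addnS; exact: deg_ltM.
- by move=> a _; rewrite tnth_mktuple; exact: deg_lt_exp.
Qed.

End affine_composition.

(** * Bounding a quadratic functional by finitely many linear ones *)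

Section quadratic_bound.
Context {R : realType}.
Variables (X : Type) (comb : X -> R -> X -> X) (b : X -> R).
Hypothesis b0 : forall x, 0 <= b x.
(** For a squared seminorm this is the inequality obtained from x = (x - c y) + c y. *)
Hypothesis b_comb : forall x c y, b x <= 2 * b (comb x c y) + 2 * c ^+ 2 * b y.

(* [comb x c y] stands for [x - c *: y]. *)
Lemma quadratic_bound_nat (N : nat) (a : nat -> X -> R) (P : X -> Prop) :
  (forall i x c y, a i (comb x c y) = a i x - c * a i y) ->
  (forall x c y, P x -> P y -> P (comb x c y)) ->
  (forall x, P x -> (forall i, (i < N)%N -> a i x = 0) -> b x = 0) ->
  exists2 C, 0 <= C & forall x rho, P x -> 0 <= rho ->
    (forall i, (i < N)%N -> `|a i x| <= rho) -> b x <= C * rho ^+ 2.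
Proof.
move=> acomb; elim: N P => [|N IH] P Pcomb ker.
  by exists 0 => // x rho Px _ _; rewrite mul0r (ker x Px).
(* If the last functional vanishes on P it carries no information and is dropped; otherwise some y
   in P serves as a pivot. *)
have [aN0|] := pselect (forall y, P y -> a N y = 0).
  have [||C C0 hC] := IH P => //.
    move=> x Px h; apply: ker => // i; rewrite ltnS leq_eqVlt => /predU1P[->|/h//].
    exact: aN0.
  by exists C => // x rho Px r0 h; apply: hC => // i iN; apply: h; exact: ltnW.
move=> /existsNP[y /not_implyP[Py /eqP aNy]].
have [||C C0 hC] := IH (fun x => P x /\ a N x = 0).
- move=> x c x' [Px ax] [Px' ax']; split; first exact: Pcomb.
  by rewrite acomb ax ax' mulr0 subr0.
- move=> x [Px ax] h; apply: ker => // i; rewrite ltnS leq_eqVlt => /predU1P[->//|].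
  exact: h.
(* With c = a_N(x) / a_N(y), the element x - c y is in the kernel of the pivot functional, and its
   other values are at most M rho since |c| <= rho / |a_N(y)|. *)
pose M := 1 + \sum_(i < N) `|a i y| / `|a N y|.
have nay : 0 < `|a N y| by rewrite normr_gt0.
have M0 : 0 <= M by rewrite addr_ge0// sumr_ge0// => i _; rewrite divr_ge0.
exists (2 * C * M ^+ 2 + 2 * b y / `|a N y| ^+ 2).
  by rewrite addr_ge0 ?divr_ge0 ?mulr_ge0 ?exprn_ge0.
move=> x rho Px r0 h.
pose c := a N x / a N y.
have cN : `|c| <= rho / `|a N y|.
  by rewrite /c normrM normfV ler_pM2r ?invr_gt0//; exact: h.
have c2 : c ^+ 2 <= rho ^+ 2 / `|a N y| ^+ 2.
  rewrite -(real_normK (num_real c)) -expr_div_n.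
  by rewrite lerXn2r ?nnegrE ?divr_ge0.
apply: (le_trans (b_comb x c y)).
have h1 : b (comb x c y) <= C * (rho * M) ^+ 2.
  apply: hC; [|exact: mulr_ge0|].
    by split; [exact: Pcomb|rewrite acomb /c divfK// subrr].
  move=> i iN; rewrite acomb (le_trans (ler_normB _ _))// mulrDr mulr1.
  apply: lerD; first by apply: h; exact: ltnW.
  rewrite normrM (bigD1 (Ordinal iN))//= mulrDr.
  apply: (@le_trans _ _ (rho * (`|a i y| / `|a N y|))).
    by rewrite mulrCA [leRHS]mulrC ler_wpM2r.
  by rewrite lerDl mulr_ge0// sumr_ge0// => j _; rewrite divr_ge0.
rewrite [leRHS]mulrDl; apply: lerD.
  apply: (@le_trans _ _ (2 * (C * (rho * M) ^+ 2))); first by rewrite ler_wpM2l.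
  by rewrite le_eqVlt; apply/orP; left; apply/eqP; ring.
apply: (@le_trans _ _ (2 * (rho ^+ 2 / `|a N y| ^+ 2) * b y)).
  by rewrite ler_wpM2r// ler_wpM2l.
by rewrite le_eqVlt; apply/orP; left; apply/eqP; ring.
Qed.

(** Finite dimension is encoded as the finiteness of [I]; eliminating one functional after the other
    takes the place of the compactness of a unit sphere. *)
Lemma quadratic_bound (I : finType) (a : I -> X -> R) (P : X -> Prop) :
  (forall i x c y, a i (comb x c y) = a i x - c * a i y) ->
  (forall x c y, P x -> P y -> P (comb x c y)) ->
  (forall x, P x -> (forall i, a i x = 0) -> b x = 0) ->
  exists2 C, 0 <= C & forall x rho, P x -> 0 <= rho ->
    (forall i, `|a i x| <= rho) -> b x <= C * rho ^+ 2.
Proof.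
move=> acomb Pcomb ker.
pose a' j x := if insub j is Some j' then a (@enum_val I predT j') x else 0.
have a'E i : a' (enum_rank i) = a i.
  by apply/funext => x; rewrite /a' valK enum_rankK.
have [| //| |C C0 hC] := @quadratic_bound_nat #|I| a' P.
- move=> j x c y; rewrite /a'; case: insubP => [j' _ _|_]; first exact: acomb.
  by rewrite mulr0 subr0.
- move=> x Px h; apply: ker => // i; rewrite -a'E; apply: h; exact: ltn_ord.
exists C => // x rho Px r0 h; apply: hC => // i iN.
by rewrite /a' insubT; exact: h.
Qed.

End quadratic_bound.

(** * Reference facets, traces and the reference weak form *)

Section reference_facets.
Context {R : realType}.

(** On the simplex [Some i] stands for the facet x_i = 0 and [None] for the oblique one; on the
    hypercube [(i, b)] stands for x_i = b. *)
Definition flabel (s : cell_shape) n : finType :=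
  match s with
  | simplex => option 'I_n.+1
  | hypercube => ('I_n.+1 * bool)%type
  end.

(** The embedding of R^n as the hyperplane x_i = 0; its transpose forgets x_i. *)
Definition ins_mx n (i : 'I_n.+1) : 'M[R]_(n.+1, n) := \matrix_(a, b) (a == lift i b)%:R.

(* The facet opposite to the origin of the simplex, with label [None], is
   parametrized by forgetting the first coordinate. *)
Definition facet_map s n : flabel s n -> affine (R := R) n n.+1 :=
  match s with
  | simplex => fun l => match l with
      | Some i => Affine (ins_mx i) 0
      | None => Affine (ins_mx ord0 - delta_mx ord0 (0 : 'I_1) *m const_mx 1) (delta_mx ord0 0)
      end
  | hypercube => fun l => Affine (ins_mx l.1) (l.2%:R *: delta_mx l.1 0)
  end.

(* Outward, but not normalized. *)
Definition facet_normal s n : flabel s n -> 'cV[R]_n.+1 :=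
  match s with
  | simplex => fun l => match l with
      | Some i => - delta_mx i 0
      | None => const_mx 1
      end
  | hypercube => fun l => (if l.2 then 1 else -1) *: delta_mx l.1 0
  end.

(** The coordinate that the parametrization of the facet omits. *)
Definition facet_index s n : flabel s n -> 'I_n.+1 :=
  match s with
  | simplex => fun l => if l is Some i then i else ord0
  | hypercube => fun l => l.1
  end.

Definition facet_proj s n (l : flabel s n) : affine (R := R) n.+1 n :=
  Affine (ins_mx (facet_index l))^T 0.

Lemma ins_mxE n i (y : 'cV[R]_n) j : (ins_mx i *m y) (lift i j) 0 = y j 0.
Proof.
rewrite mxE (bigD1 j)//= big1 ?addr0 ?mxE ?eqxx ?mul1r// => b bj.
by rewrite mxE (inj_eq lift_inj) eq_sym (negbTE bj) mul0r.
Qed.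

Lemma ins_mxE0 n i (y : 'cV[R]_n) : (ins_mx i *m y) i 0 = 0.
Proof. by rewrite mxE big1// => b _; rewrite mxE (negbTE (neq_lift _ _)) mul0r. Qed.

Lemma simplex_facet_mapE n (y : 'cV[R]_n) a : facet_map (None : flabel simplex n) y a 0 =
  (ins_mx ord0 *m y) a 0 + (a == ord0)%:R * (1 - \sum_j y j 0).
Proof.
have E : (const_mx 1 *m y : 'cV_1) 0 0 = \sum_j y j 0.
  by rewrite mxE; apply: eq_bigr => j _; rewrite mxE mul1r.
rewrite /affine_fun /= mulmxBl -mulmxA -E (mx11_scalar (_ *m y)) mul_mx_scalar !mxE !eqxx !andbT.
rewrite mulr1n; ring.
Qed.

Lemma facet_map_lift s n (l : flabel s n) y j :
  (facet_map l y) (lift (facet_index l) j) 0 = y j 0.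
Proof.
case: s l => [[i|]|[i b]]; [rewrite /affine_fun /=| |rewrite /affine_fun /=].
- by rewrite addr0 ins_mxE.
- by rewrite simplex_facet_mapE ins_mxE eq_sym (negbTE (neq_lift _ _)) mul0r addr0.
- by rewrite mxE ins_mxE !mxE eq_sym (negbTE (neq_lift _ _)) mulr0 addr0.
Qed.

Lemma facet_mapK s n (l : flabel s n) : cancel (facet_map l) (facet_proj l).
Proof.
move=> y; apply/colP => j.
transitivity (((ins_mx (facet_index l))^T *m facet_map l y) j 0).
  by have /(congr1 (fun M : 'cV_n => M j 0)) := addr0 ((ins_mx (facet_index l))^T *m facet_map l y).
rewrite mxE.
rewrite (bigD1 (lift (facet_index l) j))//= big1 ?addr0.
  by rewrite [_^T _ _]mxE [ins_mx _ _ _]mxE eqxx mul1r facet_map_lift.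
by move=> a aj; rewrite [_^T _ _]mxE [ins_mx _ _ _]mxE (negbTE aj) mul0r.
Qed.

Lemma simplex_facet_map0 n i (y : 'cV[R]_n) : facet_map (Some i : flabel simplex n) y i 0 = 0.
Proof. by rewrite /affine_fun /= addr0 ins_mxE0. Qed.

Lemma simplex_facet_map_sum n (y : 'cV[R]_n) :
  \sum_i facet_map (None : flabel simplex n) y i 0 = 1.
Proof.
under eq_bigr do rewrite simplex_facet_mapE.
rewrite big_ord_recl ins_mxE0 eqxx mul1r add0r.
under [X in _ + X]eq_bigr do rewrite ins_mxE eq_sym (negbTE (neq_lift _ _)) mul0r addr0.
by rewrite subrK.
Qed.

Lemma cube_facet_map n i b (y : 'cV[R]_n) :
  facet_map ((i, b) : flabel hypercube n) y i 0 = b%:R.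
Proof. by rewrite /affine_fun /= mxE ins_mxE0 !mxE !eqxx mulr1 add0r. Qed.

Definition trace s n (l : flabel s n) (p : mpoly n.+1 R) : mpoly n R := acomp (facet_map l) p.

(** Constant in the omitted direction: a right inverse of [trace] that does not raise the degree. *)
Definition extension s n (l : flabel s n) (q : mpoly n R) : mpoly n.+1 R := acomp (facet_proj l) q.

Lemma peval_trace s n (l : flabel s n) p y : peval (trace l p) y = peval p (facet_map l y).
Proof. exact: peval_acomp. Qed.

Lemma extensionK s n (l : flabel s n) : cancel (extension l) (trace l).
Proof. by move=> q; apply: peval_inj => y; rewrite !peval_acomp facet_mapK. Qed.

End reference_facets.

Section weak_form.
Context {R : realType}.
Variables (s : cell_shape) (n : nat) (c : flabel s n -> R).
Variables (zeta : 'I_n.+1 -> mpoly n.+1 R) (delta : flabel s n -> 'I_n.+1 -> mpoly n R).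

(** Row a of the reference problem tested with the field w e_b, without any data. Fields that are
    tests only as a whole, such as the curls, are handled as sums over b. *)
Definition weak a b (w : mpoly n.+1 R) : R :=
  ipoly s (mderiv b (zeta a) * w) -
  \sum_l c l * facet_normal l b 0 * ipoly s (delta l a * trace l w).

Lemma weakD a b w w' : weak a b (w + w') = weak a b w + weak a b w'.
Proof.
rewrite /weak mulrDr ipolyD [RHS]addrACA; congr (_ + _).
rewrite -opprD -big_split; congr (- _); apply: eq_bigr => l _.
by rewrite /trace acompD mulrDr ipolyD mulrDr.
Qed.

Lemma weakZ a b r w : weak a b (r *: w) = r * weak a b w.
Proof.
rewrite /weak -scalerAr ipolyZ mulrBr; congr (_ - _).
rewrite mulr_sumr; apply: eq_bigr => l _.
by rewrite /trace acompZ -scalerAr ipolyZ mulrCA.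
Qed.

Lemma weak0 a b : weak a b 0 = 0.
Proof. by rewrite -(scale0r 0) weakZ mul0r. Qed.

Lemma weakB a b w w' : weak a b (w - w') = weak a b w - weak a b w'.
Proof. by rewrite -scaleN1r weakD weakZ mulN1r. Qed.

End weak_form.

Section admissible.
Context {R : realType}.
Variables (s : cell_shape) (n k : nat).

Definition refpair := (('I_n.+1 -> mpoly n.+1 R) * (flabel s n -> 'I_n.+1 -> mpoly n R))%type.

(** The properties that pulled-back pairs retain. The polynomial e gathers the normal part of the
    trace and the facet unknown, both of degree at most k. *)
Definition admissible (x : refpair) : Prop :=
  [/\ ref_V s k x.1,
      forall l, \sum_b facet_normal l b 0 *: x.2 l b = 0 &
      forall l a, exists2 e, deg_lt k.+1 e & x.2 l a = trace l (x.1 a) - e].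

Lemma admissible_delta_deg x : admissible x -> (forall a, deg_lt k.+1 (x.1 a)) ->
  forall l a, deg_lt k.+1 (x.2 l a).
Proof.
move=> [_ _ h] hz l a; have [e he ->] := h l a.
by apply: deg_ltB => //; apply: deg_lt_acomp.
Qed.

(* The traces of the polynomials of degree k exhaust those on the facet. *)
Lemma delta_eq0 x : admissible x -> (forall a, deg_lt k.+1 (x.1 a)) -> forall l a,
  (forall w, deg_lt k.+1 w -> ipoly s (x.2 l a * trace l w) = 0) -> x.2 l a = 0.
Proof.
move=> hx hz l a h; apply: (@ipoly_sqr_eq0 _ s); rewrite -{2}(extensionK l (x.2 l a)).
by apply: h; apply: deg_lt_acomp; exact: admissible_delta_deg.
Qed.

End admissible.

(** * Trivial kernel on the simplex *)

Section kernel_simplex.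
Context {R : realType}.
Variables (n k : nat) (c : flabel simplex n -> R).
Variable x : refpair (R := R) simplex n.
Let zeta := x.1.
Let delta := x.2.
Hypothesis hx : admissible k x.
Hypothesis c0 : forall l, c l != 0.
Hypothesis weak_eq0 : forall a b w, deg_lt k.+1 w -> weak c zeta delta a b w = 0.
Local Notation "''X_' i" := (mpolyX R (mnm1 i)).

Lemma sum_flabel_simplex (F : flabel simplex n -> R) b :
  (forall m, m != b -> F (Some m) = 0) -> \sum_l F l = F None + F (Some b).
Proof.
move=> F0; rewrite (bigD1 None)//= (bigD1 (Some b))//= big1 ?addr0// => -[m|//] /= mb.
by apply: F0; apply: contra mb => /eqP ->.
Qed.

(** On x_i = 0 the normal is -e_i, so this is what tangentiality says there. *)
Lemma simplex_delta_diag i : delta (Some i : flabel simplex n) i = 0.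
Proof.
have [_ /(_ (Some i : flabel simplex n)) h _] := hx.
move: h; rewrite (bigD1 i)//= big1 ?addr0.
  by rewrite !mxE !eqxx scaleN1r => /eqP; rewrite oppr_eq0 => /eqP.
by move=> j ji; rewrite !mxE (negbTE ji) oppr0 scale0r.
Qed.

(** The test is w times the identity with w = div zeta, whose boundary integrand contains w (nu_l .
    delta_l) = 0. The divergence is allowed as w because it has degree at most k even though zeta
    may have degree k + 1. *)
Lemma simplex_div_eq0 : \sum_a mderiv a (zeta a) = 0.
Proof.
have [[p [q [hp hq hz]]] tang _] := hx.
have dk : deg_lt k.+1 (\sum_a mderiv a (zeta a)).
  apply: deg_lt_sum => a _; apply: deg_lt_mderiv; rewrite /zeta hz.
  apply: deg_ltD; first exact: deg_ltW (hp a).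
  by apply: (@deg_ltM _ _ 1 k.+1); [apply: deg_ltX; rewrite mdeg1|exact: homog_deg_lt].
apply: (@ipoly_sqr_eq0 _ simplex).
have : \sum_a weak c zeta delta a a (\sum_a mderiv a (zeta a)) = 0.
  by rewrite big1// => a _; exact: weak_eq0.
set w := \sum_a _; rewrite /weak sumrB exchange_big /= [X in _ - X]big1 ?subr0.
  by rewrite -ipoly_sum -mulr_suml.
move=> l _; under eq_bigr do rewrite -mulrA -ipolyZ scalerAl.
by rewrite -mulr_sumr -ipoly_sum -mulr_suml tang mul0r ipoly0 mulr0.
Qed.

(** Euler's identity gives div (x q) = (d + k) q with d = [n.+1], so div zeta = 0 makes q a multiple
    of div p, which has degree less than k; but q is homogeneous of degree k. *)
Lemma simplex_zeta_deg a : deg_lt k.+1 (zeta a).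
Proof.
have [[p [q [hp hq hz]]] _ _] := hx.
have q0 : q = 0.
  apply: (homog_eq0 hq).
  have := simplex_div_eq0; rewrite /zeta; under eq_bigr => b _.
    rewrite hz mderivD mderivM mderiv_XU eqxx mul1r; over.
  rewrite big_split /= big_split /= (euler_homog hq) sumr_const card_ord.
  rewrite -scaler_nat -scalerDl -natrD => /eqP; rewrite addrC addr_eq0 => /eqP h.
  have -> : q = (n.+1 + k)%:R^-1 *: ((n.+1 + k)%:R *: q).
    by rewrite scalerA mulVf ?scale1r// pnatr_eq0.
  rewrite h; apply: deg_ltZ; apply: deg_ltN.
  by apply: deg_lt_sum => b _; exact: deg_lt_mderiv (hp b).
by rewrite /zeta hz q0 mulr0 addr0; exact: hp.
Qed.

Let dz i j : deg_lt k (mderiv j (zeta i)).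
Proof. exact: deg_lt_mderiv (simplex_zeta_deg i). Qed.

Lemma simplex_grad_diag i : mderiv i (zeta i) = 0.
Proof.
(* This barycentric coordinate vanishes on the oblique facet. On x_m = 0 with m different from i the
   normal has no i-th component, and on x_i = 0 the jump has none. *)
pose lam0 : mpoly n.+1 R := 1 - \sum_j 'X_j.
have lam0_deg : deg_lt 2 lam0.
  apply: deg_ltB; first by rewrite /deg_lt mmeasure1.
  by apply: deg_lt_sum => j _; apply: deg_ltX; rewrite mdeg1.
have lam0E y : peval lam0 y = 1 - \sum_j y j 0.
  by rewrite pevalB peval1 peval_sum; congr (_ - _); apply: eq_bigr => j _; rewrite pevalXU.
have := @weak_eq0 i i (lam0 * mderiv i (zeta i)) (@deg_ltM _ _ 1 k _ _ lam0_deg (dz i i)).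
rewrite /weak big1 ?subr0.
  rewrite mulrCA => h.
  have /eqP : lam0 * (mderiv i (zeta i) * mderiv i (zeta i)) = 0.
    apply: ipoly_eq0 h => y [_ y1]; rewrite !pevalM -expr2 mulr_ge0 ?sqr_ge0// lam0E.
    by rewrite subr_ge0.
  rewrite !mulf_eq0 orbb => /orP[/eqP l0|/eqP//].
  have := congr1 (fun p => peval p 0) l0; rewrite lam0E peval0 big1 => [/eqP|j _].
    by rewrite subr0 oner_eq0.
  by rewrite mxE.
move=> [m|] _ /=.
- rewrite !mxE; have [->|_] := eqVneq; last by rewrite oppr0 mulr0 mul0r.
  by rewrite simplex_delta_diag mul0r ipoly0 mulr0.
- rewrite (_ : trace _ _ = 0) ?mulr0 ?ipoly0 ?mulr0//.
  apply: peval_inj => y; rewrite peval_trace pevalM lam0E simplex_facet_map_sum.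
  by rewrite subrr mul0r peval0.
Qed.

(** The field x_j (d_j zeta_i) (e_j - e_i) is tangent to the oblique facet, vanishes on x_j = 0 and
    meets delta_i = 0 on x_i = 0. Its e_i part has no volume term since d_i zeta_i = 0, which leaves
    the integral of x_j (d_j zeta_i)^2. *)
Lemma simplex_grad_eq0 i j : mderiv j (zeta i) = 0.
Proof.
have [->|ij] := eqVneq j i; first exact: simplex_grad_diag.
pose w := 'X_j * mderiv j (zeta i).
have hw : deg_lt k.+1 w by apply: (@deg_ltM _ _ 1 k) => //; apply: deg_ltX; rewrite mdeg1.
have : weak c zeta delta i j w - weak c zeta delta i i w = 0 by rewrite !weak_eq0// subrr.
rewrite /weak simplex_grad_diag mul0r ipoly0 sub0r opprK -addrA [X in _ + X](_ : _ = 0).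
  rewrite addr0 /w mulrCA => h.
  have /eqP : 'X_j * (mderiv j (zeta i) * mderiv j (zeta i)) = 0.
    apply: ipoly_eq0 h => y [y0 _]; rewrite !pevalM -expr2 mulr_ge0 ?sqr_ge0//.
    by rewrite pevalXU.
  by rewrite !mulf_eq0 orbb (negbTE (mpolyX1_neq0 _)) => /eqP.
rewrite addrC; apply/eqP; rewrite subr_eq0; apply/eqP; apply: eq_bigr => -[m|] _ /=; last first.
  by rewrite !mxE.
rewrite !mxE !andbT; transitivity (0 : R).
  have [->|_] := eqVneq i m; last by rewrite oppr0 mulr0 mul0r.
  by rewrite simplex_delta_diag mul0r ipoly0 mulr0.
have [jm|_] := eqVneq j m; last by rewrite oppr0 mulr0 mul0r.
rewrite (_ : trace _ _ = 0) ?mulr0 ?ipoly0 ?mulr0//.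
apply: peval_inj => y; rewrite peval_trace pevalM pevalXU.
by rewrite jm simplex_facet_map0 mul0r peval0.
Qed.

Lemma simplex_delta_eq0 l a : delta l a = 0.
Proof.
apply: (delta_eq0 hx simplex_zeta_deg) => w hw.
pose B l := ipoly simplex (delta l a * trace l w).
(* The normal component of e_b is 1 on the oblique facet, -1 on x_b = 0 and 0 on the other
   facets. *)
have key b : c None * B None = c (Some b) * B (Some b).
  have := weak_eq0 a b hw; rewrite /weak simplex_grad_eq0 mul0r ipoly0 sub0r.
  rewrite (@sum_flabel_simplex _ b) => [|m mb]; last first.
    by rewrite !mxE eq_sym (negbTE mb) oppr0 mulr0 mul0r.
  by rewrite !mxE !eqxx mulr1 mulrN1 mulNr => /eqP; rewrite oppr_eq0 subr_eq0 => /eqP.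
have Ba : B (Some a) = 0 by rewrite /B simplex_delta_diag mul0r ipoly0.
have BN : B None = 0.
  by have /eqP := key a; rewrite Ba mulr0 mulf_eq0 (negbTE (c0 _)) => /eqP.
case: l => [b|]; last exact: BN.
by have /esym/eqP := key b; rewrite BN mulr0 mulf_eq0 (negbTE (c0 _)) => /eqP.
Qed.

End kernel_simplex.

(** * Trivial kernel on the hypercube *)

Section cube_by_parts.
Context {R : realType}.
Variable n : nat.
Local Notation "''X_' i" := (mpolyX R (mnm1 i)).
Local Notation mX m := (mpolyX R m).
Implicit Types (m : multinom n) (p : mpoly n R).

(** The exponent of X^m restricted to x_j = 1. *)
Definition mclear (j : 'I_n) m : multinom n := Multinom [tuple (if i == j then 0 else m i)%N | i < n].

Lemma mclearE j m i : mclear j m i = if i == j then 0%N else m i.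
Proof. by rewrite mnmE. Qed.

Lemma mdeg_mclear j m : mdeg m = (m j + mdeg (mclear j m))%N.
Proof.
rewrite !mdegE (bigD1 j)//= [in RHS](bigD1 j)//= mclearE eqxx add0n; congr (_ + _)%N.
by apply: eq_bigr => i ij; rewrite mclearE (negbTE ij).
Qed.

Lemma mclearC i j m : mclear i (mclear j m) = mclear j (mclear i m).
Proof. by apply/mnmP => a; rewrite !mclearE; case: ifP; case: ifP. Qed.

Lemma mderiv_mulX j m : mderiv j ('X_j * mX m) = (m j).+1%:R *: mX m.
Proof.
rewrite -mpolyXD mderivX mnmDE mnm1E eqxx add1n; congr (_ *: mpolyX _ _).
by apply/mnmP => i; rewrite mnmBE mnmDE mnm1E addKn.
Qed.

Lemma ipoly_cube_mderiv_mulX j m :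
  ipoly hypercube (mderiv j ('X_j * mX m)) = \prod_(i | i != j) (m i).+1%:R^-1.
Proof.
by rewrite mderiv_mulX ipolyZ ipoly_cube_monomial (bigD1 j)//= mulrA divff ?mul1r// pnatr_eq0.
Qed.

(** Both sides are integrals over the face x_j = 1, the factor x_j removing the face x_j = 0; on x_j
    = 1 the power of x_j does not matter. On monomials this is the explicit formula. *)
Lemma ipoly_cube_mderiv_mclear j m p :
  ipoly hypercube (mderiv j ('X_j * mX m * p)) =
  ipoly hypercube (mderiv j ('X_j * mX (mclear j m) * p)).
Proof.
rewrite (mpolyE p) !mulr_sumr !raddf_sum !ipoly_sum; apply: eq_bigr => r _ /=.
rewrite -!scalerAr !mderivZ !ipolyZ -!mulrA -!mpolyXD; congr (_ * _).
have E m' : mpolyX R (mnm_add (mnm1 j) (mnm_add m' r)) = 'X_j * mX (mnm_add m' r).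
  by rewrite mpolyXD.
rewrite !E !ipoly_cube_mderiv_mulX; apply: eq_bigr => i ij.
by rewrite !mnmDE mclearE (negbTE ij).
Qed.

End cube_by_parts.

Section kernel_cube.
Context {R : realType}.
Variables (n k : nat) (c : flabel hypercube n -> R).
Variable x : refpair (R := R) hypercube n.
Let zeta := x.1.
Let delta := x.2.
Hypothesis hx : admissible k x.
Hypothesis c0 : forall l, c l != 0.
Hypothesis weak_eq0 : forall a b w, deg_lt k.+1 w -> weak c zeta delta a b w = 0.
Local Notation "''X_' i" := (mpolyX R (mnm1 i)).
Local Notation mX m := (mpolyX R m).
Implicit Types (m : multinom n.+1).

Let T a b w := weak c zeta delta a b w.
Let B (l : flabel hypercube n) a w := ipoly hypercube (delta l a * trace l w).

(** The vanishing of row a of the form on [curl_field k a' m], expanded into its terms. These have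
    degree k + 1 and are not tests one by one. *)
Hypothesis curl_eq0 : forall a a' m, m a' = 0%N -> mdeg m = k ->
  (k + n.+1)%:R * T a a' ('X_a' * mX m) = \sum_b T a b ('X_b * mX m).

Lemma cube_weakE a b w : T a b w = ipoly hypercube (mderiv b (zeta a) * w) -
  (c (b, true) * B (b, true) a w - c (b, false) * B (b, false) a w).
Proof.
rewrite /T /weak; congr (_ - _).
pose F i e := c (i, e) * (if e then 1 else -1) * (b == i)%:R * B (i, e) a w.
transitivity (\sum_i \sum_e F i e).
  rewrite pair_bigA; apply: eq_bigr => -[i e] _; rewrite /F /B /= !mxE andbT.
  by rewrite !mulrA.
rewrite (bigD1 b)//= [X in _ + X]big1 ?addr0.
  by rewrite big_bool /F /= eqxx !mulr1 mulrN1 mulNr.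
by move=> i ib; rewrite big1// => e _; rewrite /F eq_sym (negbTE ib) mulr0 mul0r.
Qed.

Lemma cube_delta_diag i e : delta (i, e) i = 0.
Proof.
have [_ /(_ (i, e)) h _] := hx.
move: h; rewrite (bigD1 i)//= big1 ?addr0.
  rewrite !mxE !eqxx mulr1; case: e => /eqP; first by rewrite scale1r => /eqP.
  by rewrite scaleN1r oppr_eq0 => /eqP.
by move=> j ji; rewrite !mxE (negbTE ji) mulr0 scale0r.
Qed.

(** The derivative has degree at most k, and as the coefficient of e_a it meets only the facets
    orthogonal to e_a, where delta_a = 0. *)
Lemma cube_grad_diag a : mderiv a (zeta a) = 0.
Proof.
have [[p [q [hp hq hz]]] _ _] := hx.
have := @weak_eq0 a a (mderiv a (zeta a)); rewrite -/(T _ _ _) cube_weakE.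
rewrite /B !cube_delta_diag !mul0r ipoly0 !mulr0 !subr0 => h; apply: (@ipoly_sqr_eq0 _ hypercube).
apply: h; apply: deg_lt_mderiv; rewrite /zeta hz; apply: deg_ltD; first exact: deg_ltW (hp a).
by apply: (@deg_ltM _ _ 1 k.+1); [apply: deg_ltX; rewrite mdeg1|exact: homog_deg_lt].
Qed.

Lemma cube_weak_diag a w : T a a w = 0.
Proof.
by rewrite cube_weakE cube_grad_diag mul0r /B !cube_delta_diag !mul0r !ipoly0 !mulr0 !subr0.
Qed.

(** The coefficient of X^m in d_a (x_a q_a) is m_a + 1 times that in q_a, so d_a (x_a q_a) = - d_a
    p_a gives q_a a degree less than k, against its homogeneity. *)
Lemma cube_zeta_deg a : deg_lt k.+1 (zeta a).
Proof.
have [[p [q [hp hq hz]]] _ _] := hx.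
suff q0 : q a = 0 by rewrite /zeta hz q0 mulr0 addr0; exact: hp.
apply: (homog_eq0 (hq a)); apply/deg_ltP => m qm.
have h : mderiv a ('X_a * q a) = - mderiv a (p a).
  by apply/eqP; rewrite -addr_eq0 addrC -mderivD -hz -/(zeta a) cube_grad_diag.
have /deg_ltP : deg_lt k (mderiv a ('X_a * q a)).
  by rewrite h; apply: deg_ltN; exact: deg_lt_mderiv (hp a).
apply; rewrite mcoeff_mderiv mulrC [mnm_add _ _]addmC mcoeffMX.
by rewrite mulrn_eq0.
Qed.

Let S a m := ipoly hypercube (zeta a * mX m).
(** For |m| = k the test polynomial has degree k + 1: this is the critical case, in which the
    vanishing must be derived. *)
Let t a j m := T a j ('X_j * mX m).

(** At x_j = 0 and at x_j = 1, every positive power of x_j equals x_j. *)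
Lemma facet_trace_mclear j e m :
  trace ((j, e) : flabel hypercube n) ('X_j * mX m) =
  trace ((j, e) : flabel hypercube n) ('X_j * mX (mclear j m)).
Proof.
apply: peval_inj => y; rewrite !peval_trace !pevalM !pevalXU !pevalX.
rewrite cube_facet_map (bigD1 j)//= [in RHS](bigD1 j)//= mclearE eqxx expr0 mul1r cube_facet_map.
rewrite mulrA; congr (_ * _); last first.
  by apply: eq_bigr => i ij; rewrite mclearE (negbTE ij).
by case: e; rewrite ?mul0r// expr1n mulr1.
Qed.

(* The two monomials coincide on the facets orthogonal to the j-th axis. *)
Lemma cube_weak_mclear a j m : t a j m - t a j (mclear j m) =
  ipoly hypercube (mderiv j (zeta a) * ('X_j * mX m - 'X_j * mX (mclear j m))).
Proof.
rewrite /t !cube_weakE /B (facet_trace_mclear j true) (facet_trace_mclear j false) mulrBr ipolyB.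
have gen (u v w : R) : u - v - (w - v) = u - w by ring.
exact: gen.
Qed.

(** The difference f of the two test monomials vanishes at x_j = 0 and x_j = 1, so integrating f d_j
    zeta_a by parts produces no boundary term. *)
Lemma cube_weak_by_parts a j m : t a j m - t a j (mclear j m) =
  S a (mclear j m) - (m j).+1%:R * S a m.
Proof.
rewrite cube_weak_mclear.
set f := 'X_j * mX m - _.
have : ipoly hypercube (mderiv j (f * zeta a)) = 0.
  by rewrite mulrBl mderivB ipolyB ipoly_cube_mderiv_mclear subrr.
rewrite mderivM ipolyD addrC => /eqP; rewrite addr_eq0 [mderiv j (zeta a) * f]mulrC => /eqP ->.
rewrite mderivB !mderiv_mulX mclearE eqxx scale1r mulrBl ipolyB opprB.
by rewrite -scalerAl ipolyZ /S !(mulrC (zeta a)).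
Qed.

Lemma cube_t_eq0 a j m : (mdeg m < k)%N -> t a j m = 0.
Proof. by move=> mk; apply: weak_eq0; rewrite -mpolyXD; apply: deg_ltX; rewrite mdegD mdeg1. Qed.

Lemma cube_t_clear a j m : (0 < m j)%N -> mdeg m = k -> t a j (mclear j m) = 0.
Proof. by move=> mj mk; apply: cube_t_eq0; have := mdeg_mclear j m; lia. Qed.

(** Clearing a variable lowers the degree below k, where t vanishes; integration by parts then turns
    (m_i + 1) S([mclear j m]) and (m_j + 1) S([mclear i m]) into the same integral, with both
    variables cleared. *)
Lemma cube_t_pair a i j m : (0 < m i)%N -> (0 < m j)%N -> mdeg m = k ->
  (m i).+1%:R * t a j m = (m j).+1%:R * t a i m.
Proof.
move=> mi mj mk; have [->//|ij] := eqVneq i j.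
have tS b : (0 < m b)%N -> t a b m = S a (mclear b m) - (m b).+1%:R * S a m.
  by move=> mb; rewrite -cube_weak_by_parts cube_t_clear// subr0.
have SS b d : b != d -> (0 < m b)%N -> (0 < m d)%N ->
    (m b).+1%:R * S a (mclear d m) = S a (mclear b (mclear d m)).
  move=> bd mb md; have := cube_weak_by_parts a b (mclear d m).
  have dk : (mdeg (mclear d m) < k)%N by have := mdeg_mclear d m; lia.
  rewrite !cube_t_eq0//.
    by rewrite mclearE (negbTE bd) subrr => /eqP; rewrite eq_sym subr_eq0 => /eqP ->.
  by have := mdeg_mclear b (mclear d m); lia.
rewrite (tS i mi) (tS j mj) !mulrBr SS// (SS j i) 1?eq_sym// mclearC.
by congr (_ - _); rewrite mulrCA.
Qed.

(** The curl relation for the axis a makes the sum of all t_b vanish, and then those for the other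
    axes give t_i = 0 wherever m_i = 0. The remaining t_b are proportional to m_b + 1 > 0, hence of
    one sign, and their sum is zero. *)
Lemma cube_t_perp a j m : m a = 0%N -> mdeg m = k -> t a j m = 0.
Proof.
move=> ma mk.
have kn0 : (k + n.+1)%:R != 0 :> R by rewrite pnatr_eq0 addnS.
have sum0 : \sum_b t a b m = 0 by rewrite -(curl_eq0 a ma mk) -/(t a a m) /t cube_weak_diag mulr0.
have t0 i : m i = 0%N -> t a i m = 0.
  move=> mi; have := curl_eq0 a mi mk; rewrite -/(t a i m) => /eqP.
  by rewrite -[X in _ == X]/(\sum_b t a b m) sum0 mulf_eq0 (negbTE kn0) => /eqP.
have [mj|mj] := posnP (m j); first exact: t0.
have : (m j).+1%:R * \sum_b t a b m = (\sum_(b | (0 < m b)%N) (m b).+1%:R) * t a j m.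
  rewrite mulr_sumr mulr_suml [LHS](bigID (fun b => (0 < m b)%N))/= [X in _ + X]big1 ?addr0.
    by apply: eq_bigr => b mb; rewrite (cube_t_pair a mb mj mk).
  by move=> b; rewrite lt0n negbK => /eqP/t0 ->; rewrite mulr0.
rewrite sum0 mulr0 => /esym/eqP; rewrite mulf_eq0 => /orP[|/eqP//].
rewrite (bigD1 j)//= => /eqP h.
have : 0 < (m j).+1%:R + \sum_(b | (0 < m b)%N && (b != j)) (m b).+1%:R :> R.
  by rewrite ltr_wpDr ?ltr0n// sumr_ge0.
by rewrite h ltxx.
Qed.

(** As d_a zeta_a = 0, the monomials of D = d_j zeta_a do not contain x_a, and for such exponents
    [cube_t_perp] settles the critical degree. *)
Lemma cube_grad_eq0 a j : mderiv j (zeta a) = 0.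
Proof.
have [->|ja] := eqVneq j a; first exact: cube_grad_diag.
pose D := mderiv j (zeta a).
have Da : mderiv a D = 0 by rewrite /D mderiv_comm cube_grad_diag mderiv0.
have Dk : deg_lt k D by apply: deg_lt_mderiv; exact: cube_zeta_deg.
(* It vanishes on both facets orthogonal to the j-th axis, so only the volume term remains; the
   value on bub X^m is the difference of t at m and at m + e_j, where |m| < k. *)
pose bub : mpoly n.+1 R := 'X_j * (1 - 'X_j).
have monom m : mcoeff m D != 0 -> ipoly hypercube (D * (bub * mX m)) = 0.
  move=> Dm; have mk : (mdeg m < k)%N by have /deg_ltP := Dk; apply.
  have ma : m a = 0%N.
    apply/eqP; apply: contra_neqT Dm => ma.
    have := mcoeff_mderiv a D (mnm_sub m (mnm1 a)).
    rewrite Da mcoeff0 (_ : mnm_add _ _ = m); last first.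
      by apply/mnmP => i; rewrite mnmDE mnmBE mnm1E; case: eqVneq => [<-|]; lia.
    by move=> /esym/eqP; rewrite mulrn_eq0 /= => /eqP.
  have tr0 e : trace ((j, e) : flabel hypercube n) (bub * mX m) = 0.
    apply: peval_inj => y; rewrite peval_trace !pevalM pevalB peval1 !pevalXU.
    by rewrite cube_facet_map peval0; case: e => /=; rewrite ?subrr ?mulr0 !mul0r.
  transitivity (T a j (bub * mX m)).
    by rewrite cube_weakE /B !tr0 !mulr0 ipoly0 !mulr0 !subr0.
  rewrite (_ : bub * mX m = 'X_j * mX m - 'X_j * mX (mnm_add (mnm1 j) m)); last first.
    by rewrite mpolyXD /bub; ring.
  rewrite /T weakB -/(T _ _ _) -/(T _ _ _) -/(t a j m) cube_t_eq0// sub0r.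
  apply/eqP; rewrite oppr_eq0; apply/eqP.
  move: mk; rewrite leq_eqVlt => /predU1P[mk|mk].
    by apply: cube_t_perp; [rewrite mnmDE mnm1E (negbTE ja) ma|rewrite mdegD mdeg1].
  by apply: cube_t_eq0; rewrite mdegD mdeg1.
have : ipoly hypercube (D * (bub * D)) = 0.
  rewrite [X in bub * X](mpolyE D) !mulr_sumr ipoly_sum big_seq big1// => m.
  by rewrite mcoeff_msupp => /monom h; rewrite -!scalerAr ipolyZ h mulr0.
rewrite mulrCA => h.
have /eqP : bub * (D * D) = 0.
  apply: ipoly_eq0 h => y hy; rewrite !pevalM pevalB peval1 !pevalXU -expr2.
  have /andP[y0 y1] := hy j.
  by rewrite mulr_ge0 ?sqr_ge0// mulr_ge0// subr_ge0.
rewrite !mulf_eq0 orbb (negbTE (mpolyX1_neq0 _)) /= => /orP[/eqP h1|/eqP//].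
have := congr1 (fun p => peval p 0) h1; rewrite pevalB peval1 pevalXU peval0 mxE subr0.
by move=> /eqP; rewrite oner_eq0.
Qed.

Lemma cube_t_all a j m : m j = 0%N -> mdeg m = k -> t a j m = 0.
Proof.
move=> mj mk; have [ma|ma] := posnP (m a); first exact: cube_t_perp.
have kn0 : (k + n.+1)%:R != 0 :> R by rewrite pnatr_eq0 addnS.
(* With a zero gradient, clearing x_b does not change the value, and the cleared exponent has degree
   below k. *)
have tpos b : (0 < m b)%N -> t a b m = 0.
  move=> mb; have /eqP := cube_weak_mclear a b m.
  by rewrite cube_t_clear// subr0 cube_grad_eq0 mul0r ipoly0 => /eqP.
pose s := \sum_b t a b m.
have tz b : m b = 0%N -> t a b m = s / (k + n.+1)%:R.
  by move=> mb; rewrite /s -(curl_eq0 a mb mk) mulrC mulKf.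
(* With d = [n.+1], s is s / (k + d) times the number of zero exponents of m. That number is at most
   d, hence less than k + d, since m_a > 0 forces k > 0. *)
have : s * (k + n.+1 - #|[pred b | m b == 0%N]|)%:R = 0.
  rewrite natrB; last by rewrite (leq_trans (max_card _))// card_ord leq_addl.
  rewrite mulrBr; apply/eqP; rewrite subr_eq0; apply/eqP.
  transitivity (\sum_b (if m b == 0%N then s else 0)).
    rewrite {1}/s mulr_suml; apply: eq_bigr => b _; case: eqP => [mb|/eqP].
      by rewrite tz// divfK.
    by rewrite -lt0n => /tpos ->; rewrite mul0r.
  by rewrite -big_mkcond /= sumr_const mulr_natr.
move/eqP; rewrite mulf_eq0 => /orP[/eqP s0|]; first by rewrite tz// s0 mul0r.
rewrite pnatr_eq0 subn_eq0 => h.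
have : (#|[pred b | m b == 0%N]| <= n.+1)%N by rewrite (leq_trans (max_card _))// card_ord.
have : (0 < k)%N by rewrite -mk (mdeg_mclear a) addn_gt0 ma.
by lia.
Qed.

(** The factor x_j removes the facet x_j = 0 and is 1 on x_j = 1, so the vanishing of t gives that
    of the moments on x_j = 1; tests of degree k then give it on x_j = 0. *)
Lemma cube_delta_eq0 l a : delta l a = 0.
Proof.
case: l => j; have [->|ja] := eqVneq j a; first exact: cube_delta_diag.
have TB w : T a j w = c (j, false) * B (j, false) a w - c (j, true) * B (j, true) a w.
  by rewrite cube_weakE cube_grad_eq0 mul0r ipoly0 sub0r opprB.
have tr0 w : trace ((j, false) : flabel hypercube n) ('X_j * w) = 0.
  by apply: peval_inj => y; rewrite peval_trace pevalM pevalXU cube_facet_map mul0r peval0.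
have tr1 w : trace ((j, true) : flabel hypercube n) ('X_j * w) = trace ((j, true) : flabel hypercube n) w.
  by apply: peval_inj => y; rewrite !peval_trace pevalM pevalXU cube_facet_map mul1r.
have B1 m : T a j ('X_j * mX m) = 0 -> B (j, true) a ('X_j * mX m) = 0.
  rewrite TB {1}/B tr0 mulr0 ipoly0 mulr0 sub0r => /eqP.
  by rewrite oppr_eq0 mulf_eq0 (negbTE (c0 _)) => /eqP.
have Btrue m : (mdeg m <= k)%N -> B (j, true) a (mX m) = 0.
  move=> mk; have [mj|mj] := posnP (m j).
    rewrite /B -tr1; apply: B1; rewrite -/(t a j m).
    move: mk; rewrite leq_eqVlt => /predU1P[mk|mk]; first exact: cube_t_all.
    exact: cube_t_eq0.
  have E : mX m = 'X_j * mX (mnm_sub m (mnm1 j)) :> mpoly n.+1 R.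
    rewrite -mpolyXD; congr mpolyX; apply/mnmP => i; rewrite mnmDE mnmBE mnm1E.
    by case: eqVneq => [<-|]; lia.
  by rewrite E; apply: B1; rewrite -E; apply: weak_eq0; exact: deg_ltX.
have Bfalse m : (mdeg m <= k)%N -> B (j, false) a (mX m) = 0.
  move=> mk; have : T a j (mX m) = 0 by apply: weak_eq0; exact: deg_ltX.
  rewrite TB Btrue// mulr0 subr0 => /eqP.
  by rewrite mulf_eq0 (negbTE (c0 _)) => /eqP.
move=> e; apply: (delta_eq0 hx cube_zeta_deg); apply: deg_lt_ind.
- by rewrite /trace acomp0 mulr0 ipoly0.
- by move=> p q h h'; rewrite /trace acompD mulrDr ipolyD [X in X + _]h add0r.
- by move=> r p h; rewrite /trace acompZ -scalerAr ipolyZ [X in _ * X]h mulr0.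
- by move=> m mk; case: e; [exact: Btrue|exact: Bfalse].
Qed.

End kernel_cube.

(** * The enriching curls on the hypercube *)

Section curl_fields.
Context {R : realType}.
Local Notation "''X_' i" := (mpolyX R (mnm1 i)).
Local Notation mX m := (mpolyX R m).

(* The curls which enrich the polynomials of degree k. *)
Definition curl_field k n (a : 'I_n.+1) (m : multinom n.+1) (b : 'I_n.+1) : mpoly n.+1 R :=
  (k + n.+1)%:R *: (if b == a then 'X_a * mX m else 0) - 'X_b * mX m.

Lemma mderiv_mulX2 n (i j : 'I_n) (m : multinom n) : i != j ->
  mderiv j ('X_i * ('X_j * mX m)) = (m j).+1%:R *: ('X_i * mX m).
Proof.
by move=> ij; rewrite mulrCA -!mpolyXD mpolyXD mderiv_mulX mnmDE mnm1E (negbTE ij).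
Qed.

Lemma ord2P (i : 'I_2) : i = 0 \/ i = 1.
Proof. by case: i => -[|[|//]] h; [left|right]; apply/val_inj. Qed.

Lemma ord3P (i : 'I_3) : [\/ i = 0, i = 1 | i = 2].
Proof. by case: i => -[|[|[|//]]] h; [apply: Or31|apply: Or32|apply: Or33]; apply/val_inj. Qed.

(** For a = 0 one has X^m = y^k and curl (x y^(k+1)) = ((k + 1) x y^k, - y^(k+1)), where k + 1 = (k
    + 2) - 1. For a = 1 the orientation is opposite, whence the coefficient -1. *)
Lemma ref_Grow_curl_field2 k (a : 'I_2) (m : multinom 2) : m a = 0%N -> mdeg m = k ->
  ref_Grow hypercube k (@curl_field k 1 a m).
Proof.
move=> ma mk; exists (fun=> 0), (@curl_field k 1 a m); split; [by move=> i; rewrite /poly_le mmeasure0| |by move=> i; rewrite add0r].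
have mE : mX m = 'X_(0 : 'I_2) ^+ m 0 * 'X_(1 : 'I_2) ^+ m 1.
  rewrite mpolyXE_id !big_ord_recl big_ord0 mulr1; congr (_ * 'X__ ^+ m _); exact/val_inj.
have dE : (m 0%R + m 1%R = k)%N.
  rewrite -mk mdegE !big_ord_recl big_ord0 addn0; congr (_ + m _)%N; exact/val_inj.
have gen (P : mpoly 2 R) : (k + 2)%:R *: P - P = k.+1%:R *: P.
  by rewrite -{2}(scale1r P) -scalerBl addn2 -natr1 addrK.
case: (ord2P a) ma => -> ma; rewrite ma ?add0n ?addn0 in dE.
- have E : 'X_(1 : 'I_2) ^+ k.+1 = 'X_(1 : 'I_2) * mX m by rewrite mE ma expr0 mul1r exprS dE.
  exists 1, 0 => i; rewrite E scale1r scale0r addr0 /curl_field /curl2 (tnth_nth 0).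
  case: (ord2P i) => ->/=.
    by rewrite mderiv_mulX2// dE gen.
  by rewrite mulrCA mderiv_mulX2// ma scale1r scaler0 sub0r.
- have E : 'X_(0 : 'I_2) ^+ k.+1 = 'X_(0 : 'I_2) * mX m by rewrite mE ma expr0 mulr1 exprS dE.
  exists 0, (- 1) => i; rewrite E scale0r add0r scaleN1r /curl_field /curl2 (tnth_nth 0).
  case: (ord2P i) => ->/=.
    by rewrite mulrCA mderiv_mulX2// ma scale1r scaler0 sub0r.
  by rewrite mderiv_mulX2// dE gen opprK.
Qed.

(** For a = 0 and q = X^m free of x, curl (x q (0, -z, y)) = ((k + 2) x q, - y q, - z q), where k +
    2 = (m_1 + 1) + (m_2 + 1) = (k + 3) - 1. The other axes are cyclic. *)
Lemma ref_Grow_curl_field3 k (a : 'I_3) (m : multinom 3) : m a = 0%N -> mdeg m = k ->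
  ref_Grow hypercube k (@curl_field k 2 a m).
Proof.
move=> ma mk; exists (fun=> 0), (@curl_field k 2 a m); split; [by move=> i; rewrite /poly_le mmeasure0| |by move=> i; rewrite add0r].
have mE : mX m = 'X_(0 : 'I_3) ^+ m 0 * 'X_(1 : 'I_3) ^+ m 1 * 'X_(2 : 'I_3) ^+ m 2.
  rewrite mpolyXE_id !big_ord_recl big_ord0 mulr1 mulrA.
  congr (_ * 'X__ ^+ m _ * 'X__ ^+ m _); exact/val_inj.
have dE : (m 0%R + m 1%R + m 2%R = k)%N.
  rewrite -mk mdegE !big_ord_recl big_ord0 addn0 addnA; congr (_ + m _ + m _)%N; exact/val_inj.
have gen (u v : nat) (P : mpoly 3 R) : (u + v = k)%N -> (k + 3)%:R *: P - P = u.+1%:R *: P + v.+1%:R *: P.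
  move=> <-; rewrite -{2}(scale1r P) -scalerBl -scalerDl; congr (_ *: _).
  by rewrite -natrD addn3 -natr1 addrK addSn addnS.
have compE (u v : 'I_3) (e f : nat) : comp_mpoly [tuple 'X_u; 'X_v] (mX (Multinom [tuple e; f])) =
    'X_u ^+ e * 'X_v ^+ f :> mpoly 3 R.
  by rewrite comp_mpolyX !big_ord_recl big_ord0 mulr1 !multinomE !(tnth_nth 0).
have homogE (e f : nat) : (e + f = k)%N -> poly_homog k (mX (Multinom [tuple e; f])).
  move=> <-; apply/homogP => m'; rewrite mcoeffX; case: (eqVneq (Multinom _) m') => [<- _|_ /eqP[]//].
  by rewrite mdegE !big_ord_recl big_ord0 addn0 !multinomE !(tnth_nth 0%N).
have homog0 : poly_homog k (0 : mpoly 2 R) by apply/homogP => m'; rewrite mcoeff0 eqxx.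
have curl30 (F : 'I_3 -> mpoly 3 R) i : F =1 (fun=> 0) -> curl3 F i = 0.
  by move=> F0; rewrite /curl3 !F0 (tnth_nth 0); case: (ord3P i) => ->/=; rewrite !mderiv0 subrr.
have comp0 (lq : 2.-tuple (mpoly 3 R)) : comp_mpoly lq 0 = 0 by exact: comp_mpoly0.
have wN (u v : 'I_3) : 'X_u * mX m * - 'X_v = - ('X_u * ('X_v * mX m)) :> mpoly 3 R.
  by rewrite mulrN -mulrA [mX m * _]mulrC.
have wP (u v : 'I_3) : 'X_u * mX m * 'X_v = 'X_u * ('X_v * mX m) :> mpoly 3 R.
  by rewrite -mulrA [mX m * _]mulrC.
have dself (u v : 'I_3) : v != u -> m u = 0%N -> mderiv u ('X_u * ('X_v * mX m)) = 'X_v * mX m :> mpoly 3 R.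
  by move=> uv mu; rewrite mulrCA mderiv_mulX2// mu scale1r.
case: (ord3P a) ma => -> ma; rewrite ma ?add0n ?addn0 in dE.
- exists (mX (Multinom [tuple m 1; m 2])), 0, 0; split=> [||//|i].
  + exact: homogE.
  + exact: homog0.
  rewrite [X in _ + X + _]curl30 ?[X in _ + X]curl30 ?addr0; try by move=> j; rewrite comp0 mulr0 mul0r.
  rewrite compE (_ : 'X_1 ^+ m 1 * 'X_2 ^+ m 2 = mX m); last by rewrite mE ma expr0 mul1r.
  rewrite /curl3 /curl_field !(tnth_nth 0) /= mulr0 mderiv0 wN wP !mderivN.
  case: (ord3P i) => ->/=.
  + by rewrite opprK !mderiv_mulX2// (gen _ _ _ dE).
  + by rewrite dself// ?mderiv0 scaler0 ?subr0 ?sub0r.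
  + by rewrite dself// ?mderiv0 scaler0 ?subr0 ?sub0r.
- exists 0, (mX (Multinom [tuple m 2; m 0])), 0; split=> [|||i].
  + exact: homog0.
  + by apply: homogE; rewrite addnC.
  + exact: homog0.
  rewrite [X in X + _ + _]curl30 ?[X in _ + X]curl30 ?addr0 ?add0r; try by move=> j; rewrite comp0 mulr0 mul0r.
  rewrite compE (_ : 'X_2 ^+ m 2 * 'X_0 ^+ m 0 = mX m); last by rewrite mE ma expr0 mulr1 mulrC.
  rewrite /curl3 /curl_field !(tnth_nth 0) /= mulr0 mderiv0 wN wP !mderivN.
  case: (ord3P i) => ->/=.
  + by rewrite dself// ?mderiv0 scaler0 ?subr0 ?sub0r.
  + by rewrite opprK !mderiv_mulX2// [RHS]addrC (gen _ _ _ dE).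
  + by rewrite dself// ?mderiv0 scaler0 ?subr0 ?sub0r.
- exists 0, 0, (mX (Multinom [tuple m 0; m 1])); split=> [|||i].
  + exact: homog0.
  + exact: homog0.
  + exact: homogE.
  rewrite [X in X + _ + _]curl30 ?[X in _ + X + _]curl30 ?addr0 ?add0r; try by move=> j; rewrite comp0 mulr0 mul0r.
  rewrite compE (_ : 'X_0 ^+ m 0 * 'X_1 ^+ m 1 = mX m); last by rewrite mE ma expr0 mulr1.
  rewrite /curl3 /curl_field !(tnth_nth 0) /= mulr0 mderiv0 wN wP !mderivN.
  case: (ord3P i) => ->/=.
  + by rewrite dself// ?mderiv0 scaler0 ?subr0 ?sub0r.
  + by rewrite dself// ?mderiv0 scaler0 ?subr0 ?sub0r.
  + by rewrite opprK !mderiv_mulX2// (gen _ _ _ dE).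
Qed.

End curl_fields.

(** * The estimate on the reference element *)

Section reference_estimate.
Context {R : realType}.
Variables (s : cell_shape) (n k : nat) (c : flabel s n -> R).
Hypothesis n12 : n = 1%N \/ n = 2%N.
Hypothesis c0 : forall l, c l != 0.
Local Notation pair := (refpair (R := R) s n).
Local Notation field := ('I_n.+1 -> mpoly n.+1 R).

Definition ref_form (x : pair) a (v : field) : R := \sum_b weak c x.1 x.2 a b (v b).

Definition ref_sqnorm (x : pair) : R :=
  \sum_a \sum_b ipoly s (mderiv b (x.1 a) * mderiv b (x.1 a)) +
  \sum_l \sum_a ipoly s (x.2 l a * x.2 l a).

Definition pair_comb (x : pair) r (y : pair) : pair :=
  (fun a => x.1 a - r *: y.1 a, fun l a => x.2 l a - r *: y.2 l a).

Lemma weak_comb x r y a b w :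
  weak c (pair_comb x r y).1 (pair_comb x r y).2 a b w =
  weak c x.1 x.2 a b w - r * weak c y.1 y.2 a b w.
Proof.
rewrite /weak /= mderivB mderivZ mulrBl ipolyB -scalerAl ipolyZ.
set S := \sum_l c l * _ * ipoly s ((_ - _) * _).
set S1 := \sum_l c l * _ * ipoly s (x.2 _ _ * _).
set S2 := \sum_l c l * _ * ipoly s (y.2 _ _ * _).
have -> : S = S1 - r * S2; last by ring.
rewrite mulr_sumr -sumrB; apply: eq_bigr => l _.
by rewrite mulrBl ipolyB -[r *: _ * _]scalerAl ipolyZ; ring.
Qed.

Lemma ref_form_comb x r y a v :
  ref_form (pair_comb x r y) a v = ref_form x a v - r * ref_form y a v.
Proof. by rewrite /ref_form mulr_sumr -sumrB; apply: eq_bigr => b _; rewrite weak_comb. Qed.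

(** The right-hand side minus the left-hand side is the integral of (p - 2 r q)^2. *)
Lemma ipoly_sqr_comb m (p q : mpoly m R) r : ipoly s (p * p) <=
  2 * ipoly s ((p - r *: q) * (p - r *: q)) + 2 * r ^+ 2 * ipoly s (q * q).
Proof.
rewrite -subr_ge0 -!ipolyZ -ipolyD -ipolyB.
have := @ipoly_sqr_ge0 R s m (p - (2 * r) *: q); congr (_ <= ipoly s _).
by apply: peval_inj => y; rewrite !(pevalB, pevalD, pevalM, pevalZ); ring.
Qed.

Lemma ref_sqnorm_comb x r y :
  ref_sqnorm x <= 2 * ref_sqnorm (pair_comb x r y) + 2 * r ^+ 2 * ref_sqnorm y.
Proof.
rewrite /ref_sqnorm !mulrDr addrACA; apply: lerD.
  rewrite !mulr_sumr -big_split; apply: ler_sum => a _.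
  rewrite !mulr_sumr -big_split; apply: ler_sum => b _ /=.
  by rewrite mderivB mderivZ; exact: ipoly_sqr_comb.
rewrite !mulr_sumr -big_split; apply: ler_sum => l _.
by rewrite !mulr_sumr -big_split; apply: ler_sum => a _; exact: ipoly_sqr_comb.
Qed.

Lemma ref_sqnorm_ge0 x : 0 <= ref_sqnorm x.
Proof.
by apply: addr_ge0; apply: sumr_ge0 => ? _; apply: sumr_ge0 => ? _; exact: ipoly_sqr_ge0.
Qed.

Lemma homog_comb m (p q : mpoly m R) r :
  poly_homog k p -> poly_homog k q -> poly_homog k (p - r *: q).
Proof. by move=> hp hq; apply: rpredB => //; apply: rpredZ. Qed.

Lemma ref_V_comb (v w : field) r : ref_V s k v -> ref_V s k w ->
  ref_V s k (fun i => v i - r *: w i).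
Proof.
have deg_comb (p q : mpoly n.+1 R) : poly_le k p -> poly_le k q -> poly_le k (p - r *: q).
  by move=> hp hq; apply: deg_ltB => //; exact: deg_ltZ.
case: s => [[p [q [hp hq hv]]] [p' [q' [hp' hq' hw]]]|[p [q [hp hq hv]]] [p' [q' [hp' hq' hw]]]].
- exists (fun i => p i - r *: p' i), (q - r *: q'); split=> [i||i].
  + exact: deg_comb.
  + exact: homog_comb.
  + by rewrite hv hw; apply: peval_inj => y; rewrite !(pevalB, pevalD, pevalM, pevalZ); ring.
- exists (fun i => p i - r *: p' i), (fun i => q i - r *: q' i); split=> [i|i|i].
  + exact: deg_comb.
  + exact: homog_comb.
  + by rewrite hv hw; apply: peval_inj => y; rewrite !(pevalB, pevalD, pevalM, pevalZ); ring.
Qed.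

Lemma admissible_comb x r y : admissible k x -> admissible k y -> admissible k (pair_comb x r y).
Proof.
move=> [xV xt xd] [yV yt yd]; split=> [|l|l a]; first exact: ref_V_comb.
- rewrite /=; under eq_bigr do rewrite scalerBr scalerA mulrC -scalerA.
  by rewrite sumrB xt -scaler_sumr yt scaler0 subrr.
- have [e he xe] := xd l a; have [e' he' ye] := yd l a.
  exists (e - r *: e'); first by apply: deg_ltB => //; exact: deg_ltZ.
  by rewrite /= xe ye /trace acompB acompZ scalerBr; ring.
Qed.

Lemma curl_space0 : curl_space k (fun=> 0 : mpoly n.+1 R).
Proof.
case: n12 => ->.
- have h (u v : mpoly 2 R) : 0 = 0 *: u + 0 *: v by rewrite !scale0r addr0.
  by exists 0, 0 => i; apply: h.
- have h0 : poly_homog k (0 : mpoly 2 R) by apply/homogP => m; rewrite mcoeff0 eqxx.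
  exists 0, 0, 0; split=> // i; rewrite /curl3 !comp_mpoly0 !(tnth_nth 0).
  by case: (ord3P i) => ->/=; rewrite !mulr0 !mul0r !mderiv0 !subrr !addr0.
Qed.

Lemma ref_Grow_poly (v : field) : (forall i, poly_le k (v i)) -> ref_Grow s k v.
Proof.
move=> hv; case: s => //=; exists v, (fun=> 0); split=> // [|i]; last by rewrite addr0.
exact: curl_space0.
Qed.

Lemma ref_Grow_curl (a : 'I_n.+1) (m : multinom n.+1) : m a = 0%N -> mdeg m = k ->
  ref_Grow hypercube k (@curl_field R k n a m).
Proof.
case: n12 => e; move: a m; rewrite e => a m.
- exact: ref_Grow_curl_field2.
- exact: ref_Grow_curl_field3.
Qed.

Local Notation index := ('I_n.+1 * bmultinom n.+1 k.+1)%type.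

Let is_cube := if s is hypercube then true else false.

(** The finitely many tests that the kernel computations use: monomial fields of degree at most k
    and, on the hypercube, the curls. Indices to which no curl belongs yield the zero field. *)
Definition test_field (j : index + index) : field :=
  match j with
  | inl (b, m) => fun b' => if b' == b then mpolyX R m else 0
  | inr (a, m) => if [&& is_cube, bmnm m a == 0%N & mdeg m == k]
                  then @curl_field R k n a m else fun=> 0
  end.

Lemma ref_Grow_test_field j : ref_Grow s k (test_field j).
Proof.
have le0 : poly_le k (0 : mpoly n.+1 R) by rewrite /poly_le mmeasure0.
case: j => -[a m]; rewrite /test_field.
  apply: ref_Grow_poly => i; case: eqP => // _.
  by apply: deg_ltX; exact: bmdeg.
case: ifP => [/and3P[]|_]; last exact: ref_Grow_poly.
rewrite /is_cube; case: (s) => // _ /eqP ma /eqP mk; exact: ref_Grow_curl.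
Qed.

Lemma reference_kernel x : admissible k x ->
  (forall a j, ref_form x a (test_field j) = 0) -> ref_sqnorm x = 0.
Proof.
move=> hx form0.
have weak_eq0 a b w : deg_lt k.+1 w -> weak c x.1 x.2 a b w = 0.
  move: w; apply: deg_lt_ind.
  - exact: weak0.
  - by move=> p q hp hq; rewrite weakD hp hq addr0.
  - by move=> r p hp; rewrite weakZ hp mulr0.
  move=> m mk; have := form0 a (inl (b, BMultinom mk)).
  rewrite /ref_form (bigD1 b)//= eqxx big1 ?addr0// => b' bb'.
  by rewrite (negbTE bb') weak0.
have curl_eq0 : is_cube -> forall a a' (m : multinom n.+1), m a' = 0%N -> mdeg m = k ->
    (k + n.+1)%:R * weak c x.1 x.2 a a' (mpolyX R (mnm1 a') * mpolyX R m) =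
    \sum_b weak c x.1 x.2 a b (mpolyX R (mnm1 b) * mpolyX R m).
  move=> ic a a' m ma mk.
  have mk1 : (mdeg m < k.+1)%N by rewrite mk.
  have := form0 a (inr (a', BMultinom mk1)).
  rewrite /ref_form /test_field ic /= ma mk !eqxx /=.
  under eq_bigr do rewrite weakB weakZ.
  rewrite sumrB (bigD1 a')//= eqxx big1 ?addr0.
    by move=> /eqP; rewrite subr_eq0 => /eqP.
  by move=> b ba; rewrite (negbTE ba) weak0 mulr0.
suff [g0 d0] : (forall a b, mderiv b (x.1 a) = 0) /\ (forall l a, x.2 l a = 0).
  rewrite /ref_sqnorm big1 ?add0r => [|a _]; last first.
    by rewrite big1// => b _; rewrite g0 mul0r ipoly0.
  by rewrite big1// => l _; rewrite big1// => a _; rewrite d0 mul0r ipoly0.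
move: curl_eq0 weak_eq0; clear form0; move: hx c0; rewrite /is_cube.
case: s c x => c' x' hx c0' curl_eq0 weak_eq0.
  split=> [a b|l a]; first exact: (simplex_grad_eq0 hx weak_eq0).
  exact: (simplex_delta_eq0 hx c0' weak_eq0).
split=> [a b|l a]; first exact: (cube_grad_eq0 hx weak_eq0 (curl_eq0 isT)).
exact: (cube_delta_eq0 hx c0' weak_eq0 (curl_eq0 isT)).
Qed.

Theorem reference_estimate : exists2 C, 0 <= C & forall x e, 0 <= e -> admissible k x ->
  (forall a v, ref_Grow s k v ->
     ref_form x a v ^+ 2 <= e * \sum_b ipoly s (v b * v b)) ->
  ref_sqnorm x <= C * e.
Proof.
have [|x r y|x hx form0|C C0 hC] := @quadratic_bound R pair pair_comb ref_sqnorm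
  ref_sqnorm_ge0 ref_sqnorm_comb ('I_n.+1 * (index + index))%type
  (fun j x => ref_form x j.1 (test_field j.2)) (@admissible R s n k).
- by move=> j x r y; exact: ref_form_comb.
- exact: admissible_comb.
- by apply: reference_kernel => // a j; exact: (form0 (a, j)).
(* M bounds the squared norm of every test field, so each value of the form is at most sqrt (M e) in
   modulus. *)
pose M := \sum_(j : index + index) \sum_b ipoly s (test_field j b * test_field j b).
have M0 j : 0 <= \sum_b ipoly s (test_field j b * test_field j b).
  by apply: sumr_ge0 => b _; exact: ipoly_sqr_ge0.
have MM : 0 <= M by apply: sumr_ge0.
exists (C * M); first exact: mulr_ge0.
move=> x e e0 hx hform.
rewrite -mulrA [M * e]mulrC -[e * M]sqr_sqrtr ?mulr_ge0//.
apply: hC => // -[a j] /=.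
rewrite -sqrtr_sqr ler_wsqrtr//; apply: (le_trans (hform a _ (ref_Grow_test_field j))).
by rewrite ler_wpM2l// /M (bigD1 j)//= lerDl sumr_ge0.
Qed.

End reference_estimate.

(** * The Frobenius product and the geometry of reference facets *)

Section dot_product.
Context {R : realType}.

Lemma dotE m n (A B : 'M[R]_(m, n)) : dot A B = \tr (A^T *m B).
Proof.
rewrite /mxtrace /dot exchange_big; apply: eq_bigr => j _.
by rewrite mxE; apply: eq_bigr => i _; rewrite mxE.
Qed.

Lemma dot_colE n (u v : 'cV[R]_n) : dot u v = \sum_i u i 0 * v i 0.
Proof. by apply: eq_bigr => i _; rewrite big_ord1. Qed.

Lemma dotC m n (A B : 'M[R]_(m, n)) : dot A B = dot B A.
Proof. by apply: eq_bigr => i _; apply: eq_bigr => j _; rewrite mulrC. Qed.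

Lemma dotDl m n (A B C : 'M[R]_(m, n)) : dot (A + B) C = dot A C + dot B C.
Proof. by rewrite !dotE linearD /= mulmxDl mxtraceD. Qed.

Lemma dotZl m n r (A B : 'M[R]_(m, n)) : dot (r *: A) B = r * dot A B.
Proof. by rewrite !dotE linearZ /= -scalemxAl mxtraceZ. Qed.

Lemma dotNl m n (A B : 'M[R]_(m, n)) : dot (- A) B = - dot A B.
Proof. by rewrite -scaleN1r dotZl mulN1r. Qed.

Lemma dotBl m n (A B C : 'M[R]_(m, n)) : dot (A - B) C = dot A C - dot B C.
Proof. by rewrite dotDl dotNl. Qed.

Lemma dotDr m n (A B C : 'M[R]_(m, n)) : dot A (B + C) = dot A B + dot A C.
Proof. by rewrite !(dotC A) dotDl. Qed.

Lemma dotZr m n r (A B : 'M[R]_(m, n)) : dot A (r *: B) = r * dot A B.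
Proof. by rewrite !(dotC A) dotZl. Qed.

Lemma dotNr m n (A B : 'M[R]_(m, n)) : dot A (- B) = - dot A B.
Proof. by rewrite !(dotC A) dotNl. Qed.

Lemma dotBr m n (A B C : 'M[R]_(m, n)) : dot A (B - C) = dot A B - dot A C.
Proof. by rewrite !(dotC A) dotBl. Qed.

Lemma dot0l m n (A : 'M[R]_(m, n)) : dot 0 A = 0.
Proof. by rewrite -(scale0r 0) dotZl mul0r. Qed.

Lemma dot0r m n (A : 'M[R]_(m, n)) : dot A 0 = 0.
Proof. by rewrite dotC dot0l. Qed.

Lemma dot_mull m n p (M : 'M[R]_(m, p)) (A : 'M[R]_(p, n)) (B : 'M[R]_(m, n)) :
  dot (M *m A) B = dot A (M^T *m B).
Proof. by rewrite !dotE trmx_mul mulmxA. Qed.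

Lemma dot_mulr m n p (A : 'M[R]_(m, p)) (M : 'M[R]_(p, n)) (B : 'M[R]_(m, n)) :
  dot (A *m M) B = dot A (B *m M^T).
Proof. by rewrite !dotE trmx_mul -mulmxA mxtrace_mulC -mulmxA. Qed.

Lemma dot_ge0 m n (A : 'M[R]_(m, n)) : 0 <= dot A A.
Proof. by apply: sumr_ge0 => i _; apply: sumr_ge0 => j _; rewrite -expr2 sqr_ge0. Qed.

Lemma dot_eq0 m n (A : 'M[R]_(m, n)) : dot A A = 0 -> A = 0.
Proof.
move/eqP; rewrite psumr_eq0; last first.
  by move=> i _; apply: sumr_ge0 => j _; rewrite -expr2 sqr_ge0.
move=> /allP h; apply/matrixP => i j; rewrite mxE.
have := h i (mem_index_enum _); rewrite /= psumr_eq0; last first.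
  by move=> j' _; rewrite -expr2 sqr_ge0.
by move=> /allP /(_ j (mem_index_enum _)) /=; rewrite -expr2 sqrf_eq0 => /eqP.
Qed.

Lemma enorm_sqr m n (A : 'M[R]_(m, n)) : enorm A ^+ 2 = dot A A.
Proof. by rewrite sqr_sqrtr// dot_ge0. Qed.

Lemma enorm_ge0 m n (A : 'M[R]_(m, n)) : 0 <= enorm A.
Proof. exact: sqrtr_ge0. Qed.

Lemma enorm_eq0 m n (A : 'M[R]_(m, n)) : enorm A = 0 -> A = 0.
Proof. by move=> h; apply: dot_eq0; rewrite -enorm_sqr h expr0n. Qed.

Lemma dot_cauchy_schwarz m n (A B : 'M[R]_(m, n)) : dot A B ^+ 2 <= dot A A * dot B B.
Proof.
apply: discriminant_le0 => r t.
have := dot_ge0 (r *: A + t *: B); congr (_ <= _).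
by rewrite !(dotDl, dotDr, dotZl, dotZr) (dotC B A); ring.
Qed.

(** Cauchy-Schwarz for each entry of the product, a row of A against a column of B. *)
Lemma enorm_sqr_mul m n p (A : 'M[R]_(m, p)) (B : 'M[R]_(p, n)) :
  dot (A *m B) (A *m B) <= dot A A * dot B B.
Proof.
rewrite [dot (A *m B) _]/dot [dot A A]/dot mulr_suml; apply: ler_sum => i _.
have -> : dot B B = \sum_j dot (col j B) (col j B).
  rewrite /dot exchange_big; apply: eq_bigr => j _; apply: eq_bigr => a _.
  by rewrite big_ord1 !mxE.
rewrite mulr_sumr; apply: ler_sum => j _.
have := dot_cauchy_schwarz ((row i A)^T) (col j B).
rewrite -expr2 !dot_colE.
have -> : \sum_a (row i A)^T a 0 * col j B a 0 = (A *m B) i j.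
  by rewrite mxE; apply: eq_bigr => a _; rewrite !mxE.
by under [X in _ <= X * _]eq_bigr do rewrite !mxE.
Qed.

Lemma enorm_mul m n p (A : 'M[R]_(m, p)) (B : 'M[R]_(p, n)) :
  enorm (A *m B) <= enorm A * enorm B.
Proof. by rewrite /enorm -sqrtrM ?dot_ge0// ler_wsqrtr// enorm_sqr_mul. Qed.

Lemma enormZ m n r (A : 'M[R]_(m, n)) : enorm (r *: A) = `|r| * enorm A.
Proof.
by rewrite /enorm dotZl dotZr mulrA -expr2 sqrtrM ?sqr_ge0// sqrtr_sqr.
Qed.

Lemma enorm_trmx m n (A : 'M[R]_(m, n)) : enorm A^T = enorm A.
Proof.
congr Num.sqrt; rewrite /dot exchange_big; apply: eq_bigr => i _.
by apply: eq_bigr => j _; rewrite mxE.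
Qed.

Lemma enorm_ge_coef m n (A : 'M[R]_(m, n)) i j : `|A i j| <= enorm A.
Proof.
rewrite -sqrtr_sqr ler_wsqrtr// /dot (bigD1 i)//= (bigD1 j)//= expr2 -addrA lerDl.
by rewrite addr_ge0// sumr_ge0// => ? _; rewrite ?sumr_ge0// -?expr2 ?sqr_ge0// => ? _; rewrite -expr2 sqr_ge0.
Qed.

Lemma enorm_le_coef m n (A : 'M[R]_(m, n)) (M : R) : 0 <= M ->
  (forall i j, `|A i j| <= M) -> enorm A <= (m * n)%:R * M.
Proof.
move=> M0 h.
have : dot A A <= (m * n)%:R * M ^+ 2.
  apply: (@le_trans _ _ (\sum_(i < m) \sum_(j < n) M ^+ 2)).
    apply: ler_sum => i _; apply: ler_sum => j _.
    by rewrite -expr2 -(real_normK (num_real _)) lerXn2r// nnegrE.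
  by rewrite !sumr_const !card_ord -mulrnA -[leLHS]mulr_natl mulnC.
move=> h1; rewrite -[leRHS]ger0_norm ?mulr_ge0// -sqrtr_sqr ler_wsqrtr//.
apply: (le_trans h1); rewrite exprMn ler_wpM2r ?exprn_ge0// -natrX ler_nat.
by case: (m * n)%N => // e; rewrite -mulnn leq_pmulr.
Qed.

End dot_product.

Section reference_facet_geometry.
Context {R : realType}.

(** The maximum of nu_l . x over the reference cell, attained on the facet l. *)
Definition facet_height s n : flabel s n -> R :=
  match s with
  | simplex => fun l => if l is Some _ then 0 else 1
  | hypercube => fun l => if l.2 then 1 else 0
  end.

Lemma dot_facet_normal_simplex n i (x : 'cV[R]_n.+1) :
  dot (facet_normal (Some i : flabel simplex n)) x = - x i 0.
Proof.
rewrite dotNl dot_colE (bigD1 i)//= big1 ?addr0; first by rewrite !mxE !eqxx mul1r.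
by move=> j ji; rewrite !mxE (negbTE ji) mul0r.
Qed.

Lemma dot_facet_normal_simplex_sum n (x : 'cV[R]_n.+1) :
  dot (facet_normal (None : flabel simplex n)) x = \sum_i x i 0.
Proof. by rewrite dot_colE; apply: eq_bigr => j _; rewrite mxE mul1r. Qed.

Lemma dot_facet_normal_cube n i b (x : 'cV[R]_n.+1) :
  dot (facet_normal ((i, b) : flabel hypercube n)) x = (if b then 1 else -1) * x i 0.
Proof.
rewrite dotZl dot_colE (bigD1 i)//= big1 ?addr0; first by rewrite !mxE !eqxx mul1r.
by move=> j ji; rewrite !mxE (negbTE ji) mul0r.
Qed.

Lemma dot_normal_facet_map s n (l : flabel s n) y :
  dot (facet_normal l) (facet_map l y : 'cV[R]_n.+1) = facet_height l.
Proof.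
case: s l => [[i|]|[i b]].
- by rewrite dot_facet_normal_simplex simplex_facet_map0 oppr0.
- by rewrite dot_facet_normal_simplex_sum simplex_facet_map_sum.
- rewrite dot_facet_normal_cube cube_facet_map /=; case: b; first by rewrite mul1r.
  by rewrite mulr0.
Qed.

Lemma dot_normal_le s n (l : flabel s n) (x : 'cV[R]_n.+1) : ref_cell s n.+1 x ->
  dot (facet_normal l) x <= facet_height l.
Proof.
case: s l => [[i|]|[i b]].
- by move=> [x0 _]; rewrite dot_facet_normal_simplex oppr_le0.
- by move=> [_ x1]; rewrite dot_facet_normal_simplex_sum.
- move=> /(_ i) /andP[x0 x1]; rewrite dot_facet_normal_cube /=.
  by case: b; rewrite ?mul1r// mulN1r oppr_le0.
Qed.

Lemma ref_cell0 s n : ref_cell s n (0 : 'cV[R]_n).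
Proof.
case: s => /= [|i]; last by rewrite mxE lexx ler01.
by split=> [i|]; rewrite ?mxE// big1 ?ler01// => i _; rewrite mxE.
Qed.

Lemma ref_cell_delta s n j : ref_cell s n (delta_mx j 0 : 'cV[R]_n).
Proof.
have h i : 0 <= (delta_mx j 0 : 'cV[R]_n) i 0 <= 1.
  by rewrite mxE andbT; case: eqP; rewrite ?lexx ler01.
case: s => //=; split=> [i|]; first by have /andP[] := h i.
rewrite (bigD1 j)//= big1 ?addr0 ?mxE ?eqxx// => i ij.
by rewrite mxE (negbTE ij).
Qed.

Lemma dot_normal_lt s n (l : flabel s n) : exists2 x : 'cV[R]_n.+1, ref_cell s n.+1 x &
  dot (facet_normal l) x < facet_height l.
Proof.
case: s l => [[i|]|[i [|]]].
- exists (delta_mx i 0); first exact: ref_cell_delta.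
  by rewrite dot_facet_normal_simplex mxE !eqxx oppr_lt0 ltr01.
- exists 0; first exact: ref_cell0.
  by rewrite dot0r ltr01.
- exists 0; first exact: ref_cell0.
  by rewrite dot0r ltr01.
- exists (delta_mx i 0); first exact: ref_cell_delta.
  by rewrite dot_facet_normal_cube mxE !eqxx mulN1r oppr_lt0 ltr01.
Qed.

Lemma facet_mapD s n (l : flabel s n) (y : 'cV[R]_n) :
  linpart (facet_map l) *m y = facet_map l y - facet_map l 0.
Proof. by rewrite /affine_fun mulmx0 add0r addrK. Qed.

Lemma facet_normal_orth s n (l : flabel s n) :
  (facet_normal l)^T *m linpart (facet_map l) = 0 :> 'rV[R]_n.
Proof.
apply/rowP => j; rewrite mxE.
have := facet_mapD l (delta_mx j 0); rewrite -colE => /(congr1 (dot (facet_normal l))).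
rewrite dotBr !dot_normal_facet_map subrr dot_colE => h; rewrite [RHS]mxE -[RHS]h.
by apply: eq_bigr => i _; rewrite !mxE.
Qed.

Lemma facet_projK s n (l : flabel s n) :
  linpart (facet_proj l) *m linpart (facet_map l) = 1%:M :> 'M[R]_n.
Proof.
have h y : linpart (facet_proj l) *m (facet_map l y) = y.
  by rewrite -[RHS](facet_mapK l) -[RHS]/(linpart (facet_proj l) *m (facet_map l y) + 0) addr0.
apply/matrixP => i j.
have : (linpart (facet_proj l) *m linpart (facet_map l)) *m delta_mx j (0 : 'I_1) = delta_mx j 0 :> 'cV[R]_n.
  by rewrite -mulmxA facet_mapD mulmxBr !h subr0.
by rewrite -colE => /colP /(_ i); rewrite [LHS]mxE => ->; rewrite !mxE eqxx andbT.
Qed.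

Lemma facet_normal_neq0 s n (l : flabel s n) : dot (facet_normal l) (facet_normal l) != 0 :> R.
Proof.
apply/eqP => /dot_eq0 h; have [x _] := @dot_normal_lt s n l.
have := dot_normal_facet_map l 0; rewrite h !dot0l => <-.
by rewrite ltxx.
Qed.

Lemma facet_proj_coord s n (l : flabel s n) (x : 'cV[R]_n.+1) j :
  facet_proj l x j 0 = x (lift (facet_index l) j) 0.
Proof.
transitivity (((ins_mx (facet_index l))^T *m x) j 0).
  by have /(congr1 (fun M : 'cV_n => M j 0)) := addr0 ((ins_mx (facet_index l))^T *m x).
rewrite mxE (bigD1 (lift (facet_index l) j))//= big1 ?addr0.
  by rewrite [_^T _ _]mxE [ins_mx _ _ _]mxE eqxx mul1r.
by move=> a aj; rewrite [_^T _ _]mxE [ins_mx _ _ _]mxE (negbTE aj) mul0r.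
Qed.

Lemma sum_lift n (i : 'I_n.+1) (F : 'I_n.+1 -> R) :
  \sum_j F j = F i + \sum_j F (lift i j).
Proof. by rewrite (bigD1_ord i). Qed.

Lemma some_facet_map_lift n i (y : 'cV[R]_n) j :
  facet_map (Some i : flabel simplex n) y (lift i j) 0 = y j 0.
Proof. exact: (facet_map_lift (Some i : flabel simplex n)). Qed.

Lemma none_facet_map_lift n (y : 'cV[R]_n) j :
  facet_map (None : flabel simplex n) y (lift ord0 j) 0 = y j 0.
Proof. exact: (facet_map_lift (None : flabel simplex n)). Qed.

Lemma cube_facet_map_lift n i b (y : 'cV[R]_n) j :
  facet_map ((i, b) : flabel hypercube n) y (lift i j) 0 = y j 0.
Proof. exact: (facet_map_lift ((i, b) : flabel hypercube n)). Qed.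

Lemma facet_map_indexE s n (l : flabel s n) (x : 'cV[R]_n.+1) :
  dot (facet_normal l) x = facet_height l -> facet_map l (facet_proj l x) = x.
Proof.
move=> hx; apply/colP => a.
have [j ->|->] := unliftP (facet_index l) a; first by rewrite facet_map_lift facet_proj_coord.
case: s l hx => [[i|]|[i b]] hx.
- rewrite simplex_facet_map0; move: hx; rewrite dot_facet_normal_simplex => /eqP.
  by rewrite oppr_eq0 => /eqP ->.
- have := simplex_facet_map_sum (facet_proj (None : flabel simplex n) x).
  rewrite -[RHS]hx dot_facet_normal_simplex_sum !big_ord_recl.
  set S := \sum_i _; set S' := \sum_i _.
  have -> : S = S'; last by move/addIr.
  apply: eq_bigr => i _; rewrite none_facet_map_lift.
  exact: (facet_proj_coord (None : flabel simplex n)).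
- rewrite cube_facet_map; move: hx; rewrite dot_facet_normal_cube /=.
  case: b => [|/eqP]; first by rewrite mul1r.
  by rewrite mulN1r oppr_eq0 => /eqP.
Qed.

Lemma ref_cell_facet s n (l : flabel s n) (x : 'cV[R]_n.+1) :
  (ref_cell s n.+1 x /\ dot (facet_normal l) x = facet_height l) <->
  (facet_map l @` ref_cell s n) x.
Proof.
split=> [[hx xl]|[y hy <-]].
  exists (facet_proj l x); last exact: facet_map_indexE.
  case: s l xl hx => l xl /=.
    move=> [x0 x1]; split=> [i|]; first by rewrite facet_proj_coord.
    under eq_bigr do rewrite facet_proj_coord.
    by apply: le_trans x1; rewrite (bigD1_ord (facet_index l))//= lerDr.
  by move=> hx i; rewrite facet_proj_coord.
split; last exact: dot_normal_facet_map.
case: s l hy => [l [y0 y1]|l hy].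
- split=> [a|].
    have [j ->|->] := unliftP (facet_index l) a; first by rewrite facet_map_lift.
    case: l => [i|]; first by rewrite simplex_facet_map0.
    by rewrite [facet_index _]/ord0 simplex_facet_mapE ins_mxE0 eqxx mul1r add0r subr_ge0.
  case: l => [i|]; last by rewrite simplex_facet_map_sum.
  rewrite (sum_lift i) simplex_facet_map0 add0r.
  by under eq_bigr do rewrite some_facet_map_lift.
- move=> a; have [j ->|->] := unliftP (facet_index l) a; first by rewrite facet_map_lift.
  by case: l => i b; rewrite cube_facet_map; case: b; rewrite ?lexx ?ler01.
Qed.

Lemma ref_facetsP s n (A : set 'cV[R]_n.+1) :
  ref_facets s n.+1 A <-> exists l : flabel s n, A = facet_map l @` ref_cell s n.
Proof.
have E (l : flabel s n) : facet_map l @` ref_cell s n =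
    ref_cell s n.+1 `&` [set x : 'cV[R]_n.+1 | dot (facet_normal l) x = facet_height l].
  by apply/seteqP; split=> x /ref_cell_facet.
case: s E => E; split.
- move=> [[i ->]|->]; [exists (Some i : flabel simplex n)|exists (None : flabel simplex n)].
    rewrite E; congr (_ `&` _); apply/seteqP; split=> x /=; rewrite dot_facet_normal_simplex.
      by move=> ->; rewrite oppr0.
    by move/eqP; rewrite oppr_eq0 => /eqP.
  by rewrite E; congr (_ `&` _); apply/seteqP; split=> x /=; rewrite dot_facet_normal_simplex_sum.
- move=> [[i|]] ->; [left; exists i|right]; rewrite E.
    congr (_ `&` _); apply/seteqP; split=> x /=; rewrite dot_facet_normal_simplex.
      by move/eqP; rewrite oppr_eq0 => /eqP.
    by move=> ->; rewrite oppr0.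
  by congr (_ `&` _); apply/seteqP; split=> x /=; rewrite dot_facet_normal_simplex_sum.
- move=> [i [b ->]]; exists ((i, b) : flabel hypercube n); rewrite E; congr (_ `&` _).
  apply/seteqP; split=> x /=; rewrite dot_facet_normal_cube; case: b => /=.
  + by move=> ->; rewrite mul1r.
  + by move=> ->; rewrite mulr0.
  + by rewrite mul1r.
  + by move/eqP; rewrite mulN1r oppr_eq0 => /eqP.
- move=> [[i b]] ->; exists i, b; rewrite E; congr (_ `&` _).
  apply/seteqP; split=> x /=; rewrite dot_facet_normal_cube; case: b => /=.
  + by rewrite mul1r.
  + by move/eqP; rewrite mulN1r oppr_eq0 => /eqP.
  + by move=> ->; rewrite mul1r.
  + by move=> ->; rewrite mulr0.
Qed.

(* The barycenter of a facet lies on no other facet. *)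
Lemma facet_barycenter s n (l : flabel s n) : exists2 y : 'cV[R]_n, ref_cell s n y &
  forall l', dot (facet_normal l') (facet_map l y : 'cV[R]_n.+1) = facet_height l' -> l' = l.
Proof.
case: s l => l.
(* With n coordinates equal to 1 / (n + 1), what is left to the sum 1 is 1 / (n + 1) as well; this
   excludes all other facets. *)
- pose a : R := n.+1%:R^-1.
  have a0 : 0 < a by rewrite invr_gt0 ltr0n.
  have sa : \sum_(i < n) (const_mx a : 'cV[R]_n) i 0 = 1 - a.
    under eq_bigr do rewrite mxE.
    rewrite sumr_const card_ord -[a *+ n]mulr_natl.
    have : n.+1%:R * a = 1 by rewrite mulfV// pnatr_eq0.
    by rewrite -natr1 mulrDl mul1r => h; rewrite -[X in X - a]h addrK.
  exists (const_mx a); first by split=> [i|]; rewrite ?mxE ?ltW// sa; lra.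
  case: l => [i|] [j|] //.
  + rewrite dot_facet_normal_simplex [facet_height _]/(0 : R); have [k ->|->//] := unliftP i j.
    by rewrite some_facet_map_lift mxE => h; move: a0; rewrite -oppr_lt0 h ltxx.
  + rewrite dot_facet_normal_simplex_sum (sum_lift i) simplex_facet_map0 add0r.
    under eq_bigr do rewrite some_facet_map_lift.
    by rewrite sa => /= h; exfalso; lra.
  + rewrite dot_facet_normal_simplex [facet_height _]/(0 : R) => /eqP; rewrite oppr_eq0 => /eqP h; exfalso.
    move: h; have [k ->|->] := unliftP ord0 j.
      by rewrite none_facet_map_lift mxE => h; lra.
    by rewrite simplex_facet_mapE ins_mxE0 eqxx mul1r add0r sa => h; lra.
- exists (const_mx (1 / 2)); first by move=> i; rewrite mxE; apply/andP; split; lra.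
  case: l => i b [j e] h.
  have {h} : (if e then 1 else -1 : R) * facet_map ((i, b) : flabel hypercube n) (const_mx (1 / 2)) j 0 =
    (if e then 1 else 0) :> R by rewrite -dot_facet_normal_cube.
  have [k ->|->] := unliftP i j.
    by rewrite cube_facet_map_lift mxE => h; exfalso; move: h; case: e => h; lra.
  by rewrite cube_facet_map; case: e; case: b => //= h; exfalso; lra.
Qed.

End reference_facet_geometry.

(** * Surface elements and normals under affine maps *)

Section gram_determinants.
Context {R : realType}.
Variable n : nat.
Implicit Types (u : 'cV[R]_n.+1) (B : 'M[R]_(n.+1, n)).

Lemma mul_trmx_dot u v : u^T *m v = (dot u v)%:M :> 'M[R]_1.
Proof.
rewrite [LHS]mx11_scalar mxE dot_colE; congr (_%:M).
by apply: eq_bigr => i _; rewrite mxE.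
Qed.

(** The Gram matrix of the columns u and B is block triangular by orthogonality, with determinant
    the square of that of (u, B). *)
Lemma gram_orth u B : u^T *m B = 0 ->
  dot u u * \det (B^T *m B) = \det (row_mx u B : 'M[R]_(1 + n)) ^+ 2.
Proof.
move=> uB; set M := row_mx u B.
have -> : \det M ^+ 2 = \det (M^T *m M) by rewrite det_mulmx det_tr expr2.
rewrite /M tr_row_mx mul_col_row uB.
by rewrite mul_trmx_dot (@det_lblock _ 1 n) det_scalar1.
Qed.

Lemma gram_neq0 B (P : 'M[R]_(n, n.+1)) : P *m B = 1%:M -> \det (B^T *m B) != 0.
Proof.
move=> PB; apply/det0P => -[v v0 h].
have /dot_eq0 h' : dot (B *m v^T) (B *m v^T) = 0.
  have E : B^T *m B *m v^T = (v *m (B^T *m B))^T by rewrite !trmx_mul trmxK.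
  by rewrite dot_mull mulmxA E h trmx0 dot0r.
have : P *m (B *m v^T) = v^T by rewrite mulmxA PB mul1mx.
by rewrite h' mulmx0 => /(congr1 trmx); rewrite trmxK trmx0 => v00; rewrite -v00 eqxx in v0.
Qed.

Variables (u : 'cV[R]_n.+1) (B : 'M[R]_(n.+1, n)) (P : 'M[R]_(n, n.+1)).
Hypothesis u0 : dot u u != 0.
Hypothesis uB : u^T *m B = 0.
Hypothesis PB : P *m B = 1%:M.

Lemma gram_gt0 : 0 < \det (B^T *m B).
Proof.
have up : 0 < dot u u by rewrite lt_def u0 dot_ge0.
rewrite lt_def (gram_neq0 PB) /=.
by rewrite -(pmulr_rge0 _ up) gram_orth// sqr_ge0.
Qed.

(** Together u and the columns of B span the space, and v minus its projection on u is orthogonal to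
    all of them. *)
Lemma orth_colinear (v : 'cV[R]_n.+1) : v^T *m B = 0 -> v = (dot v u / dot u u) *: u.
Proof.
move=> vB; apply/eqP; rewrite -subr_eq0; apply/eqP.
set v' := v - _.
have v'B : v'^T *m B = 0 by rewrite linearB /= linearZ /= mulmxBl vB -scalemxAl uB scaler0 subrr.
have v'u : v'^T *m u = 0 by rewrite mul_trmx_dot dotBl dotZl divfK// subrr raddf0.
have uM : (row_mx u B : 'M[R]_(1 + n)) \in unitmx.
  by rewrite unitmxE unitfE -sqrf_eq0 -gram_orth// mulf_neq0// gt_eqF// gram_gt0.
have : v'^T *m (row_mx u B : 'M[R]_(1 + n)) = 0.
  by rewrite mul_mx_row v'B v'u row_mx0.
move=> /(congr1 (mulmxr (invmx (row_mx u B : 'M[R]_(1 + n))))); rewrite /= mulmxK// mul0mx.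
by move=> /(congr1 trmx); rewrite trmxK trmx0.
Qed.

Variable J : 'M[R]_n.+1.
Hypothesis uJ : J \in unitmx.
Let w := (invmx J)^T *m u.

Lemma dot_cotransform (v : 'cV[R]_n.+1) : dot w (J *m v) = dot u v.
Proof. by rewrite /w dot_mull trmxK mulKmx. Qed.

Lemma cotransform_orth : w^T *m (J *m B) = 0.
Proof. by rewrite /w trmx_mul trmxK -mulmxA mulKmx. Qed.

Lemma cotransform_inv : (P *m invmx J) *m (J *m B) = 1%:M.
Proof. by rewrite -mulmxA mulKmx. Qed.

(** Nanson's formula, squared: areas scale by |det J| |J^-T u| / |u|. The product of (w, J B)^T with
    J (u, B) is block triangular, with diagonal blocks u . u and the Gram matrix of J B, which links
    the determinants. *)
Lemma gram_cotransform :
  \det ((J *m B)^T *m (J *m B)) * dot u u = dot w w * \det J ^+ 2 * \det (B^T *m B).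
Proof.
have h1 := gram_orth uB; have h2 := gram_orth cotransform_orth.
have h3 : \det (row_mx w (J *m B) : 'M[R]_(1 + n)) * (\det J * \det (row_mx u B : 'M[R]_(1 + n))) =
    dot u u * \det ((J *m B)^T *m (J *m B)).
  rewrite -det_mulmx -[\det (row_mx w (J *m B))]det_tr -det_mulmx (@mul_mx_row _ n.+1 n.+1 1 n).
  rewrite (@tr_row_mx _ n.+1 1 n) (@mul_col_row _ 1 n n.+1 1 n).
  by rewrite cotransform_orth mul_trmx_dot dot_cotransform (@det_lblock _ 1 n) det_scalar1.
have g0 := gram_neq0 cotransform_inv.
apply: (mulfI g0); apply: (mulfI u0).
set gJ := \det ((J *m B)^T *m (J *m B)) in h2 h3 g0 *.
have := congr1 (fun x => x ^+ 2) h3; rewrite !exprMn -h1 -h2 => h4.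
by rewrite -[LHS]/(dot u u * (gJ * (gJ * dot u u))); lra.
Qed.

End gram_determinants.

Section physical_facets.
Context {R : realType}.
Variables (s : cell_shape) (n : nat) (Phi : affine (R := R) n.+1 n.+1).
Hypothesis uJ : linpart Phi \in unitmx.
Variable l : flabel s n.
Local Notation J := (linpart Phi).
Local Notation Il := (linpart (facet_map l)).

Definition facet_param : affine (R := R) n n.+1 :=
  Affine (J *m Il) (J *m origin (facet_map l) + origin Phi).

Lemma facet_paramE y : facet_param y = Phi (facet_map l y).
Proof. by rewrite /affine_fun /= mulmxDr mulmxA addrA. Qed.

(** Normals transform by J^-T. It is left unnormalized because its length is the local factor of the
    surface element. *)
Definition conormal : 'cV[R]_n.+1 := (invmx J)^T *m facet_normal l.

Definition unit_normal : 'cV[R]_n.+1 := (enorm conormal)^-1 *: conormal.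

Lemma dot_conormal v : dot conormal (J *m v) = dot (facet_normal l) v.
Proof. exact: dot_cotransform. Qed.

Lemma dot_conormal_affine x y :
  dot conormal (Phi x - Phi y) = dot (facet_normal l) x - dot (facet_normal l) y.
Proof. by rewrite /affine_fun opprD addrACA subrr addr0 -mulmxBr dot_conormal dotBr. Qed.

Lemma conormal_neq0 : enorm conormal != 0.
Proof.
apply/eqP => /enorm_eq0 h; have := dot_conormal (facet_normal l).
by rewrite h dot0l => /esym/eqP; rewrite (negbTE (facet_normal_neq0 l)).
Qed.

Lemma conormal_gt0 : 0 < enorm conormal.
Proof. by rewrite lt_def conormal_neq0 enorm_ge0. Qed.

Lemma enorm_unit_normal : enorm unit_normal = 1.
Proof.
by rewrite enormZ ger0_norm ?invr_ge0 ?enorm_ge0// mulVf// conormal_neq0.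
Qed.

Lemma unit_normal_tangent x y : dot unit_normal (facet_param x - facet_param y) = 0.
Proof.
rewrite dotZl !facet_paramE dot_conormal_affine !dot_normal_facet_map.
by rewrite subrr mulr0.
Qed.

Lemma tangent_orth (m : 'cV[R]_n.+1) :
  (forall x y, ref_cell s n x -> ref_cell s n y -> dot m (facet_param x - facet_param y) = 0) ->
  exists r, m = r *: conormal.
Proof.
move=> h.
have mI : m^T *m (J *m Il) = 0.
  apply/rowP => j; rewrite mxE.
  have := h _ _ (ref_cell_delta s j) (ref_cell0 s n).
  rewrite /affine_fun mulmx0 add0r addrK -colE dot_colE => hj; rewrite [RHS]mxE -[RHS]hj.
  by apply: eq_bigr => i _; rewrite !mxE.
exists (dot m conormal / dot conormal conormal); apply: (@orth_colinear _ _ _ (J *m Il) (linpart (facet_proj l) *m invmx J)) => //.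
- by rewrite -enorm_sqr expf_neq0// conormal_neq0.
- apply: cotransform_orth => //; exact: facet_normal_orth.
- by apply: cotransform_inv => //; exact: facet_projK.
Qed.

(** The part of the surface element that depends on the reference facet only; it becomes the weight
    c_l. *)
Definition facet_gram : R := Num.sqrt (\det (Il^T *m Il)) / enorm (facet_normal l).

Lemma facet_gram_gt0 : 0 < facet_gram.
Proof.
apply: divr_gt0.
  rewrite sqrtr_gt0; apply: (@gram_gt0 _ _ (facet_normal l) _ (linpart (facet_proj l))).
  - exact: facet_normal_neq0.
  - exact: facet_normal_orth.
  - exact: facet_projK.
by rewrite sqrtr_gt0 lt_def facet_normal_neq0 dot_ge0.
Qed.

Lemma sqrt_gram : Num.sqrt (\det ((J *m Il)^T *m (J *m Il))) =
  `|\det J| * enorm conormal * facet_gram.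
Proof.
have := gram_cotransform (facet_normal_neq0 l) (facet_normal_orth l) (facet_projK l) uJ.
have nu0 : 0 < (dot (facet_normal l) (facet_normal l) : R) by rewrite lt_def facet_normal_neq0 dot_ge0.
move=> /(congr1 Num.sqrt); rewrite sqrtrM; last first.
  apply/ltW/(@gram_gt0 _ _ conormal _ (linpart (facet_proj l) *m invmx J)).
  - by rewrite -enorm_sqr expf_neq0// conormal_neq0.
  - apply: cotransform_orth => //; exact: facet_normal_orth.
  - by apply: cotransform_inv => //; exact: facet_projK.
rewrite -/conormal.
have h1 : 0 <= dot conormal conormal * \det J ^+ 2 by rewrite mulr_ge0 ?dot_ge0 ?sqr_ge0.
rewrite (sqrtrM _ h1) (sqrtrM _ (dot_ge0 conormal)) sqrtr_sqr.
rewrite -/(enorm conormal) -/(enorm (facet_normal l)) /facet_gram => h.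
have e0 : enorm (facet_normal l) != 0 :> R by rewrite gt_eqF// sqrtr_gt0.
by apply: (mulIf e0); rewrite h mulrA divfK//; ring.
Qed.

End physical_facets.

Lemma affine_compE {R : realType} m n p (f : affine (R := R) n p) (g : affine m n) y :
  Affine (linpart f *m linpart g) (linpart f *m origin g + origin f) y = f (g y).
Proof. by rewrite /affine_fun /= mulmxDr mulmxA addrA. Qed.

Section affine_on_ref_cell.
Context {R : realType}.
Variables (s : cell_shape) (m n : nat).

(** The cell contains 0 and the unit vectors, whose images determine an affine map. *)
Lemma affine_eq_ref_cell (f g : affine (R := R) m n) :
  (forall y, ref_cell s m y -> f y = g y) -> f = g.
Proof.
move=> fg.
have o : origin f = origin g.
  by have := fg _ (ref_cell0 s m); rewrite /affine_fun !mulmx0 !add0r.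
have L : linpart f = linpart g.
  apply/matrixP => i j; have := fg _ (ref_cell_delta s j).
  by rewrite /affine_fun o => /addIr; rewrite -!colE => /colP /(_ i); rewrite !mxE.
by case: f g o L {fg} => [? ?] [? ?] /= -> ->.
Qed.

End affine_on_ref_cell.

Section reparametrization.
Context {R : realType}.
Variables (s : cell_shape) (n : nat) (Phi : affine (R := R) n.+1 n.+1).
Hypothesis uJ : linpart Phi \in unitmx.
Variables (l : flabel s n) (PF : affine (R := R) n n.+1).
Hypothesis rPF : \rank (linpart PF) = n.
Hypothesis PFE : PF @` ref_cell s n = facet_param Phi l @` ref_cell s n.

(* The two parametrizations of the facet differ by an affine automorphism of
   the reference facet. *)
Lemma facet_reparam : exists A : affine (R := R) n n, [/\ linpart A \in unitmx,
  forall y, PF y = facet_param Phi l (A y) & forall y, ref_cell s n (A y) <-> ref_cell s n y].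
Proof.
pose P := linpart (facet_proj l) *m invmx (linpart Phi).
pose A := Affine (P *m linpart PF) (P *m (origin PF - origin Phi)).
have AE y : A y = facet_proj l (affine_inv Phi (PF y)).
  transitivity (P *m (PF y - origin Phi)).
    by rewrite /affine_fun /A [linpart (Affine _ _)]/= [origin (Affine _ _)]/= -mulmxA -mulmxDr addrA.
  by rewrite -[RHS]/(linpart (facet_proj l) *m (invmx (linpart Phi) *m (PF y - origin Phi)) + 0) addr0 mulmxA.
have psiK y : facet_proj l (affine_inv Phi (facet_param Phi l y)) = y.
  by rewrite facet_paramE affine_funK// facet_mapK.
have psiA y : ref_cell s n y -> PF y = facet_param Phi l (A y) /\ ref_cell s n (A y).
  move=> hy; have : (facet_param Phi l @` ref_cell s n) (PF y) by rewrite -PFE; exists y.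
  by move=> [y' hy' e]; rewrite AE -e psiK.
pose G := Affine (linpart (facet_param Phi l) *m linpart A)
  (linpart (facet_param Phi l) *m origin A + origin (facet_param Phi l)).
have GE y : G y = facet_param Phi l (A y).
  exact: affine_compE.
have PFG : PF = G by apply: (@affine_eq_ref_cell _ s) => y' /psiA[-> _]; rewrite GE.
have E y : PF y = facet_param Phi l (A y) by rewrite -GE -PFG.
have lE : linpart PF = linpart (facet_param Phi l) *m linpart A by rewrite PFG.
have uA : linpart A \in unitmx.
  have h := mxrankM_maxr (linpart (facet_param Phi l)) (linpart A).
  by rewrite -lE rPF in h; rewrite -row_full_unit /row_full eqn_leq rank_leq_row.
exists A; split=> // y; split=> [hA|/psiA[]//].
have : (PF @` ref_cell s n) (PF y) by rewrite PFE E; exists (A y).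
move=> [y' hy' e]; suff -> : y = y' by [].
have := congr1 (fun x => facet_proj l (affine_inv Phi x)) e; rewrite !E !psiK.
by rewrite /affine_fun => /addIr /(congr1 (mulmx (invmx (linpart A)))); rewrite !mulKmx.
Qed.

End reparametrization.

(** * Facets of the mesh and their normals *)

Section mesh_facets.
Context {R : realType}.
Variables (s : cell_shape) (n : nat) (Omega : set 'cV[R]_n.+1).
Variable T : triangulation s Omega.
Implicit Types (K : elt T) (F : facet T) (l : flabel s n).

Definition has_label K l F :=
  fset_of F = facet_param (PhiK K) l @` ref_cell s n.

Lemma facet_param_image K l :
  facet_param (PhiK K) l @` ref_cell s n = PhiK K @` (facet_map l @` ref_cell s n).
Proof.
apply/seteqP; split=> x.
  by move=> [y hy <-]; exists (facet_map l y); [exists y|rewrite facet_paramE].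
by move=> [_ [y hy <-] <-]; exists y => //; rewrite facet_paramE.
Qed.

Lemma facet_ofP K F : facet_of K F <-> exists l, has_label K l F.
Proof.
rewrite /facet_of; split.
  by move=> /asboolP[A /ref_facetsP[l ->] e]; exists l; rewrite /has_label -e facet_param_image.
move=> [l hl]; apply/asboolP; exists (facet_map l @` ref_cell s n).
  by apply/ref_facetsP; exists l.
by rewrite -facet_param_image; exact/esym.
Qed.

Lemma exists_facet K l : exists F, has_label K l F.
Proof.
have : (\bigcup_(K in [set: elt T]) facets_of s (PhiK K)) (facet_param (PhiK K) l @` ref_cell s n).
  exists K => //; exists (facet_map l @` ref_cell s n); last exact/esym/facet_param_image.
  by apply/ref_facetsP; exists l.
by rewrite -(facet_sets T) => -[F _ h]; exists F.
Qed.

Lemma has_label_inj K F l l' : has_label K l F -> has_label K l' F -> l = l'.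
Proof.
rewrite /has_label => h h'; have [y hy uy] := @facet_barycenter R s n l.
have : (facet_param (PhiK K) l @` ref_cell s n) (facet_param (PhiK K) l y) by exists y.
rewrite -h h' => -[y' _]; rewrite !facet_paramE => /(congr1 (affine_inv (PhiK K))).
rewrite !affine_funK ?PhiK_unit// => e.
by apply/esym/uy; rewrite -e dot_normal_facet_map.
Qed.

Definition facet_at K l : facet T := projT1 (cid (exists_facet K l)).

Lemma facet_atP K l : has_label K l (facet_at K l).
Proof. by rewrite /facet_at; case: cid. Qed.

(** Labels and mesh facets of K are in bijection: [facet_sets] gives existence, [facet_inj] and
    [has_label_inj] give uniqueness. *)
Lemma sum_facets K (G : facet T -> R) :
  \sum_(F | facet_of K F) G F = \sum_l G (facet_at K l).
Proof.
rewrite [RHS](partition_big (facet_at K) (facet_of K)) /=; last first.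
  by move=> l _; apply/facet_ofP; exists l; exact: facet_atP.
apply: eq_bigr => F /facet_ofP[l hl].
have FE : facet_at K l = F.
  apply: (@facet_inj _ _ _ _ T); have := facet_atP K l.
  by rewrite /has_label /fset_of => ->; exact/esym.
rewrite (big_pred1 l) ?FE// => l'; rewrite /= -FE.
apply/eqP/eqP => [e|->//].
by apply: (@has_label_inj K F); rewrite // /has_label -FE -e; exact: facet_atP.
Qed.

Section one_facet.
Variables (K : elt T) (l : flabel s n) (F : facet T).
Hypothesis hl : has_label K l F.
Local Notation psi := (facet_param (PhiK K) l).
Local Notation n0 := (unit_normal (PhiK K) l).
Let uJ := PhiK_unit K.

Lemma mesh_reparam : exists A : affine (R := R) n n, [/\ linpart A \in unitmx,
  forall y, PhiF F y = psi (A y) & forall y, ref_cell s n (A y) <-> ref_cell s n y].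
Proof. exact: (facet_reparam uJ (PhiF_rank F) hl). Qed.

(** The mesh parametrization of F differs from the one through K by an automorphism A of the
    reference facet; the factor |det A| in the surface element compensates the substitution y -> A
    y. *)
Lemma integral_facet_poly (f : 'cV[R]_n.+1 -> R) (p : mpoly n R) :
  (forall y, ref_cell s n y -> f (psi y) = peval p y) ->
  integral_facet F f = `|\det (linpart (PhiK K))| * enorm (conormal (PhiK K) l) *
    facet_gram l * ipoly s p.
Proof.
move=> fp; have [A [uA EA refA]] := mesh_reparam.
have lA : linpart (PhiF F) = linpart psi *m linpart A.
  have -> : PhiF F = Affine (linpart psi *m linpart A) (linpart psi *m origin A + origin psi).
    apply: (@affine_eq_ref_cell _ s) => y _; rewrite EA; exact/esym/(affine_compE psi).
  by [].
have gE (P : 'M[R]_(n.+1, n)) (M : 'M[R]_n) :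
    \det ((P *m M)^T *m (P *m M)) = \det M ^+ 2 * \det (P^T *m P).
  by rewrite trmx_mul mulmxA -(mulmxA M^T) 2!det_mulmx det_tr; ring.
rewrite -(sqrt_gram uJ) /integral_facet lA gE sqrtrM ?sqr_ge0// sqrtr_sqr.
have -> : integral_on (ref_cell s n) (fun y => f (PhiF F y)) =
    integral_on (ref_cell s n) (peval p \o A).
  by apply: eq_integral_on => y hy; rewrite EA fp//; apply/refA.
have imA : A @` ref_cell s n = ref_cell s n.
  apply/seteqP; split=> [_ [y hy <-]|y hy]; first exact/refA.
  exists (affine_inv A y); last by rewrite affine_invK.
  by apply/refA; rewrite affine_invK.
have [|_ E] := @integral_on_affine_image R n A (ref_cell s n) uA (@mset_ref_cell R s n) (peval p)
  (measurable_peval p).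
  apply: (@eq_integrable_on _ _ _ (peval (acomp A p))); first by move=> y _; rewrite peval_acomp.
    exact: mset_ref_cell.
  exact: integrable_on_peval.
by rewrite ipolyE -{2}imA E; ring.
Qed.

Lemma facet_tangent (m : 'cV[R]_n.+1) : (forall x y, fset_of F x -> fset_of F y -> dot m (x - y) = 0) ->
  exists r, m = r *: conormal (PhiK K) l.
Proof.
move=> h; apply: (tangent_orth uJ) => x y hx hy; apply: h; rewrite hl.
  by exists x.
by exists y.
Qed.

Lemma unit_normal_facet x y : fset_of F x -> fset_of F y -> dot n0 (x - y) = 0.
Proof. by rewrite hl => -[x' _ <-] [y' _ <-]; exact: unit_normal_tangent. Qed.

(** The unit normal is unique up to its sign, which enters twice. *)
Lemma tr_nE v : tr_n F v = dot v n0 *: n0.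
Proof.
have [n1 nt] : enorm (nF F) = 1 /\
    forall x y, fset_of F x -> fset_of F y -> dot (nF F) (x - y) = 0.
  apply: (@xgetPex _ 0 [set n : 'cV[R]_n.+1 | enorm n = 1 /\
    forall x y, fset_of F x -> fset_of F y -> dot n (x - y) = 0]).
  by exists n0; split; [exact: enorm_unit_normal|exact: unit_normal_facet].
have [r nE] := facet_tangent nt.
have w0 := @conormal_neq0 _ _ _ _ uJ l.
have r2 : r ^+ 2 = (enorm (conormal (PhiK K) l))^-1 ^+ 2.
  move: n1; rewrite nE enormZ => h; rewrite -(real_normK (num_real r)); congr (_ ^+ 2).
  by apply: (mulIf w0); rewrite h mulVf.
rewrite /tr_n nE /unit_normal !dotZr !scalerA; congr (_ *: _).
by rewrite mulrC mulrA -expr2 r2; ring.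
Qed.

(** The inequality for two points of F in both orders makes the vector normal to F; a point of K off
    the plane of F then fixes the sign. *)
Lemma outward_normalE : outward_normal K F = n0.
Proof.
have sub x : fset_of F x -> cell K x.
  rewrite hl => -[y hy <-]; rewrite facet_paramE; exists (facet_map l y) => //.
  by have /ref_cell_facet[] : (facet_map l @` ref_cell s n) (facet_map l y) by exists y.
have inw := @conormal_gt0 _ _ _ _ uJ l.
have [n1 nt] : enorm (outward_normal K F) = 1 /\
    forall x y, fset_of F x -> cell K y -> dot (outward_normal K F) (y - x) <= 0.
  apply: (@xgetPex _ 0 [set n : 'cV[R]_n.+1 | enorm n = 1 /\
    forall x y, fset_of F x -> cell K y -> dot n (y - x) <= 0]).
  exists n0; split; first exact: enorm_unit_normal.
  move=> x y; rewrite hl => -[x' hx' <-] [y' hy' <-].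
  rewrite facet_paramE dotZl dot_conormal_affine// dot_normal_facet_map.
  by rewrite pmulr_rle0 ?invr_gt0// subr_le0 dot_normal_le.
have [r nE] : exists r, outward_normal K F = r *: conormal (PhiK K) l.
  apply: facet_tangent => x y hx hy; apply/eqP; rewrite eq_le nt//=; last exact: sub.
  by rewrite -oppr_le0 -dotNr opprB nt//; exact: sub.
have [x hx xlt] := @dot_normal_lt R s n l.
have [y0 hy0] : exists y, ref_cell s n (y : 'cV[R]_n) by exists 0; exact: ref_cell0.
have : dot (outward_normal K F) (PhiK K x - psi y0) <= 0.
  by apply: nt; [rewrite hl; exists y0|exists x].
rewrite nE dotZl facet_paramE dot_conormal_affine// dot_normal_facet_map.
rewrite nmulr_lle0 ?subr_lt0// => r0.
move: n1; rewrite nE enormZ ger0_norm// => r1.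
rewrite /unit_normal; congr (_ *: _).
by apply: (mulIf (negbT (gt_eqF inw))); rewrite r1 mulVf// gt_eqF.
Qed.

Lemma M_facet_poly k w : M_facet k F w -> exists2 e : 'I_n.+1 -> mpoly n R,
  forall i, deg_lt k.+1 (e i) & forall y, ref_cell s n y -> w (psi y) = eval_vec e y.
Proof.
move=> [v hv hw]; have [A [uA EA refA]] := mesh_reparam.
pose A' := Affine (invmx (linpart A)) (- (invmx (linpart A) *m origin A)).
have A'E y : A' y = affine_inv A y by rewrite /affine_inv mulmxBr.
exists (fun i => acomp A' (v i)) => [i|y hy]; first by apply: deg_lt_acomp; exact: hv.
have hy' : ref_cell s n (A' y) by apply/refA; rewrite A'E affine_invK.
have -> : psi y = PhiF F (A' y) by rewrite EA A'E affine_invK.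
by rewrite hw//; apply/colP => i; rewrite !mxE -[RHS]/(peval _ _) peval_acomp.
Qed.

End one_facet.

End mesh_facets.

(** * Pull-back of the discrete spaces to the reference element *)

Section element_polynomials.
Context {R : realType}.
Variables (s : cell_shape) (n k : nat) (Omega : set 'cV[R]_n.+1).
Variable T : triangulation s Omega.
Variable K : elt T.
Local Notation Phi := (PhiK K).
Local Notation J := (linpart (PhiK K)).
Let uJ : J \in unitmx := PhiK_unit K.

Lemma eval_vecE m p (v : 'I_m -> mpoly p R) x i : eval_vec v x i 0 = peval (v i) x.
Proof. by rewrite mxE. Qed.

Lemma integral_cell_poly (f : 'cV[R]_n.+1 -> R) (p : mpoly n.+1 R) :
  (forall y, f (Phi y) = peval p y) ->
  [/\ measurable_fun setT (f \o @vec R n.+1), integrable_on (cell K) f &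
      integral_on (cell K) f = `|\det J| * ipoly s p].
Proof.
move=> fp.
pose Phi' := Affine (invmx J) (- (invmx J *m origin Phi)).
have mf : measurable_fun setT (f \o @vec R n.+1).
  rewrite (_ : _ \o _ = peval (acomp Phi' p) \o @vec R n.+1); first exact: measurable_peval.
  apply/funext => t; rewrite /= peval_acomp -fp; congr f.
  have -> : Phi' (vec t) = affine_inv Phi (vec t) by rewrite /affine_inv mulmxBr.
  by rewrite affine_invK.
have [|i E] := integral_on_affine_image uJ (@mset_ref_cell R s n.+1) mf.
  apply: (@eq_integrable_on _ _ _ (peval p)); first by move=> y _; rewrite /= fp.
    exact: mset_ref_cell.
  exact: integrable_on_peval.
split=> //; rewrite E ipolyE; congr (_ * _).
by apply: eq_integral_on => y _; rewrite /= fp.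
Qed.

Lemma L2_cell_poly (f : 'cV[R]_n.+1 -> R) (p : mpoly n.+1 R) :
  (forall y, f (Phi y) = peval p y) -> L2 (cell K) f.
Proof.
move=> fp; have [mf _ _] := integral_cell_poly fp; split; first exact: measurable_funTS.
have [|_ /integrableP[_ h] _] := @integral_cell_poly (fun x => f x ^+ 2) (p * p).
  by move=> y; rewrite fp pevalM expr2.
apply: le_lt_trans h; rewrite le_eqVlt; apply/orP; left; apply/eqP.
by apply: eq_integral => t _; rewrite /= ger0_norm// sqr_ge0.
Qed.

Lemma le_ipoly p (u v : mpoly p R) : (forall y, ref_cell s p y -> peval u y <= peval v y) ->
  ipoly s u <= ipoly s v.
Proof.
move=> uv; rewrite -subr_ge0 -ipolyB; apply: ipoly_ge0 => y hy.
by rewrite pevalB subr_ge0 uv.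
Qed.

Lemma poly_ref_cell_eq0 p (u : mpoly p R) : (forall y, ref_cell s p y -> peval u y = 0) -> u = 0.
Proof.
move=> u0; apply: (@ipoly_sqr_eq0 _ s); rewrite ipolyE.
rewrite (@eq_integral_on _ _ _ _ (peval 0)); last first.
  by move=> y /u0 h; rewrite pevalM h mul0r peval0.
by rewrite -ipolyE ipoly0.
Qed.

Lemma ref_V_scale c (v : 'I_n.+1 -> mpoly n.+1 R) : ref_V s k v ->
  ref_V s k (fun i => c *: v i).
Proof.
move=> hv; have := ref_V_comb (1 - c) hv hv; congr (ref_V _ _ _); apply/funext => i.
by rewrite scalerBl scale1r opprB addrC subrK.
Qed.

(** The factor 1 / det J of the Piola map is absorbed into zeta, so that the gradient transforms by
    conjugation with J. *)
Lemma V_elt_poly w : V_elt k K w -> exists2 zeta, ref_V s k zeta &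
  forall y, w (Phi y) = J *m eval_vec zeta y.
Proof.
move=> [v hv wE]; exists (fun i => (\det J)^-1 *: v i); first exact: ref_V_scale.
move=> y; rewrite wE /piola -/(affine_inv Phi _) affine_funK// scalemxAr; congr (_ *m _).
by apply/colP => i; rewrite [LHS]mxE !eval_vecE pevalZ.
Qed.

Lemma is_derive_affine_inv (f : 'cV[R]_n.+1 -> R) y v df :
  is_derive y (invmx J *m v) f df -> is_derive (Phi y) v (f \o affine_inv Phi) df.
Proof.
have E : (fun h : R => h^-1 *: ((f \o affine_inv Phi \o shift (Phi y)) (h *: v) - (f \o affine_inv Phi) (Phi y))) =
    (fun h : R => h^-1 *: ((f \o shift y) (h *: (invmx J *m v)) - f y)).
  apply/funext => h; rewrite /= affine_funK//; congr (_ *: (f _ - _)).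
  by rewrite /affine_inv -addrA mulmxDr -scalemxAr -/(affine_inv Phi (Phi y)) affine_funK.
by move=> [d1 d2]; split; [rewrite /derivable E|rewrite /derive E].
Qed.

Lemma grad_cell_poly w zeta (y : 'cV[R]_n.+1) : (forall y, w (Phi y) = J *m eval_vec zeta y) ->
  grad w (Phi y) = J *m (\matrix_(a, b) peval (mderiv b (zeta a)) y) *m invmx J.
Proof.
move=> wE; apply/matrixP => i j; rewrite mxE /partial.
pose p := \sum_a J i a *: zeta a.
have -> : (fun x => w x i 0) = peval p \o affine_inv Phi.
  apply/funext => x; rewrite -{1}(affine_invK uJ x) wE mxE /= peval_sum.
  by apply: eq_bigr => a _; rewrite eval_vecE pevalZ.
have [_ ->] := is_derive_affine_inv (is_derive_peval y (invmx J *m delta_mx j 0) p).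
rewrite -colE [RHS]mxE; apply: eq_bigr => b _; rewrite [col _ _ _ _]mxE; congr (_ * _).
rewrite mxE /p raddf_sum peval_sum; apply: eq_bigr => a _ /=.
by rewrite mderivZ pevalZ mxE.
Qed.

(** Row i is (J^-1)_(a, i) J v, a multiple of the Piola image of v. The factor J^-T e_a is dual to z
    = J zeta and isolates row a of the reference gradient. *)
Definition test_tensor a (v : 'I_n.+1 -> mpoly n.+1 R) (x : 'cV[R]_n.+1) : 'M[R]_n.+1 :=
  (invmx J)^T *m delta_mx a (0 : 'I_1) *m (J *m eval_vec v (affine_inv Phi x))^T.

Lemma test_tensorE a v y :
  test_tensor a v (Phi y) = (invmx J)^T *m delta_mx a (0 : 'I_1) *m (J *m eval_vec v y)^T.
Proof. by rewrite /test_tensor affine_funK. Qed.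

Hypothesis n12 : n = 1%N \/ n = 2%N.

Lemma ref_Grow_scale c (v : 'I_n.+1 -> mpoly n.+1 R) : ref_Grow s k v ->
  ref_Grow s k (fun i => c *: v i).
Proof.
case: s => /= [hv i|[p [q [hp hq hv]]]]; first by apply: deg_ltZ; exact: hv.
exists (fun i => c *: p i), (fun i => c *: q i); split=> [i||i].
- by apply: deg_ltZ; exact: hp.
- case: n12 => e; move: q hq {hv}; rewrite e => q /=.
    have gen a b (u1 u2 : mpoly 2 R) : c *: (a *: u1 + b *: u2) = (c * a) *: u1 + (c * b) *: u2.
      by rewrite scalerDr !scalerA.
    by move=> [a [b h]]; exists (c * a), (c * b) => i; rewrite h; apply: gen.
  move=> [q1 [q2 [q3 [h1 h2 h3 h]]]].
  have curlZ (F G : 'I_3 -> mpoly 3 R) i : (forall j, F j = c *: G j) -> curl3 F i = c *: curl3 G i.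
    move=> FG; rewrite /curl3 !(tnth_nth 0).
    by case: (ord3P i) => ->/=; rewrite !FG !mderivZ scalerBr.
  exists (c *: q1), (c *: q2), (c *: q3); split; [exact: rpredZ|exact: rpredZ|exact: rpredZ|] => i.
  rewrite h !scalerDr; congr (_ + _ + _); apply/esym/curlZ => j;
    by rewrite comp_mpolyZ -scalerAr -scalerAl.
- by rewrite hv scalerDr.
Qed.

Lemma G_elt_test_tensor a v : ref_Grow s k v -> G_elt k K (test_tensor a v).
Proof.
move=> hv i; exists (fun b => (\det J * (invmx J) a i) *: v b); first exact: ref_Grow_scale.
move=> x; rewrite /piola -/(affine_inv Phi x).
have -> : eval_vec (fun b => (\det J * (invmx J) a i) *: v b) (affine_inv Phi x) =
    (\det J * (invmx J) a i) *: eval_vec v (affine_inv Phi x).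
  by apply/colP => b; rewrite [RHS]mxE !eval_vecE pevalZ.
have d0 : \det J != 0 by move: uJ; rewrite unitmxE unitfE.
rewrite -scalemxAr scalerA mulrA mulVf// mul1r.
apply/colP => b; rewrite [LHS]mxE [LHS]mxE /test_tensor [LHS]mxE big_ord1 -colE.
by rewrite [RHS]mxE; congr (_ * _); rewrite !mxE.
Qed.

Lemma G_elt0 : G_elt k K (fun=> 0).
Proof.
move=> i; exists (fun=> 0) => [|x].
  by apply: ref_Grow_poly => // j; rewrite /poly_le mmeasure0.
rewrite /piola (_ : eval_vec _ _ = 0) ?mulmx0 ?scaler0; first by rewrite linear0 trmx0.
by apply/colP => j; rewrite eval_vecE peval0 mxE.
Qed.

Lemma dot_col_eval m (v : 'I_m -> mpoly n.+1 R) y :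
  dot (eval_vec v y) (eval_vec v y) = peval (\sum_b v b * v b) y.
Proof. by rewrite dot_colE peval_sum; apply: eq_bigr => b _; rewrite pevalM !eval_vecE. Qed.

Lemma dot_grad_test a zeta v y :
  dot (J *m (\matrix_(a, b) peval (mderiv b (zeta a)) y) *m invmx J)
      ((invmx J)^T *m delta_mx a (0 : 'I_1) *m (J *m eval_vec v y)^T) =
  peval (\sum_b mderiv b (zeta a) * v b) y.
Proof.
set D := \matrix_(_, _) _.
rewrite dot_mulr dot_mull trmx_mul.
have -> : J^T *m ((invmx J)^T *m delta_mx a (0 : 'I_1) *m ((eval_vec v y)^T *m J^T) *m (invmx J)^T) =
    delta_mx a 0 *m (eval_vec v y)^T.
  have h : J^T *m (invmx J)^T = 1%:M by rewrite -trmx_mul mulVmx// trmx1.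
  by rewrite -!mulmxA h mulmx1 !mulmxA h mul1mx.
rewrite peval_sum /dot (bigD1 a)//= [X in _ + X]big1 ?addr0; last first.
  move=> i ia; rewrite big1// => b _; rewrite [X in _ * X]mxE big_ord1.
  by rewrite [delta_mx _ _ _ _]mxE (negbTE ia) mul0r mulr0.
apply: eq_bigr => b _; rewrite pevalM mxE; congr (_ * _).
by rewrite mxE big_ord1 !mxE !eqxx mul1r.
Qed.

End element_polynomials.

(** * Scaling of forms and norms on one element *)

Section diameters.
Context {R : realType}.

Lemma affineB m n (f : affine (R := R) m n) x y : f x - f y = linpart f *m (x - y).
Proof. by rewrite /affine_fun opprD addrACA subrr addr0 -mulmxBr. Qed.

Lemma le_diam m (A : set 'cV[R]_m) (M : R) x y :
  (forall x y, A x -> A y -> enorm (x - y) <= M) -> A x -> A y -> enorm (x - y) <= diam A.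
Proof.
move=> AM Ax Ay; apply: ub_le_sup; last by exists x => //; exists y.
by exists M => _ [x' Ax' [y' Ay' <-]]; exact: AM.
Qed.

Lemma enorm_ref_cell s n (x y : 'cV[R]_n) : ref_cell s n x -> ref_cell s n y ->
  enorm (x - y) <= n%:R.
Proof.
move=> hx hy; have := @enorm_le_coef R n 1 (x - y) 1 ler01; rewrite muln1 mulr1; apply => i j.
rewrite [j]ord1 !mxE ler_norml.
have /andP[x0 x1] := ref_cell_coord hx i; have /andP[y0 y1] := ref_cell_coord hy i.
by apply/andP; split; lra.
Qed.

End diameters.

Section element_bound.
Context {R : realType}.
Variables (s : cell_shape) (n k : nat) (Omega : set 'cV[R]_n.+1).
Variable T : triangulation s Omega.
Variable K : elt T.
Local Notation Phi := (PhiK K).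
Local Notation J := (linpart (PhiK K)).
Let uJ : J \in unitmx := PhiK_unit K.
Hypothesis n12 : n = 1%N \/ n = 2%N.

Lemma le_diam_cell x y : cell K x -> cell K y -> enorm (x - y) <= diam (cell K).
Proof.
apply: (@le_diam _ _ _ (enorm J * n.+1%:R)) => _ _ [x' hx' <-] [y' hy' <-].
rewrite affineB.
by apply: (le_trans (enorm_mul _ _)); rewrite ler_wpM2l ?enorm_ge0// (enorm_ref_cell hx' hy').
Qed.

Lemma facet_cell l x : fset_of (facet_at K l) x -> cell K x.
Proof.
rewrite (facet_atP K l) => -[y hy <-]; rewrite facet_paramE; exists (facet_map l y) => //.
by have /ref_cell_facet[] : (facet_map l @` ref_cell s n) (facet_map l y) by exists y.
Qed.

(* A facet contains the image of a vector of length at least 1. *)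
Lemma hF_ge l : 1 <= enorm (invmx J) * hF (facet_at K l).
Proof.
have n0 : (0 < n)%N by case: n12 => ->.
pose j := Ordinal n0; pose u := linpart (facet_map l) *m delta_mx j (0 : 'I_1) : 'cV[R]_n.+1.
have u1 : 1 <= enorm u.
  apply: le_trans (enorm_ge_coef u (lift (facet_index l) j) 0).
  rewrite /u facet_mapD [X in `|X|]mxE [X in _ + X]mxE !facet_map_lift !mxE !eqxx subr0.
  by rewrite normr1.
apply: (le_trans u1); rewrite -{1}(mulKmx uJ u); apply: (le_trans (enorm_mul _ _)).
rewrite ler_wpM2l ?enorm_ge0//.
have -> : J *m u = facet_param Phi l (delta_mx j 0) - facet_param Phi l 0.
  by rewrite !facet_paramE affineB /u facet_mapD.
apply: (@le_diam _ _ _ (diam (cell K))).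
- by move=> x y /facet_cell hx /facet_cell hy; exact: le_diam_cell.
- by rewrite (facet_atP K l); exists (delta_mx j 0) => //; exact: ref_cell_delta.
- by rewrite (facet_atP K l); exists 0 => //; exact: ref_cell0.
Qed.

Lemma hF_inv_le l : (hF (facet_at K l))^-1 <= enorm (invmx J).
Proof.
have h := hF_ge l.
have h0 : 0 < hF (facet_at K l).
  rewrite ltNge; apply/negP => h0; have := le_trans h (ler_wpM2l (enorm_ge0 _) h0).
  by rewrite mulr0 ler10.
by rewrite -[leLHS]mul1r ler_pdivrMr.
Qed.

Lemma hF_ge0 l : 0 <= (hF (facet_at K l))^-1.
Proof.
rewrite invr_ge0 leNgt; apply/negP => h0.
have := le_trans (hF_ge l) (ler_wpM2l (enorm_ge0 _) (ltW h0)).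
by rewrite mulr0 ler10.
Qed.

(** On the facet nu_l . x is constant, so the normal component of x q has the degree of q. On the
    hypercube the normal selects one component, in which x_i is 0 or 1. *)
Lemma normal_trace_deg (zeta : 'I_n.+1 -> mpoly n.+1 R) (l : flabel s n) : ref_V s k zeta ->
  deg_lt k.+1 (\sum_b facet_normal l b 0 *: trace l (zeta b)).
Proof.
have addsum (u v : 'I_n.+1 -> R) : \sum_b u b + \sum_b v b = \sum_b (u b + v b).
  by rewrite big_split.
move: l; case: s => l [p [q [hp hq hz]]].
- have -> : \sum_b facet_normal l b 0 *: trace l (zeta b) =
      \sum_b facet_normal l b 0 *: trace l (p b) + (facet_height l : R) *: trace l q.
    apply: peval_inj => y; rewrite pevalD pevalZ peval_trace !peval_sum -(dot_normal_facet_map l y) dot_colE.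
    rewrite mulr_suml -big_split; apply: eq_bigr => b _.
    rewrite !pevalZ !peval_trace hz pevalD pevalM pevalXU /=; ring.
  apply: deg_ltD; last by apply/deg_ltZ/deg_lt_acomp; exact: homog_deg_lt.
  by apply: deg_lt_sum => b _; apply/deg_ltZ/deg_lt_acomp; exact: hp.
- apply: deg_lt_sum => b _; case: l => i e.
  have [->|bi] := eqVneq b i; last by rewrite !mxE (negbTE bi) mulr0 scale0r; exact: deg_lt0.
  apply: deg_ltZ; rewrite hz.
  have -> : trace ((i, e) : flabel hypercube n) (p i + mpolyX R (mnm1 i) * q i) =
      trace ((i, e) : flabel hypercube n) (p i) + (e%:R : R) *: trace ((i, e) : flabel hypercube n) (q i).
    apply: peval_inj => y; rewrite pevalD pevalZ !peval_trace pevalD pevalM pevalXU.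
    by rewrite cube_facet_map.
  apply: deg_ltD; first by apply: deg_lt_acomp; exact: hp.
  by apply/deg_ltZ/deg_lt_acomp; exact: homog_deg_lt (hq i).
Qed.

Variables (w : 'cV[R]_n.+1 -> 'cV[R]_n.+1) (zhat : facet T -> 'cV[R]_n.+1 -> 'cV[R]_n.+1).
Hypothesis hw : V_elt k K w.
Hypothesis hzhat : Mh_t k zhat.
Let D F x := tr_t F (w x) - zhat F x.

Lemma dot_unit_normal (l : flabel s n) : dot (unit_normal Phi l) (unit_normal Phi l) = 1.
Proof. by rewrite -enorm_sqr enorm_unit_normal// expr1n. Qed.

Lemma dot_unit_normalJ (l : flabel s n) v : dot (unit_normal Phi l) (J *m v) =
  (enorm (conormal Phi l))^-1 * dot (facet_normal l) v.
Proof. by rewrite /unit_normal dotZl dot_conormal. Qed.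

Lemma zhat_tangent l x : fset_of (facet_at K l) x ->
  dot (unit_normal Phi l) (zhat (facet_at K l) x) = 0.
Proof.
move=> hx; have [_ /(_ x hx)] := hzhat (facet_at K l).
rewrite (tr_nE (facet_atP K l)) => /(congr1 (dot (unit_normal Phi l))).
by rewrite dotZr dot_unit_normal mulr1 dot0r dotC.
Qed.

Lemma jump_tangent l x : fset_of (facet_at K l) x ->
  dot (unit_normal Phi l) (D (facet_at K l) x) = 0.
Proof.
move=> hx; rewrite /D dotBr zhat_tangent// subr0 /tr_t dotBr (tr_nE (facet_atP K l)).
by rewrite dotZr dot_unit_normal mulr1 [dot (w x) _]dotC subrr.
Qed.

Lemma facet_param_fset l y : ref_cell s n y -> fset_of (facet_at K l) (facet_param Phi l y).
Proof. by move=> hy; rewrite (facet_atP K l); exists y. Qed.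

(* The jump pulls back to a tangential field which is the trace of the field on
   the reference element up to a polynomial of degree k. *)
Lemma reference_pair : exists x : refpair (R := R) s n, [/\ admissible k x,
  forall y, w (Phi y) = J *m eval_vec x.1 y &
  forall l y, ref_cell s n y -> D (facet_at K l) (facet_param Phi l y) = J *m eval_vec (x.2 l) y].
Proof.
have [zeta hzeta wE] := V_elt_poly hw.
have /choice[e he] : forall l, exists e : 'I_n.+1 -> mpoly n R, (forall i, deg_lt k.+1 (e i)) /\
    forall y, ref_cell s n y -> zhat (facet_at K l) (facet_param Phi l y) = eval_vec e y.
  move=> l; have [hM _] := hzhat (facet_at K l).
  by have [e h1 h2] := M_facet_poly (facet_atP K l) hM; exists e.
(* E is J^-1 applied to the normal part of the trace of w plus [zhat], so that delta is J^-1 applied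
   to the jump. *)
pose alpha (l : flabel s n) i := (enorm (conormal Phi l))^-1 * (invmx J *m unit_normal Phi l) i 0.
pose E (l : flabel s n) i := alpha l i *: \sum_b facet_normal l b 0 *: trace l (zeta b) +
  \sum_j invmx J i j *: e l j.
pose delta (l : flabel s n) i := trace l (zeta i) - E l i.
have deltaE l y : ref_cell s n y ->
    eval_vec (delta l) y = invmx J *m D (facet_at K l) (facet_param Phi l y).
  move=> hy; rewrite /D /tr_t (tr_nE (facet_atP K l)) [dot (w _) _]dotC.
  rewrite facet_paramE wE dot_unit_normalJ -facet_paramE (he l).2//.
  rewrite !mulmxBr mulKmx// -scalemxAr; apply/colP => i.
  have E1 : peval (\sum_b facet_normal l b 0 *: trace l (zeta b)) y =
      dot (facet_normal l) (eval_vec zeta (facet_map l y)).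
    rewrite peval_sum dot_colE; apply: eq_bigr => b _.
    by rewrite pevalZ peval_trace eval_vecE.
  have E2 : peval (\sum_j invmx J i j *: e l j) y = (invmx J *m eval_vec (e l) y) i 0.
    by rewrite peval_sum [RHS]mxE; apply: eq_bigr => j _; rewrite pevalZ eval_vecE.
  rewrite eval_vecE /delta /E pevalB pevalD pevalZ peval_trace E1 E2 opprD addrA.
  rewrite [RHS]mxE [X in _ = X + _]mxE eval_vecE [X in _ = _ + X + _]mxE [(- (invmx J *m eval_vec (e l) y)) i 0]mxE.
  by congr (_ - _ - _); rewrite [RHS]mxE /alpha; ring.
exists (zeta, delta); split=> //=.
  split=> [//|l|l i].
  - apply: (@poly_ref_cell_eq0 _ s) => y hy.
    have := jump_tangent (facet_param_fset l hy).
    have -> : D (facet_at K l) (facet_param Phi l y) = J *m eval_vec (delta l) y.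
      by rewrite deltaE// mulKVmx.
    rewrite dot_unit_normalJ => /eqP; rewrite mulf_eq0 invr_eq0 (negbTE (conormal_neq0 uJ l)) /=.
    move=> /eqP h; rewrite -[RHS]h dot_colE peval_sum; apply: eq_bigr => b _.
    by rewrite pevalZ eval_vecE.
  - exists (E l i) => //; apply: deg_ltD; first by apply: deg_ltZ; exact: normal_trace_deg.
    by apply: deg_lt_sum => j _; apply: deg_ltZ; exact: (he l).1.
by move=> l y hy; rewrite deltaE// mulKVmx.
Qed.

Section pulled_back.
Variable x : refpair (R := R) s n.
Hypothesis wE : forall y, w (Phi y) = J *m eval_vec x.1 y.
Hypothesis DE : forall l y, ref_cell s n y ->
  D (facet_at K l) (facet_param Phi l y) = J *m eval_vec (x.2 l) y.
Let G (l : flabel s n) := `|\det J| * enorm (conormal Phi l) * facet_gram l.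

(** All of J cancels except |det J|. On a facet, the length of the conormal in the surface element
    cancels the normalization of the outward normal. *)
Lemma element_form (r : 'cV[R]_n.+1 -> 'M[R]_n.+1) a v :
  integral_on (cell K) (fun x => dot (r x) (test_tensor K a v x)) -
  integral_on (cell K) (fun x => dot (grad w x) (test_tensor K a v x)) +
  \sum_(F | facet_of K F) integral_facet F (fun x =>
    dot (D F x) (tr_t F (test_tensor K a v x *m outward_normal K F))) = 0 ->
  integral_on (cell K) (fun x => dot (r x) (test_tensor K a v x)) =
  `|\det J| * ref_form (@facet_gram R s n) x a v.
Proof.
move=> h.
have [_ _ I1] : [/\ measurable_fun setT ((fun x => dot (grad w x) (test_tensor K a v x)) \o @vec R n.+1),
    integrable_on (cell K) (fun x => dot (grad w x) (test_tensor K a v x)) &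
    integral_on (cell K) (fun x => dot (grad w x) (test_tensor K a v x)) =
    `|\det J| * ipoly s (\sum_b mderiv b (x.1 a) * v b)].
  apply: integral_cell_poly => y.
  by rewrite (grad_cell_poly _ wE) test_tensorE dot_grad_test.
have I2 l : integral_facet (facet_at K l) (fun x => dot (D (facet_at K l) x)
      (tr_t (facet_at K l) (test_tensor K a v x *m outward_normal K (facet_at K l)))) =
    `|\det J| * (facet_gram l * \sum_b facet_normal l b 0 * ipoly s (x.2 l a * trace l (v b))).
  have cw := conormal_neq0 uJ l.
  rewrite (integral_facet_poly (facet_atP K l) (p := (enorm (conormal Phi l))^-1 *:
      \sum_b facet_normal l b 0 *: (x.2 l a * trace l (v b)))).
    rewrite ipolyZ ipoly_sum; under eq_bigr do rewrite ipolyZ.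
    by field.
  move=> y hy; rewrite (outward_normalE (facet_atP K l)) /tr_t (tr_nE (facet_atP K l)).
  (* The jump is tangential, so the tangential projection of the test may be dropped. *)
  rewrite dotBr dotZr [dot (D _ _) (unit_normal _ _)]dotC jump_tangent ?mulr0 ?subr0; last exact: facet_param_fset.
  rewrite DE// facet_paramE test_tensorE -[_ *m unit_normal _ _]mulmxA mul_trmx_dot [dot (J *m _) (unit_normal _ _)]dotC dot_unit_normalJ.
  rewrite mul_mx_scalar dotZr dot_mull mulmxA -trmx_mul mulVmx// trmx1 mul1mx.
  have -> : dot (eval_vec (x.2 l) y) (delta_mx a 0) = peval (x.2 l a) y.
    rewrite dot_colE (bigD1 a)//= big1 ?addr0 => [|i ia]; first by rewrite eval_vecE !mxE !eqxx mulr1.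
    by rewrite [delta_mx _ _ _ _]mxE (negbTE ia) mulr0.
  rewrite pevalZ peval_sum dot_colE -mulrA mulr_suml; congr (_ * _); apply: eq_bigr => b _.
  by rewrite pevalZ pevalM peval_trace eval_vecE; ring.
move: h; rewrite I1 (sum_facets K) (eq_bigr _ (fun l _ => I2 l)).
rewrite -mulr_sumr -addrA -mulrN -mulrDr => /eqP; rewrite addr_eq0 => /eqP ->.
rewrite -mulrN opprD opprK; congr (_ * _).
rewrite /ref_form /weak sumrB -ipoly_sum exchange_big; congr (_ - _).
by apply: eq_bigr => l _; rewrite mulr_sumr; apply: eq_bigr => b _; rewrite mulrA.
Qed.

Lemma sqnorm_mulJ m (v : 'I_n.+1 -> mpoly m R) y : dot (J *m eval_vec v y) (J *m eval_vec v y) =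
  peval (\sum_i (\sum_a J i a *: v a) * (\sum_a J i a *: v a)) y.
Proof.
rewrite dot_colE peval_sum; apply: eq_bigr => i _; rewrite pevalM.
by congr (_ * _); rewrite mxE peval_sum; apply: eq_bigr => a _; rewrite pevalZ eval_vecE.
Qed.

Lemma elt_sqnorm_grad_le : elt_sqnorm K (grad w) <= `|\det J| *
  (dot J J * dot (invmx J) (invmx J) * \sum_a \sum_b ipoly s (mderiv b (x.1 a) * mderiv b (x.1 a))).
Proof.
pose p i j := \sum_b \sum_a (J i a * invmx J b j) *: mderiv b (x.1 a).
have pE i j y : grad w (Phi y) i j = peval (p i j) y.
  rewrite (grad_cell_poly _ wE) mxE peval_sum; apply: eq_bigr => b _.
  rewrite mxE mulr_suml peval_sum; apply: eq_bigr => a _.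
  by rewrite pevalZ mxE; ring.
rewrite /elt_sqnorm; have [_ _ ->] : [/\ measurable_fun setT ((fun x => enorm (grad w x) ^+ 2) \o @vec R n.+1),
    integrable_on (cell K) (fun x => enorm (grad w x) ^+ 2) &
    integral_on (cell K) (fun x => enorm (grad w x) ^+ 2) =
    `|\det J| * ipoly s (\sum_i \sum_j p i j * p i j)].
  apply: integral_cell_poly => y; rewrite enorm_sqr peval_sum; apply: eq_bigr => i _.
  by rewrite peval_sum; apply: eq_bigr => j _; rewrite pevalM !pE.
rewrite ler_wpM2l//.
have -> : \sum_a \sum_b ipoly s (mderiv b (x.1 a) * mderiv b (x.1 a)) =
    ipoly s (\sum_a \sum_b mderiv b (x.1 a) * mderiv b (x.1 a)).
  by rewrite ipoly_sum; apply: eq_bigr => a _; rewrite ipoly_sum.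
rewrite -ipolyZ; apply: le_ipoly => y _.
rewrite pevalZ; set D' := \matrix_(a, b) peval (mderiv b (x.1 a)) y : 'M[R]_n.+1.
have -> : peval (\sum_i \sum_j p i j * p i j) y = dot (J *m D' *m invmx J) (J *m D' *m invmx J).
  rewrite -(grad_cell_poly _ wE) peval_sum; apply: eq_bigr => i _.
  by rewrite peval_sum; apply: eq_bigr => j _; rewrite pevalM !pE.
have -> : peval (\sum_a \sum_b mderiv b (x.1 a) * mderiv b (x.1 a)) y = dot D' D'.
  rewrite peval_sum; apply: eq_bigr => i _.
  by rewrite peval_sum; apply: eq_bigr => j _; rewrite pevalM !mxE.
apply: (le_trans (enorm_sqr_mul _ _)); rewrite mulrAC ler_wpM2r ?dot_ge0//.
exact: enorm_sqr_mul.
Qed.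

(** One factor |J^-1| comes from h_F^-1, another from the conormal in the surface element, and the
    jump J delta contributes |J|^2. Thus the weight h_F^-1 gives the jumps the scaling of the
    gradient. *)
Lemma facet_sqnorm_jump_le l :
  (hF (facet_at K l))^-1 * facet_sqnorm (facet_at K l) (D (facet_at K l)) <= `|\det J| *
  (dot J J * dot (invmx J) (invmx J) * (enorm (facet_normal l) * facet_gram l) *
   \sum_a ipoly s (x.2 l a * x.2 l a)).
Proof.
have -> : facet_sqnorm (facet_at K l) (D (facet_at K l)) = G l *
    ipoly s (\sum_i (\sum_a J i a *: x.2 l a) * (\sum_a J i a *: x.2 l a)).
  apply: (integral_facet_poly (facet_atP K l)) => y hy.
  by rewrite enorm_sqr DE// sqnorm_mulJ.
have le1 : ipoly s (\sum_i (\sum_a J i a *: x.2 l a) * (\sum_a J i a *: x.2 l a)) <=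
    dot J J * \sum_a ipoly s (x.2 l a * x.2 l a).
  rewrite -ipoly_sum -ipolyZ; apply: le_ipoly => y _.
  rewrite -sqnorm_mulJ pevalZ; apply: (le_trans (enorm_sqr_mul _ _)).
  by rewrite ler_wpM2l ?dot_ge0// dot_colE peval_sum; apply: ler_sum => b _; rewrite pevalM !eval_vecE.
have le2 : enorm (conormal Phi l) <= enorm (invmx J) * enorm (facet_normal l).
  by rewrite -(enorm_trmx (invmx J)); exact: enorm_mul.
have g0 := @facet_gram_gt0 R s n l.
have G0 : 0 <= G l.
  by apply: mulr_ge0; [apply: mulr_ge0; [exact: normr_ge0|exact: enorm_ge0]|exact: ltW].
have S0 : 0 <= \sum_a ipoly s (x.2 l a * x.2 l a) by apply: sumr_ge0 => a _; exact: ipoly_sqr_ge0.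
apply: (@le_trans _ _ (enorm (invmx J) * (G l * (dot J J * \sum_a ipoly s (x.2 l a * x.2 l a))))).
  apply: ler_pM; [exact: hF_ge0| |exact: hF_inv_le|].
    apply: mulr_ge0; first exact: G0.
    apply: ipoly_ge0 => y _; rewrite peval_sum; apply: sumr_ge0 => i _.
    by rewrite pevalM -expr2 sqr_ge0.
  by rewrite ler_wpM2l.
rewrite /G -(enorm_sqr (invmx J)).
set S := \sum_a _ in S0 *; set u := enorm (conormal _ _) in le2 *.
rewrite [leLHS](_ : _ = (`|\det J| * enorm (invmx J) * facet_gram l * dot J J * S) * u); last by ring.
rewrite [leRHS](_ : _ = (`|\det J| * enorm (invmx J) * facet_gram l * dot J J * S) *
  (enorm (invmx J) * enorm (facet_normal l))); last by ring.
apply: ler_wpM2l le2; apply: mulr_ge0 S0; apply: mulr_ge0; last exact: dot_ge0.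
apply: mulr_ge0; last exact: ltW.
by apply: mulr_ge0; [exact: normr_ge0|exact: enorm_ge0].
Qed.

End pulled_back.

End element_bound.

(** * The estimate on one element *)

Section element_estimate.
Context {R : realType}.
Variables (s : cell_shape) (n k : nat) (Omega : set 'cV[R]_n.+1).
Variable T : triangulation s Omega.
Variable K : elt T.
Local Notation Phi := (PhiK K).
Local Notation J := (linpart (PhiK K)).
Let uJ : J \in unitmx := PhiK_unit K.
Hypothesis n12 : n = 1%N \/ n = 2%N.

(** The squared condition number of J in the Frobenius norm. *)
Definition distortion : R := dot J J * dot (invmx J) (invmx J).

Lemma distortion_ge0 : 0 <= distortion.
Proof. by apply: mulr_ge0; exact: dot_ge0. Qed.

Lemma test_tensor_coef a v y i j : test_tensor K a v (Phi y) i j =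
  peval (invmx J a i *: \sum_b J j b *: v b) y.
Proof.
rewrite test_tensorE mxE big_ord1 -colE !mxE pevalZ peval_sum; congr (_ * _).
by apply: eq_bigr => b _; rewrite pevalZ eval_vecE.
Qed.

Lemma test_tensor_sqnorm_le a v :
  integral_on (cell K) (fun x => dot (test_tensor K a v x) (test_tensor K a v x)) <=
  `|\det J| * (distortion * \sum_b ipoly s (v b * v b)).
Proof.
pose p i j := invmx J a i *: \sum_b J j b *: v b.
have pE y : dot (test_tensor K a v (Phi y)) (test_tensor K a v (Phi y)) =
    peval (\sum_i \sum_j p i j * p i j) y.
  rewrite peval_sum; apply: eq_bigr => i _; rewrite peval_sum; apply: eq_bigr => j _.
  by rewrite pevalM !test_tensor_coef.
have [_ _ ->] := @integral_cell_poly R s n Omega T K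
  (fun x => dot (test_tensor K a v x) (test_tensor K a v x)) _ pE.
rewrite ler_wpM2l// -ipoly_sum -ipolyZ; apply: le_ipoly => y _.
rewrite -pE pevalZ -dot_col_eval test_tensorE; apply: (le_trans (enorm_sqr_mul _ _)).
rewrite /distortion mulrC -mulrA.
apply: (@le_trans _ _ ((dot J J * dot (eval_vec v y) (eval_vec v y)) * dot (invmx J) (invmx J))).
  apply: ler_pM; rewrite ?dot_ge0//.
    by rewrite -enorm_sqr enorm_trmx enorm_sqr; exact: enorm_sqr_mul.
  apply: (le_trans (enorm_sqr_mul _ _)); rewrite -enorm_sqr enorm_trmx enorm_sqr.
  rewrite [X in _ * X](_ : _ = 1) ?mulr1//.
  rewrite dot_colE (bigD1 a)//= big1 ?addr0 => [|i ia]; first by rewrite !mxE !eqxx mulr1.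
  by rewrite !mxE (negbTE ia) mulr0.
by rewrite le_eqVlt; apply/orP; left; apply/eqP; ring.
Qed.

Lemma test_tensor_L2 a v i j : L2 (cell K) (fun x => test_tensor K a v x i j).
Proof. by apply: L2_cell_poly => y; exact: test_tensor_coef. Qed.

Variables (w : 'cV[R]_n.+1 -> 'cV[R]_n.+1) (zhat : facet T -> 'cV[R]_n.+1 -> 'cV[R]_n.+1).
Variable r : 'cV[R]_n.+1 -> 'M[R]_n.+1.
Hypothesis hw : V_elt k K w.
Hypothesis hzhat : Mh_t k zhat.
Hypothesis hr : forall i j, L2 (cell K) (fun x => r x i j).
Let D F x := tr_t F (w x) - zhat F x.
Hypothesis weak_gradient : forall a v, ref_Grow s k v ->
  integral_on (cell K) (fun x => dot (r x) (test_tensor K a v x)) -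
  integral_on (cell K) (fun x => dot (grad w x) (test_tensor K a v x)) +
  \sum_(F | facet_of K F) integral_facet F (fun x =>
    dot (D F x) (tr_t F (test_tensor K a v x *m outward_normal K F))) = 0.
Variable C : R.
Hypothesis hC : forall x e, 0 <= e -> admissible k x ->
  (forall a v, ref_Grow s k v ->
     ref_form (@facet_gram R s n) x a v ^+ 2 <= e * \sum_b ipoly s (v b * v b)) ->
  ref_sqnorm x <= C * e.

Definition facet_weight : R := \sum_(l : flabel s n) enorm (facet_normal l : 'cV[R]_n.+1) * facet_gram l.

Lemma facet_weight_term_ge0 (l : flabel s n) :
  0 <= enorm (facet_normal l : 'cV[R]_n.+1) * facet_gram l.
Proof. by rewrite mulr_ge0 ?enorm_ge0// ltW// facet_gram_gt0. Qed.

Lemma facet_weight_ge0 : 0 <= facet_weight.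
Proof. by apply: sumr_ge0 => l _; exact: facet_weight_term_ge0. Qed.

(** One factor [distortion] is the cost of the test tensor, the other that of mapping gradient and
    jumps back to K; the powers of |det J| cancel. *)
Lemma element_estimate : elt_sqnorm K (grad w) +
  \sum_(F | facet_of K F) (hF F)^-1 * facet_sqnorm F (D F) <=
  (1 + facet_weight) * C * distortion ^+ 2 * elt_sqnorm K r.
Proof.
have [x [hx wE DE]] := reference_pair hw hzhat.
have d0 : 0 < `|\det J| by rewrite normr_gt0 -unitfE -unitmxE.
have rE : elt_sqnorm K r = integral_on (cell K) (fun x => dot (r x) (r x)).
  by apply: eq_integral_on => y _; rewrite enorm_sqr.
have r0 : 0 <= elt_sqnorm K r by rewrite rE; apply: integral_on_ge0 => y _; exact: dot_ge0.
(* By Cauchy-Schwarz, |det J|^2 times the squared form is at most the squared norm of r times |det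
   J| [distortion] |v|^2; division by |det J|^2 leaves e |v|^2. *)
pose e := `|\det J|^-1 * distortion * elt_sqnorm K r.
have e0 : 0 <= e by rewrite /e; apply: mulr_ge0 => //; apply: mulr_ge0; [rewrite invr_ge0|exact: distortion_ge0].
have mK : mset (cell K) by apply: mset_affine_image => //; exact: mset_ref_cell.
have hs : ref_sqnorm x <= C * e.
  apply: hC => // a v hv.
  have := integral_on_dot_cauchy_schwarz mK hr (test_tensor_L2 a v).
  rewrite -rE (element_form hzhat wE DE (@weak_gradient a v hv)) exprMn => h.
  have {h} := le_trans h (ler_wpM2l r0 (test_tensor_sqnorm_le a v)).
  rewrite -(ler_pM2l (exprn_gt0 2 (_ : 0 < `|\det J|^-1))) ?invr_gt0// => h.
  have dn : `|\det J| != 0 by rewrite gt_eqF.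
  have -> : ref_form (@facet_gram R s n) x a v ^+ 2 =
      `|\det J|^-1 ^+ 2 * (`|\det J| ^+ 2 * ref_form (@facet_gram R s n) x a v ^+ 2).
    by rewrite mulrA -exprMn mulVf// expr1n mul1r.
  apply: (le_trans h); rewrite /e le_eqVlt; apply/orP; left; apply/eqP.
  by field.
set S1 := \sum_a \sum_b ipoly s (mderiv b (x.1 a) * mderiv b (x.1 a)).
pose S2 l := \sum_a ipoly s (x.2 l a * x.2 l a).
have S10 : 0 <= S1 by apply: sumr_ge0 => ? _; apply: sumr_ge0 => ? _; exact: ipoly_sqr_ge0.
have S20 l : 0 <= S2 l by apply: sumr_ge0 => ? _; exact: ipoly_sqr_ge0.
have nE : ref_sqnorm x = S1 + \sum_l S2 l by [].
rewrite sum_facets.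
apply: (@le_trans _ _ (`|\det J| * distortion * ((1 + facet_weight) * ref_sqnorm x))).
  apply: (@le_trans _ _ (`|\det J| * (distortion * S1) + \sum_l
      `|\det J| * (distortion * (enorm (facet_normal l : 'cV[R]_n.+1) * facet_gram l) * S2 l))).
    apply: lerD; first exact: (elt_sqnorm_grad_le wE).
    by apply: ler_sum => l _; exact: (facet_sqnorm_jump_le n12 DE).
  have -> : \sum_l `|\det J| * (distortion * (enorm (facet_normal l : 'cV[R]_n.+1) * facet_gram l) * S2 l) =
      `|\det J| * distortion * \sum_l enorm (facet_normal l : 'cV[R]_n.+1) * facet_gram l * S2 l.
    by rewrite mulr_sumr; apply: eq_bigr => l _; rewrite !mulrA.
  rewrite (mulrA _ distortion S1) -mulrDr; apply: ler_wpM2l.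
    by apply: mulr_ge0; [exact: normr_ge0|exact: distortion_ge0].
  rewrite nE.
  have le1 : \sum_l enorm (facet_normal l : 'cV[R]_n.+1) * facet_gram l * S2 l <=
      facet_weight * \sum_l S2 l.
    rewrite mulr_sumr; apply: ler_sum => l _; rewrite ler_wpM2r//.
    rewrite /facet_weight (bigD1 l)// lerDl; apply: sumr_ge0 => l' _.
    exact: facet_weight_term_ge0.
  have S0 : 0 <= \sum_l S2 l by apply: sumr_ge0 => l _.
  have := mulr_ge0 facet_weight_ge0 S10; lra.
have A0 : 0 <= `|\det J| * distortion * (1 + facet_weight).
  by apply: mulr_ge0; [rewrite mulr_ge0 ?distortion_ge0|rewrite addr_ge0 ?facet_weight_ge0].
rewrite mulrA; apply: (le_trans (ler_wpM2l A0 hs)).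
rewrite le_eqVlt; apply/orP; left; apply/eqP; rewrite /e.
have dn : `|\det J| != 0 by rewrite gt_eqF.
by field.
Qed.

End element_estimate.

(** * Shape regularity bounds the distortion *)

Section shape_regularity.
Context {R : realType}.
Variables (s : cell_shape) (n : nat) (Omega : set 'cV[R]_n.+1).
Variable T : triangulation s Omega.
Variable K : elt T.
Local Notation Phi := (PhiK K).
Local Notation J := (linpart (PhiK K)).
Let uJ : J \in unitmx := PhiK_unit K.

Lemma cell_ref_cell0 : cell K (Phi 0).
Proof. by exists 0 => //; exact: ref_cell0. Qed.

(** The degenerate ball makes the set whose supremum is [inscribed_diam] nonempty. *)
Lemma ball0_cell : [set x | enorm (x - Phi 0) <= 0] `<=` cell K.
Proof.
move=> x /= x0; have /enorm_eq0/subr0_eq-> : enorm (x - Phi 0) = 0 by apply/le_anti; rewrite x0 enorm_ge0.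
exact: cell_ref_cell0.
Qed.

Lemma diam_cell_ge0 : 0 <= diam (cell K).
Proof. exact: le_trans (enorm_ge0 _) (le_diam_cell cell_ref_cell0 cell_ref_cell0). Qed.

(** The columns of J are differences of vertices of K; the factor comes from bounding the norm by
    the entries. *)
Lemma enorm_linpart_le : enorm J <= (n.+1 * n.+1)%:R * diam (cell K).
Proof.
apply: enorm_le_coef => [|i j]; first exact: diam_cell_ge0.
have -> : J i j = (Phi (delta_mx j 0) - Phi 0) i 0 by rewrite affineB subr0 -colE mxE.
apply: (le_trans (enorm_ge_coef _ _ _)); apply: le_diam_cell cell_ref_cell0.
by exists (delta_mx j 0) => //; exact: ref_cell_delta.
Qed.

Lemma enorm_delta j : enorm (delta_mx j 0 : 'cV[R]_n.+1) = 1.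
Proof.
rewrite /enorm dot_colE (bigD1 j)//= big1 ?addr0 => [|i ij]; last by rewrite mxE (negbTE ij) mulr0.
by rewrite mxE !eqxx mulr1 sqrtr1.
Qed.

(* The preimage of a ball of radius r lies in the unit cube. *)
Lemma ball_enorm_invmx_le (r : R) c : 0 <= r -> [set x | enorm (x - c) <= r] `<=` cell K ->
  2 * r * enorm (invmx J) <= (n.+1 * n.+1)%:R.
Proof.
move=> r0 rK; rewrite -[2 * r]ger0_norm ?mulr_ge0// -enormZ -[leRHS]mulr1.
apply: enorm_le_coef => // i j.
have hp (e : R) : `|e| = 1 -> cell K (c + (e * r) *: delta_mx j 0).
  by move=> e1; apply: rK; rewrite /= [c + _]addrC addrK enormZ normrM e1 enorm_delta mul1r mulr1 ger0_norm.
have [y hy yE] := hp 1 (normr1 _).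
have [y' hy' y'E] : cell K (c + (-1 * r) *: delta_mx j 0) by apply: hp; rewrite normrN1.
have -> : (2 * r *: invmx J) i j = y i 0 - y' i 0.
  have : J *m (y - y') = (2 * r) *: delta_mx j 0.
    rewrite -affineB yE y'E opprD addrACA subrr add0r -scalerBl; congr (_ *: _); ring.
  move=> /(congr1 (mulmx (invmx J))); rewrite mulKmx// -scalemxAr -colE => /matrixP/(_ i 0).
  by rewrite !mxE => ->.
have /andP[a0 a1] := ref_cell_coord hy i; have /andP[b0 b1] := ref_cell_coord hy' i.
by rewrite ler_norml; apply/andP; split; lra.
Qed.

Lemma enorm_invmx_gt0 : 0 < enorm (invmx J).
Proof.
rewrite lt_neqAle enorm_ge0 andbT eq_sym; apply/eqP => /enorm_eq0 J0.
by have := mulmxV uJ; rewrite J0 mulmx0 => /matrixP/(_ 0 0)/eqP; rewrite !mxE eqxx eq_sym oner_eq0.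
Qed.

Lemma inscribed_diam_le : inscribed_diam (cell K) <= (n.+1 * n.+1)%:R / enorm (invmx J).
Proof.
apply: ge_sup.
  exists (2 * 0), 0 => //; split=> //; exists (Phi 0); exact: ball0_cell.
move=> _ [r [r0 [c hc]] <-]; rewrite ler_pdivlMr ?enorm_invmx_gt0//.
exact: ball_enorm_invmx_le hc.
Qed.

(** With d = [n.+1], |J| is at most d^2 times the diameter of K, and the inscribed diameter is at
    most d^2 / |J^-1|; shape regularity compares the two diameters. *)
Lemma distortion_le sigma : shape_regular T sigma ->
  distortion K <= ((n.+1 * n.+1)%:R ^+ 2 * `|sigma|) ^+ 2.
Proof.
move=> hT; rewrite /distortion -!enorm_sqr -exprMn.
have i0 := enorm_invmx_gt0; have d0 : (0 : R) <= (n.+1 * n.+1)%:R by exact: ler0n.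
have J0 : 0 <= enorm J := enorm_ge0 _.
rewrite ler_pXn2r ?nnegrE ?mulr_ge0 ?exprn_ge0//; last exact: ltW.
have insc0 : 0 <= inscribed_diam (cell K).
  apply: ub_le_sup.
    exists ((n.+1 * n.+1)%:R / enorm (invmx J)) => _ [r [r0 [c hc]] <-].
    by rewrite ler_pdivlMr//; exact: ball_enorm_invmx_le hc.
  exists 0; last by rewrite mulr0.
  split=> //; exists (Phi 0); exact: ball0_cell.
have h1 : diam (cell K) <= `|sigma| * ((n.+1 * n.+1)%:R / enorm (invmx J)).
  apply: (le_trans (hT K)); apply: (le_trans (ler_norm _)); rewrite normrM (ger0_norm insc0).
  by apply: ler_wpM2l => //; exact: inscribed_diam_le.
have := le_trans enorm_linpart_le (ler_wpM2l d0 h1).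
rewrite !mulrA ler_pdivlMr// => h; apply: (le_trans h).
by rewrite le_eqVlt; apply/orP; left; apply/eqP; ring.
Qed.

End shape_regularity.

(** * Summation over the mesh *)

Section mesh_estimate.
Context {R : realType}.
Variables (s : cell_shape) (n k : nat).
Hypothesis n12 : n = 1%N \/ n = 2%N.

Lemma integral_on0 m (A : set 'cV[R]_m) : integral_on A (fun=> 0) = 0.
Proof. by rewrite /integral_on /Rintegral integral0. Qed.

Section test.
Variables (Omega : set 'cV[R]_n.+1) (T : triangulation s Omega).
Variables (r : broken T 'M[R]_n.+1) (z : broken T 'cV[R]_n.+1).
Variable zhat : facet T -> 'cV[R]_n.+1 -> 'cV[R]_n.+1.
Hypothesis weak_gradient : forall g : broken T 'M[R]_n.+1, Gh k g ->
  inner_mesh r g - inner_mesh (fun K => grad (z K)) g +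
  inner_boundary
    (fun K F x => tr_t F (z K x) - zhat F x)
    (fun K F x => tr_t F (g K x *m outward_normal K F)) = 0.

(** Functions in G_h may jump across facets, so the test tensor of K extends by zero to the other
    elements. *)
Lemma weak_gradient_elt K a v : ref_Grow s k v ->
  integral_on (cell K) (fun x => dot (r K x) (test_tensor K a v x)) -
  integral_on (cell K) (fun x => dot (grad (z K) x) (test_tensor K a v x)) +
  \sum_(F | facet_of K F) integral_facet F (fun x =>
    dot (tr_t F (z K x) - zhat F x) (tr_t F (test_tensor K a v x *m outward_normal K F))) = 0.
Proof.
move=> hv.
pose g : broken T 'M[R]_n.+1 := fun K' => if K' == K then test_tensor K a v else fun=> 0.
have gE : g K = test_tensor K a v by rewrite /g eqxx.
have g0 K' : K' != K -> g K' = fun=> 0 by rewrite /g => /negbTE ->.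
have hg : Gh k g.
  move=> K'; have [->|KK'] := eqVneq K' K; first by rewrite gE; exact: G_elt_test_tensor.
  by rewrite g0//; exact: G_elt0.
have E1 (u : broken T 'M[R]_n.+1) : inner_mesh u g =
    integral_on (cell K) (fun x => dot (u K x) (test_tensor K a v x)).
  rewrite /inner_mesh (bigD1 K)//= [X in _ + X]big1 ?addr0 ?gE// => K' KK'.
  by rewrite g0// -(integral_on0 (cell K')); apply: eq_integral_on => x _; rewrite dot0r.
have := weak_gradient hg; rewrite !E1 /inner_boundary (bigD1 K)//= gE.
rewrite [X in _ + (_ + X)]big1 ?addr0// => K' KK'; apply: big1 => F _.
rewrite g0// /integral_facet (_ : integral_on _ _ = 0) ?mulr0//.
rewrite -[RHS](integral_on0 (ref_cell s n)); apply: eq_integral_on => x _.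
rewrite mul0mx (_ : tr_t F 0 = 0) ?dot0r//.
by rewrite /tr_t /tr_n dotC dot0r scale0r subr0.
Qed.

End test.

Lemma mesh_estimate (sigma : R) : exists2 B : R, 0 <= B &
  forall (Omega : set 'cV[R]_n.+1) (T : triangulation s Omega) (hT : shape_regular T sigma)
    (r : broken T 'M[R]_n.+1) (z : broken T 'cV[R]_n.+1)
    (zhat : facet T -> 'cV[R]_n.+1 -> 'cV[R]_n.+1),
  L2_mesh r -> Vh_div k z -> Mh_t k zhat ->
  (forall g : broken T 'M[R]_n.+1, Gh k g ->
     inner_mesh r g - inner_mesh (fun K => grad (z K)) g +
     inner_boundary
       (fun K F x => tr_t F (z K x) - zhat F x)
       (fun K F x => tr_t F (g K x *m outward_normal K F)) = 0) ->
  \sum_K elt_sqnorm K (grad (z K)) +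
  \sum_F (hF F)^-1 * \sum_(K | facet_of K F) facet_sqnorm F (fun x => tr_t F (z K x) - zhat F x)
  <= B * inner_mesh r r.
Proof.
have [C C0 hC] := @reference_estimate R s n k (@facet_gram R s n) n12
  (fun l => lt0r_neq0 (@facet_gram_gt0 R s n l)).
pose W := (1 + @facet_weight R s n) * C.
have W0 : 0 <= W by rewrite mulr_ge0// addr_ge0// facet_weight_ge0.
pose M := ((n.+1 * n.+1)%:R ^+ 2 * `|sigma|) ^+ 2 : R.
exists (W * M ^+ 2) => [|Omega T hT r z zhat hr [hz _] hzhat weq].
  by rewrite mulr_ge0// exprn_ge0// sqr_ge0.
have -> : inner_mesh r r = \sum_K elt_sqnorm K (r K).
  by apply: eq_bigr => K _; apply: eq_integral_on => x _; rewrite enorm_sqr.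
(* Each facet term is attributed to the element whose trace it contains, so that the element
   estimates can be summed. *)
have -> : \sum_F (hF F)^-1 * \sum_(K | facet_of K F)
      facet_sqnorm F (fun x => tr_t F (z K x) - zhat F x) =
    \sum_K \sum_(F | facet_of K F)
      (hF F)^-1 * facet_sqnorm F (fun x => tr_t F (z K x) - zhat F x).
  rewrite [RHS](exchange_big_dep xpredT)//; apply: eq_bigr => F _.
  by rewrite mulr_sumr.
rewrite -big_split mulr_sumr; apply: ler_sum => K _.
have := element_estimate n12 (hz K) hzhat (hr K)
  (fun a v hv => weak_gradient_elt weq K a hv) hC.
move=> /le_trans; apply; apply: ler_wpM2r.
  by apply: integral_on_ge0 => x _; exact: sqr_ge0.
by rewrite ler_wpM2l// ler_pXn2r ?nnegrE ?distortion_ge0 ?sqr_ge0//; exact: distortion_le hT.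
Qed.

End mesh_estimate.

Theorem theorem2p1 (R : realType) (k : nat) (sigma : R) :
  exists C : R,
  forall (d : nat) (hd : d = 2%N \/ d = 3%N) (s : cell_shape)
    (Omega : set 'cV[R]_d) (hOmega : polytope Omega)
    (T : triangulation s Omega) (hT : shape_regular T sigma)
    (r : broken T 'M[R]_d) (z : broken T 'cV[R]_d)
    (zhat : facet T -> 'cV[R]_d -> 'cV[R]_d),
  L2_mesh r -> Vh_div k z -> Mh_t k zhat ->
  (forall g : broken T 'M[R]_d, Gh k g ->
     inner_mesh r g - inner_mesh (fun K => grad (z K)) g +
     inner_boundary
       (fun K F x => tr_t F (z K x) - zhat F x)
       (fun K F x => tr_t F (g K x *m outward_normal K F)) = 0) ->
  Num.sqrt
    (\sum_K elt_sqnorm K (grad (z K)) +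
     \sum_F (hF F)^-1 *
       \sum_(K | facet_of K F)
         facet_sqnorm F (fun x => tr_t F (z K x) - zhat F x))
  <= C * norm_mesh r.
Proof.
have ex s n (n12 : n = 1%N \/ n = 2%N) := @mesh_estimate R s n k n12 sigma.
have [B1 B10 h1] := ex simplex 1%N (or_introl erefl).
have [B2 B20 h2] := ex simplex 2%N (or_intror erefl).
have [B3 B30 h3] := ex hypercube 1%N (or_introl erefl).
have [B4 B40 h4] := ex hypercube 2%N (or_intror erefl).
(* The sum dominates each of the four constants, one for each cell shape and dimension. *)
pose B := B1 + B2 + B3 + B4.
have B0 : 0 <= B by rewrite /B !addr_ge0.
have le_sqrt (b S Q : R) : b <= B -> 0 <= Q -> S <= b * Q -> Num.sqrt S <= Num.sqrt B * Num.sqrt Q.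
  move=> bB Q0 SQ; rewrite -sqrtrM// ler_wsqrtr//; apply: (le_trans SQ).
  exact: ler_wpM2r.
have inner0 d s (Omega : set 'cV[R]_d) (T : triangulation s Omega) (r : broken T 'M[R]_d) :
    0 <= inner_mesh r r.
  by apply: sumr_ge0 => K _; apply: integral_on_ge0 => x _; exact: dot_ge0.
exists (Num.sqrt B) => d hd s Omega hOmega T hT r z zhat hr hz hzhat weq.
case: hd => ed; subst d; case: s T hT r z zhat hr hz hzhat weq => T hT r z zhat hr hz hzhat weq.
- by apply: (le_sqrt _ _ _ _ _ (h1 _ _ hT _ _ _ hr hz hzhat weq)) => //; rewrite /B; lra.
- by apply: (le_sqrt _ _ _ _ _ (h3 _ _ hT _ _ _ hr hz hzhat weq)) => //; rewrite /B; lra.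
- by apply: (le_sqrt _ _ _ _ _ (h2 _ _ hT _ _ _ hr hz hzhat weq)) => //; rewrite /B; lra.
- by apply: (le_sqrt _ _ _ _ _ (h4 _ _ hT _ _ _ hr hz hzhat weq)) => //; rewrite /B; lra.
Qed.
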